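(* For all integers $n\ge1$ and $k\ge1$, the set $wSL(n)_k$ of $w_k$-equivalence classes of $n$-component welded string links, endowed with the stacking product, is a finitely generated group.
   Context: **Welded string links.** A virtual diagram is a planar immersed 1-manifold with finitely many transverse double points, each decorated as a classical or a virtual crossing. Welded objects are virtual diagrams up to the three usual Reidemeister moves on classical crossings, the Detour move (an arc having only virtual crossings may be replaced by any arc with the same endpoints and only virtual crossings), and the OC move (two consecutive over-passages of classical crossings on a strand may be exchanged). An $n$-component welded string link is the welded class of $n$ properly immersed intervals in $[0,1]^2$, with $n$ fixed points on each of $[0,1]\times\{0\}$ and $[0,1]\times\{1\}$, the $i$th interval running from the $i$th point of $[0,1]\times\{0\}$ to the $i$th point of $[0,1]\times\{1\}$. They form a monoid $wSL(n)$ under stacking, with unit the crossingless diagram $\mathbf 1$. **w-trees.** A $w$-tree for a diagram $L$ is a connected unitrivalent tree immersed in the plane, with pairwise disjoint trivalent vertices, disjoint from $L$, each cyclically ordered; with univalent vertices on $L$ away from crossings; with oriented edges, exactly one outgoing edge at each trivalent vertex (so there is exactly one head and the other endpoints are tails); edges have only virtual crossings (with $L$ or other edges), and may carry twists $\bullet$ (two consecutive twists cancel). A $w_l$-tree is a $w$-tree with $l$ tails. Surgery along a $w_1$-tree on $L$ creates exactly one classical crossing, where the strand at the tail passes over the strand at the head; every other new crossing is virtual. Its sign is $+1$ if the head reaches its strand from the right and $-1$ if from the left, each twist changing the sign. Twists on the edge at a head can be traded for attaching the head from the other side of the strand. For $l\ge2$, surgery along a $w_l$-tree is surgery along its expansion,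 defined recursively: at the trivalent vertex adjacent to the head, facing the head, let $X$ and $Y$ be the left and right incoming subtrees; replace the tree by four parallel $w$-trees with adjacent heads at the former head, in the order $Y,X,Y^\bullet,X^\bullet$ from left to right, where $^\bullet$ denotes a twist next to the head. **$w_k$-equivalence.** $L$ and $L'$ are $w_k$-equivalent, written $L\stackrel{k}{\sim}L'$, if they are related by a finite sequence of surgeries along $w_l$-trees with $l\ge k$ and welded moves (generalized Reidemeister and OC moves). *)

(* Defs.v *)
From HB Require Import structures.
From mathcomp Require Import all_boot.
From mathcomp.classical Require Import boolp.
From Stdlib Require Import Relation_Operators.

Set Implicit Arguments.
Unset Strict Implicit.
Unset Printing Implicit Defensive.

Local Open Scope quotient_scope.

(* Virtual string link diagrams are encoded by their Gauss diagrams: following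
   each oriented component from bottom to top, one records the successive
   passages through the classical crossings, with their signs.  Planar isotopy
   and the Detour move relate two virtual diagrams exactly when their Gauss
   diagrams agree up to the names of the crossings, and every Gauss diagram is
   realized by a virtual diagram; virtual crossings are thus not recorded.  The
   sign of a crossing is stored at its under-passage only; [true] is +1. *)

Inductive passage := Over of nat | Under of nat & bool.

Definition passage_code (p : passage) : nat * option bool :=
  match p with Over c => (c, None) | Under c s => (c, Some s) end.
Definition passage_decode (q : nat * option bool) : passage :=
  match q with (c, None) => Over c | (c, Some s) => Under c s end.
Lemma passage_codeK : cancel passage_code passage_decode.
Proof. by case. Qed.
HB.instance Definition _ := Countable.copy passage (can_type passage_codeK).

Definition over_name (p : passage) := if p is Over c then Some c else None.
Definition under_name (p : passage) := if p is Under c _ then Some c else None.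

Definition rename (f : nat -> nat) (p : passage) : passage :=
  match p with Over c => Over (f c) | Under c s => Under (f c) s end.

(* Each crossing is met exactly once from above and exactly once from below. *)
Definition gauss_axiom (w : seq passage) : bool :=
  uniq (pmap over_name w) && perm_eq (pmap over_name w) (pmap under_name w).

Record diagram n := Diagram {
  strands : n.-tuple (seq passage);
  strandsP : gauss_axiom (flatten strands) }.
HB.instance Definition _ n := [isSub for @strands n].
HB.instance Definition _ n := [Countable of diagram n by <:].

(* A template is a diagram with extra marked points ("sites") on its strands,
   away from the crossings.  Local modifications of a diagram replace the
   sites by short words of passages. *)

Definition template n := n.-tuple (seq (passage + nat)).

Definition site_name (x : passage + nat) := if x is inr j then Some j else None.
Definition sites n (C : template n) : seq nat := pmap site_name (flatten C).

Definition fill_word (F : nat -> seq passage) (w : seq (passage + nat)) :=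
  flatten [seq match x with inl p => [:: p] | inr j => F j end | x <- w].
Definition fill n (F : nat -> seq passage) (C : template n) :=
  map_tuple (fill_word F) C.

(* Freshness and distinctness of the names of created crossings need not be
   required: they are forced by [strandsP] for [D] and [D']. *)
Definition local_move n (J : seq nat) (F F' : nat -> seq passage)
    (D D' : diagram n) : Prop :=
  exists C : template n, [/\ uniq J, perm_eq (sites C) J,
    strands D = fill F C & strands D' = fill F' C].

(* The same, with sites 0, 1, ... filled by the successive words of a list. *)
Definition word_move n (ws ws' : seq (seq passage)) : diagram n -> diagram n -> Prop :=
  local_move (iota 0 (size ws)) (nth [::] ws) (nth [::] ws').

Definition two (r : bool) (p q : passage) := if r then [:: q; p] else [:: p; q].

(* The three arcs in a Reidemeister III move: top (over at a and b), middle
   (under at a, over at c), bottom (under at b and c).  Let e_T = +1 if the top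
   arc meets a before b, and -1 otherwise; let e_M, e_B be the analogous signs
   for (middle: a before c) and (bottom: b before c); let e be the orientation
   of the planar triangle abc.  Since the sign of a crossing is that of
   det(over direction, under direction), the signs of a, b, c are
   e e_T e_M, e e_T e_B and e e_M e_B.  The move reverses e_T, e_M and e_B, and
   keeps e. *)
Definition triangle (a b c : nat) (e rT rM rB : bool) : seq (seq passage) :=
  [:: two rT (Over a) (Over b);
      two rM (Under a (e (+) rT (+) rM)) (Over c);
      two rB (Under b (e (+) rT (+) rB)) (Under c (e (+) rM (+) rB))].

Inductive welded_move n (D D' : diagram n) : Prop :=
| Renaming f of injective f & strands D' = map_tuple (map (rename f)) (strands D)
| R1 a s r of word_move [:: [::]] [:: two r (Over a) (Under a s)] D D'
| R2 a b s r of word_move [:: [::]; [::]]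
    [:: [:: Over a; Over b]; two r (Under a s) (Under b (~~ s))] D D'
| R3 a b c e rT rM rB of word_move
    (triangle a b c e rT rM rB) (triangle a b c e (~~ rT) (~~ rM) (~~ rB)) D D'
| OC a b of word_move [:: [:: Over a; Over b]] [:: [:: Over b; Over a]] D D'.

(* [Tail t j] is an edge starting at a tail attached at site [j].  In
   [Vertex t X Y], [X] and [Y] are the left and right incoming subtrees at a
   trivalent vertex, facing the root.  In both cases [t] is the parity of the
   number of twists on the outgoing edge.  As edges may cross virtually, the
   immersion carries no further data.  Likewise the side from which a tail
   reaches its strand is not recorded, surgery being independent of it. *)
Inductive tree := Tail of bool & nat | Vertex of bool & tree & tree.

Fixpoint tails (T : tree) : seq nat :=
  match T with Tail _ j => [:: j] | Vertex _ X Y => tails X ++ tails Y end.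

(* A w-tree: the site of the head, the side from which the head reaches its
   strand ([true] for the right), and the tree. *)
Record wtree := WTree { head_site : nat; from_right : bool; body : tree }.

(* The w_1-trees (site of the tail, sign) given by iterating the expansion, as
   their heads are met along the orientation of the strand; [s] is the side of
   the head.  A twist next to the head is traded for a change of side.  For a
   head coming from the right (resp. left), reading from left to right facing
   the head is following the strand forwards (resp. backwards); hence the order
   Y, X, Y^twisted, X^twisted, respectively its reverse. *)
Fixpoint expansion (s : bool) (T : tree) : seq (nat * bool) :=
  match T with
  | Tail t j => [:: (j, s (+) t)]
  | Vertex t X Y =>
      let s' := s (+) t in
      if s' then expansion s' Y ++ expansion s' X ++
                 expansion (~~ s') Y ++ expansion (~~ s') X
      else expansion (~~ s') X ++ expansion (~~ s') Y ++
           expansion s' X ++ expansion s' Y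
  end.

(* Result of surgery at the sites of a w-tree, [cs] naming the new crossings.
   Passages over the parallel copies of a tail are put in a definite order;
   any other order is related to it by OC moves. *)
Definition surgered (T : wtree) (cs : seq nat) (j : nat) : seq passage :=
  let arrows := zip cs (expansion (from_right T) (body T)) in
  if j == head_site T then [seq Under x.1 x.2.2 | x <- arrows]
  else [seq Over x.1 | x <- arrows & x.2.1 == j].

Definition surgery n (T : wtree) (D D' : diagram n) : Prop :=
  exists2 cs : seq nat, size cs = size (expansion (from_right T) (body T)) &
    local_move (head_site T :: tails (body T)) (fun=> [::]) (surgered T cs) D D'.

Inductive wk_move n k (D D' : diagram n) : Prop :=
| Welded of welded_move D D'
| Surgery T of k <= size (tails (body T)) & surgery T D D'.

Definition wk_equiv n k : diagram n -> diagram n -> Prop :=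
  clos_refl_sym_trans (diagram n) (@wk_move n k).

Definition wk_rel n k (D D' : diagram n) : bool := `[< wk_equiv k D D' >].

Lemma wk_rel_refl n k : reflexive (@wk_rel n k).
Proof. by move=> D; apply/asboolP; apply: rst_refl. Qed.
Lemma wk_rel_sym n k : symmetric (@wk_rel n k).
Proof.
move=> D D'; apply/idP/idP => /asboolP H; apply/asboolP; exact: rst_sym.
Qed.
Lemma wk_rel_trans n k : transitive (@wk_rel n k).
Proof.
move=> D2 D1 D3 /asboolP H /asboolP H'; apply/asboolP.
exact: rst_trans H H'.
Qed.
Canonical wk_equiv_rel n k :=
  EquivRel (@wk_rel n k) (@wk_rel_refl n k) (@wk_rel_sym n k) (@wk_rel_trans n k).

Definition wSL n k := {eq_quot (wk_equiv_rel n k)}.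
HB.instance Definition _ n k := Choice.on (wSL n k).
HB.instance Definition _ n k := Quotient.on (wSL n k).

Definition trivial_strands n : n.-tuple (seq passage) := [tuple of nseq n [::]].
Lemma trivial_strandsP n : gauss_axiom (flatten (trivial_strands n)).
Proof. by rewrite /=; elim: n. Qed.
Definition trivial n : diagram n := Diagram (trivial_strandsP n).

(* The two sets of crossings are made disjoint by renaming. *)
Definition bottom (p : passage) := rename double p.
Definition top (p : passage) := rename (fun c => c.*2.+1) p.

Definition stack_strands n (D E : diagram n) : n.-tuple (seq passage) :=
  [tuple map bottom (tnth (strands D) i) ++ map top (tnth (strands E) i) | i < n].

Lemma pmap_over f w :
  pmap over_name (map (rename f) w) = map f (pmap over_name w).
Proof. by elim: w => //= -[c|c s] w /= ->. Qed.
Lemma pmap_under f w :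
  pmap under_name (map (rename f) w) = map f (pmap under_name w).
Proof. by elim: w => //= -[c|c s] w /= ->. Qed.

Lemma double_injective : injective double.
Proof. by move=> a b /(congr1 half); rewrite !doubleK. Qed.
Lemma doubleS_injective : injective (fun c => c.*2.+1).
Proof. by move=> a b [/double_injective]. Qed.

Lemma perm_stack n (D E : diagram n) :
  perm_eq (flatten (stack_strands D E))
    (map bottom (flatten (strands D)) ++ map top (flatten (strands E))).
Proof.
rewrite /stack_strands /=.
have fl (t : n.-tuple (seq passage)) :
    flatten t = flatten [seq tnth t i | i <- enum 'I_n].
  by rewrite -[in LHS](map_tnth_enum t).
rewrite (fl (strands D)) (fl (strands E)).
elim: (enum 'I_n) => //= i l IH; rewrite !map_cat -!catA perm_cat2l.
by rewrite perm_sym perm_catCA perm_cat2l perm_sym.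
Qed.

Lemma stack_strandsP n (D E : diagram n) :
  gauss_axiom (flatten (stack_strands D E)).
Proof.
have P := perm_stack D E.
have /andP[uD pD] := strandsP D; have /andP[uE pE] := strandsP E.
rewrite /gauss_axiom (perm_uniq (perm_pmap over_name P)).
rewrite (perm_trans (perm_pmap over_name P)) ?andbT.
  rewrite pmap_cat !pmap_over cat_uniq !map_inj_uniq ?uD ?uE /=;
    [|exact: doubleS_injective|exact: double_injective].
  rewrite andbT; apply/hasPn => _ /mapP[a _ ->]; apply/mapP => -[b _].
  by move=> /(congr1 odd); rewrite /= !odd_double.
rewrite perm_sym (perm_trans (perm_pmap under_name P)) //.
rewrite !pmap_cat !pmap_over !pmap_under perm_sym.
by apply: perm_cat; apply: perm_map.
Qed.

Definition stack n (D E : diagram n) : diagram n := Diagram (stack_strandsP D E).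

Definition embed n (f : nat -> nat) (A B : 'I_n -> seq passage) (D : diagram n)
    : n.-tuple (seq passage) :=
  [tuple A i ++ map (rename f) (tnth (strands D) i) ++ B i | i < n].

Lemma stack_embedl n (D E : diagram n) : strands (stack D E) =
  embed double (fun=> [::]) (fun i => map top (tnth (strands E) i)) D.
Proof. by apply: eq_from_tnth => i; rewrite !tnth_mktuple. Qed.
Lemma stack_embedr n (D E : diagram n) : strands (stack D E) =
  embed (fun c => c.*2.+1) (fun i => map bottom (tnth (strands D) i))
        (fun=> [::]) E.
Proof. by apply: eq_from_tnth => i; rewrite !tnth_mktuple cats0. Qed.

Definition rename_site (f : nat -> nat) (x : passage + nat) : passage + nat :=
  match x with inl p => inl (rename f p) | inr j => inr j end.

Lemma fill_word_cat F w w' :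
  fill_word F (w ++ w') = fill_word F w ++ fill_word F w'.
Proof. by rewrite /fill_word map_cat flatten_cat. Qed.
Lemma fill_word_inl F w : fill_word F (map inl w) = w.
Proof. by elim: w => //= p w IH; rewrite /fill_word /= in IH *; rewrite IH. Qed.
Lemma fill_word_rename f F G w : (forall j, G j = map (rename f) (F j)) ->
  fill_word G (map (rename_site f) w) = map (rename f) (fill_word F w).
Proof.
move=> GF; elim: w => //= -[p|j] w IH; rewrite /fill_word /= in IH *.
  by rewrite IH.
by rewrite map_cat GF IH.
Qed.
Lemma eq_fill_word F G w : F =1 G -> fill_word F w = fill_word G w.
Proof.
by move=> FG; congr flatten; apply: eq_map => -[p|j].
Qed.

Lemma pmap_site_inl w : pmap site_name (map inl w) = [::].
Proof. by elim: w. Qed.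
Lemma pmap_site_rename f w :
  pmap site_name (map (rename_site f) w) = pmap site_name w.
Proof. by elim: w => //= -[p|j] w /= ->. Qed.

Lemma local_move_embed n f (A B : 'I_n -> seq passage) J F F' G G'
    (D D' X X' : diagram n) :
  (forall j, G j = map (rename f) (F j)) ->
  (forall j, G' j = map (rename f) (F' j)) ->
  strands X = embed f A B D -> strands X' = embed f A B D' ->
  local_move J F F' D D' -> local_move J G G' X X'.
Proof.
move=> GF GF' eX eX' [C [uJ pC eD eD']].
exists [tuple map inl (A i) ++ map (rename_site f) (tnth C i) ++ map inl (B i)
       | i < n].
split=> //.
- suff <- : sites C = sites [tuple map inl (A i) ++
      map (rename_site f) (tnth C i) ++ map inl (B i) | i < n] by [].
  rewrite /sites -[in LHS](map_tnth_enum C) /=.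
  elim: (enum 'I_n) => //= i l IH.
  by rewrite !pmap_cat -IH !pmap_site_inl pmap_site_rename cats0.
- rewrite eX; apply: eq_from_tnth => i.
  rewrite [RHS]tnth_map !tnth_mktuple eD tnth_map.
  by rewrite !fill_word_cat !fill_word_inl (fill_word_rename _ GF).
- rewrite eX'; apply: eq_from_tnth => i.
  rewrite [RHS]tnth_map !tnth_mktuple eD' tnth_map.
  by rewrite !fill_word_cat !fill_word_inl (fill_word_rename _ GF').
Qed.

Lemma word_move_embed n f (A B : 'I_n -> seq passage) ws ws' vs vs'
    (D D' X X' : diagram n) :
  vs = map (map (rename f)) ws -> vs' = map (map (rename f)) ws' ->
  strands X = embed f A B D -> strands X' = embed f A B D' ->
  word_move ws ws' D D' -> word_move vs vs' X X'.
Proof.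
have nthE (us : seq (seq passage)) j :
    nth [::] (map (map (rename f)) us) j = map (rename f) (nth [::] us j).
  case: (ltnP j (size us)) => h; first by rewrite (nth_map [::]).
  by rewrite !nth_default ?size_map.
move=> -> -> eX eX'; rewrite /word_move size_map.
by apply: local_move_embed eX eX' => j; apply: nthE.
Qed.

Lemma map_two f r p q :
  map (rename f) (two r p q) = two r (rename f p) (rename f q).
Proof. by case: r. Qed.

Lemma surgered_rename f T cs j :
  surgered T (map f cs) j = map (rename f) (surgered T cs j).
Proof.
rewrite /surgered.
case: ifP => _; elim: cs (expansion _ _) => [|c cs IH] [|[j' s] l] //=.
  by rewrite IH.
by case: ifP => _ /=; rewrite IH.
Qed.

Lemma wk_move_embed n k f h (A B : 'I_n -> seq passage) (D D' X X' : diagram n) :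
  (forall g, injective g -> injective (h g)) ->
  (forall g c, h g (f c) = f (g c)) ->
  (forall g i, map (rename (h g)) (A i) = A i) ->
  (forall g i, map (rename (h g)) (B i) = B i) ->
  strands X = embed f A B D -> strands X' = embed f A B D' ->
  wk_move k D D' -> wk_move k X X'.
Proof.
move=> hI hE hA hB eX eX' [[g gI eq_D|a s r H|a b s r H|a b c e rT rM rB H|a b H]|T kT H].
- apply/Welded/(Renaming (hI g gI)); rewrite eX eX'; apply: eq_from_tnth => i.
  rewrite [RHS]tnth_map !tnth_mktuple eq_D tnth_map !map_cat hA hB -!map_comp.
  congr (_ ++ (_ ++ _)); apply: eq_map => -[c|c s] /=; by rewrite hE.
- apply/Welded/(R1 (a := f a) (s := s) (r := r)).
  by apply: word_move_embed eX eX' H; rewrite //= map_two.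
- apply/Welded/(R2 (a := f a) (b := f b) (s := s) (r := r)).
  by apply: word_move_embed eX eX' H; rewrite //= map_two.
- apply/Welded/(R3 (a := f a) (b := f b) (c := f c) (e := e)
                   (rT := rT) (rM := rM) (rB := rB)).
  by apply: word_move_embed eX eX' H; rewrite /triangle /= !map_two.
- apply/Welded/(OC (a := f a) (b := f b)).
  exact: word_move_embed eX eX' H.
- case: H => cs sz H; apply: (Surgery kT); exists (map f cs).
    by rewrite size_map.
  by apply: local_move_embed eX eX' H => // j; apply: surgered_rename.
Qed.

Lemma wk_equiv_map n k (phi : diagram n -> diagram n) :
  (forall D D', wk_move k D D' -> wk_move k (phi D) (phi D')) ->
  forall D D', wk_equiv k D D' -> wk_equiv k (phi D) (phi D').
Proof.
move=> H D D'; elim=> {D D'}.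
- by move=> D D' /H; apply: rst_step.
- by move=> D; apply: rst_refl.
- by move=> D D' _; apply: rst_sym.
- by move=> D D' D'' _ IH _; apply: rst_trans IH.
Qed.

Lemma wk_equiv_stack n k (D D' E E' : diagram n) :
  wk_equiv k D D' -> wk_equiv k E E' -> wk_equiv k (stack D E) (stack D' E').
Proof.
move=> HD HE; apply: (rst_trans _ _ _ (stack D' E)).
  move: HD; apply: (@wk_equiv_map _ _ (fun D => stack D E)) => {D'}D D'.
  pose h (g : nat -> nat) c := if odd c then c else (g c./2).*2.
  apply: (@wk_move_embed n k double h); last first.
  - exact: stack_embedl.
  - exact: stack_embedl.
  - move=> g i; rewrite -map_comp; apply: eq_map => -[c|c s];
      by rewrite /= /h /= odd_double.
  - by [].
  - by move=> g c; rewrite /h odd_double doubleK.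
  move=> g gI a b; rewrite /h.
  case: ifP => oa; case: ifP => ob // e.
  - by move: oa; rewrite e odd_double.
  - by move: ob; rewrite -e odd_double.
  - move/double_injective/gI: e => e.
    by rewrite -(odd_double_half a) -(odd_double_half b) oa ob e.
move: HE; apply: (@wk_equiv_map _ _ (stack D')) => {E'}E E'.
pose h (g : nat -> nat) c := if odd c then (g c./2).*2.+1 else c.
apply: (@wk_move_embed n k (fun c => c.*2.+1) h); last first.
- exact: stack_embedr.
- exact: stack_embedr.
- by [].
- move=> g i; rewrite -map_comp; apply: eq_map => -[c|c s];
    by rewrite /= /h odd_double.
- by move=> g c; rewrite /h /= odd_double /= uphalf_double.
move=> g gI a b; rewrite /h.
case: ifP => oa; case: ifP => ob // e.
- move/doubleS_injective/gI: e => e.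
  by rewrite -(odd_double_half a) -(odd_double_half b) oa ob e.
- by move: ob; rewrite -e /= odd_double.
- by move: oa; rewrite e /= odd_double.
Qed.

(* Stacking of classes, through representatives; [wSL_mulE] shows that the
   choice of representatives is immaterial. *)
Definition wSL_mul n k (x y : wSL n k) : wSL n k :=
  \pi_(wSL n k) (stack (repr x) (repr y)).
Definition wSL_one n k : wSL n k := \pi_(wSL n k) (trivial n).

Lemma wSL_piP n k (D D' : diagram n) :
  \pi_(wSL n k) D = \pi_(wSL n k) D' <-> wk_equiv k D D'.
Proof.
split=> [/eqmodP/asboolP //|H]; by apply/eqmodP/asboolP.
Qed.

Lemma wSL_mulE n k (D E : diagram n) :
  wSL_mul (\pi_(wSL n k) D) (\pi_(wSL n k) E) = \pi_(wSL n k) (stack D E).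
Proof.
by apply/wSL_piP/wk_equiv_stack; apply/wSL_piP; rewrite reprK.
Qed.

Definition is_group (G : Type) (one : G) (mul : G -> G -> G) : Prop :=
  [/\ associative mul, left_id one mul, right_id one mul &
      exists inv : G -> G, left_inverse one inv mul /\ right_inverse one inv mul].

Definition is_subgroup (G : Type) (one : G) (mul : G -> G -> G) (H : G -> Prop)
    : Prop :=
  [/\ H one, forall x y, H x -> H y -> H (mul x y) &
      forall x y, mul x y = one -> H x -> H y].

Definition finitely_generated (G : eqType) (one : G) (mul : G -> G -> G) : Prop :=
  exists S : seq G, forall H : G -> Prop, is_subgroup one mul H ->
    (forall x, x \in S -> H x) -> forall x, H x.

(* Main.v *)
Require Import Defs.
From HB Require Import structures.
From mathcomp Require Import all_boot.
From mathcomp.classical Require Import boolp.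
From mathcomp Require Import zify.
From Stdlib Require Import Relation_Operators.

(* By induction on k.  Two diagrams related by surgery along a w-tree with exactly k
   tails differ, modulo w_(k+1)-equivalence, by stacking the trivial diagram surgered
   along a tree with k tails in standard position, and there are finitely many of
   those.  So w_k-equivalent diagrams differ in wSL(n)_(k+1) by right multiplication
   by elements of a finite set; this lifts right inverses, and a finite set of
   generators, from wSL(n)_k to wSL(n)_(k+1).

   To bring a tree into standard position, surgery along a tree is seen as the
   insertion, at its head, of an iterated commutator in the labels of its tails.
   Reidemeister II makes the inserted words into a group; the combination of
   Reidemeister II, III and OC moves that slides a tail past a head is the Wirtinger
   relation; and trees with more than k tails are trivial.  Commutator calculus then
   shows that the tails of a tree with k tails may be moved along their strands, and
   that its head commutes with everything else. *)

(** The classes are not yet known to form a group when commutators are needed, so the calculus takes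
    place elsewhere: in a fixed diagram with one hole, two words of heads are identified when they
    are interchangeable at the hole, whatever heads surround them. The quotient is a group, although
    its elements are not links. Carrying a tail along its strand conjugates its label by the heads
    passed, that is, multiplies it by a commutator of weight at least 2; a commutator of k labels
    then changes by factors of weight at least k+1, which are trivial.

    The hole is the obstacle: labels are compared only along portions without it. A tail below the
    head of its own tree cannot reach the top of its strand, and this is why standard trees use a
    mark n besides the top marks 0, ..., n-1; the marks of the given diagram are kept above n.
    Moving the head past a mark changes the context itself, hence a separate argument with an
    auxiliary mark.

    The induction starts at k = 0, where surgery along trees with one tail deletes every crossing. A
    product that is trivial at level k is corrected at level k+1 by further factors on its right,
    whence right inverses. *)

Set Implicit Arguments.
Unset Strict Implicit.
Unset Printing Implicit Defensive.

Local Open Scope quotient_scope.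

(** * Words with strand separators *)

(* The strands of a diagram are joined into one word, each strand being followed
   by a terminator [None]; local modifications then take place in [A ++ _ ++ B]. *)
Section Words.
Variable X : Type.
Implicit Types (w : seq (option X)).

Definition join (ss : seq (seq X)) : seq (option X) :=
  flatten [seq rcons (map Some s) None | s <- ss].

Fixpoint split w : seq (seq X) :=
  match w with
  | [::] => [::]
  | None :: w' => [::] :: split w'
  | Some x :: w' => if split w' is s :: ss then (x :: s) :: ss else [::]
  end.

Definition ends w := count (fun x => ~~ isSome x) w.

Definition contents w : seq X := pmap id w.

(** Extending every strand at its top end: this is what stacking becomes on joined words. *)
Fixpoint ins (q : nat -> seq X) (j : nat) w : seq (option X) :=
  match w with
  | [::] => [::]
  | None :: w' => map Some (q j) ++ None :: ins q j.+1 w'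
  | x :: w' => x :: ins q j w'
  end.

Lemma join_cons s ss : join (s :: ss) = map Some s ++ None :: join ss.
Proof. by rewrite /join /= -cats1 -catA. Qed.

Lemma split_cat_some s w :
  split (map Some s ++ None :: w) = s :: split w.
Proof. by elim: s => //= x s ->. Qed.

Lemma joinK ss : split (join ss) = ss.
Proof. by elim: ss => //= s ss IH; rewrite join_cons split_cat_some IH. Qed.

(** The default value makes the empty word terminated, as the join of no strand has to be. *)
Definition terminated w := ~~ isSome (last None w).

Lemma splitK w : terminated w -> join (split w) = w.
Proof.
rewrite /terminated; elim: w => // x w IH /=.
case: w IH x => [_ [x|] //|y w IH x H]; have {IH} E := IH H.
case: x {H} => [x|]; last by rewrite /= in E *; rewrite join_cons E.
rewrite -[in RHS]E; have: split (y :: w) <> [::] by move=> e; rewrite e in E.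
change (split (Some x :: y :: w)) with
  (if split (y :: w) is s :: ss then (x :: s) :: ss else [::]).
by case: (split (y :: w)) => [|s ss].
Qed.

Lemma ends_cat w w' : ends (w ++ w') = ends w + ends w'.
Proof. exact: count_cat. Qed.
Lemma ends_some (s : seq X) : ends (map Some s) = 0.
Proof. by elim: s. Qed.
Lemma ends_join ss : ends (join ss) = size ss.
Proof.
by elim: ss => //= s ss IH; rewrite join_cons ends_cat ends_some /= -IH.
Qed.
Lemma terminated_join ss : terminated (join ss).
Proof.
rewrite /terminated; elim/last_ind: ss => // ss s _.
by rewrite /join -cats1 map_cat flatten_cat last_cat /= cats0 last_rcons.
Qed.

Lemma contents_cat w w' : contents (w ++ w') = contents w ++ contents w'.
Proof. exact: pmap_cat. Qed.
Lemma contents_some (s : seq X) : contents (map Some s) = s.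
Proof. by elim: s => //= x s ->. Qed.
Lemma contents_join ss : contents (join ss) = flatten ss.
Proof.
by elim: ss => //= s ss IH; rewrite join_cons contents_cat contents_some -IH.
Qed.

End Words.

(** Filling a template, erasing or changing names, realizing a marked word and plugging a word into
    a hole are all substitutions of this form, so that [bind_bind] composes them. *)
Definition bind (X Y : Type) (f : X -> seq Y) (w : seq (option X)) : seq (option Y) :=
  flatten [seq if x is Some y then map Some (f y) else [:: None] | x <- w].

Section Bind.
Variables X Y : Type.
Implicit Types (w : seq (option X)).

Lemma bind_cat (f : X -> seq Y) w w' : bind f (w ++ w') = bind f w ++ bind f w'.
Proof. by rewrite /bind map_cat flatten_cat. Qed.
Lemma bind_some (f : X -> seq Y) s :
  bind f (map Some s) = map Some (flatten (map f s)).
Proof. by rewrite /bind; elim: s => //= x s ->; rewrite map_cat. Qed.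
Lemma bind_cons (f : X -> seq Y) x w : bind f (x :: w) =
  (if x is Some y then map Some (f y) else [:: None]) ++ bind f w.
Proof. by []. Qed.
Lemma terminated_bind (f : X -> seq Y) w : terminated w -> terminated (bind f w).
Proof.
rewrite /terminated; elim/last_ind: w => // w x _.
by rewrite last_rcons -cats1 bind_cat last_cat; case: x.
Qed.
Lemma ends_bind (f : X -> seq Y) w : ends (bind f w) = ends w.
Proof.
elim: w => //= -[x|] w IH; rewrite bind_cons ends_cat IH //.
by rewrite ends_some.
Qed.
Lemma contents_bind (f : X -> seq Y) w :
  contents (bind f w) = flatten (map f (contents w)).
Proof.
elim: w => //= -[x|] w IH; rewrite bind_cons contents_cat IH //.
by rewrite contents_some.
Qed.

End Bind.

Lemma bind_bind (X Y Z : Type) (f : X -> seq Y) (g : Y -> seq Z) w :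
  bind g (bind f w) = bind (fun x => flatten (map g (f x))) w.
Proof.
elim: w => // -[x|] w IH.
  by rewrite (bind_cons f) bind_cat bind_some IH.
by rewrite (bind_cons f) bind_cat IH.
Qed.

Lemma eq_bind (X : Type) (Y : Type) (f g : X -> seq Y) w :
  f =1 g -> bind f w = bind g w.
Proof. by move=> fg; elim: w => //= -[x|] w; rewrite !bind_cons => ->; rewrite ?fg. Qed.

Lemma eq_in_bind (X : eqType) (Y : Type) (f g : X -> seq Y) w :
  {in contents w, f =1 g} -> bind f w = bind g w.
Proof.
elim: w => //= -[x|] w IH H; rewrite !bind_cons IH //.
  by rewrite (H x) ?mem_head.
by move=> y yw; apply: H; rewrite inE yw orbT.
Qed.

Lemma bind_fill_join F (ss : seq (seq (passage + nat))) :
  bind (fun x => match x with inl p => [:: p] | inr j => F j end) (join ss) =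
  join (map (fill_word F) ss).
Proof.
elim: ss => //= s ss IH.
by rewrite !join_cons bind_cat bind_some bind_cons IH.
Qed.

Lemma bind_sing_join (X Y : Type) (f : X -> Y) ss :
  bind (fun x => [:: f x]) (join ss) = join (map (map f) ss).
Proof.
elim: ss => //= s ss IH.
rewrite !join_cons bind_cat bind_some bind_cons IH; congr (map _ _ ++ _).
by elim: s => //= x s ->.
Qed.

Section Ins.
Variable X : Type.
Implicit Types (q : nat -> seq X) (w : seq (option X)).

Lemma ins_cat q j w w' :
  ins q j (w ++ w') = ins q j w ++ ins q (j + ends w) w'.
Proof.
elim: w j => [|[x|] w IH] j /=; first by rewrite addn0.
  by rewrite IH.
by rewrite IH -catA /= addSnnS.
Qed.

Lemma ins_some q j s w : ins q j (map Some s ++ w) = map Some s ++ ins q j w.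
Proof. by elim: s => //= x s ->. Qed.

Lemma ends_ins q j w : ends (ins q j w) = ends w.
Proof.
by elim: w j => //= -[x|] w IH j; rewrite ?ends_cat ?ends_some /= IH.
Qed.

Lemma terminated_ins q j w : terminated w -> terminated (ins q j w).
Proof.
rewrite /terminated; elim/last_ind: w => // w x _.
by rewrite last_rcons -cats1 ins_cat last_cat; case: x => //=; rewrite last_cat.
Qed.

Lemma ins_join q j ss : ins q j (join ss) =
  join (mkseq (fun i => nth [::] ss i ++ q (j + i)) (size ss)).
Proof.
rewrite /mkseq; elim: ss j => //= s ss IH j.
rewrite !join_cons ins_some /= IH addn0 map_cat -catA; congr (_ ++ (_ ++ _ :: join _)).
by rewrite -[iota 1 _]/(iota (1 + 0) _) iotaDl -map_comp; apply: eq_map => i /=; rewrite addSnnS.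
Qed.

End Ins.

Lemma bind_ins (X Y : Type) (f : X -> seq Y) q j w :
  bind f (ins q j w) = ins (fun i => flatten (map f (q i))) j (bind f w).
Proof.
elim: w j => //= -[x|] w IH j /=.
  by rewrite !bind_cons IH ins_some.
by rewrite bind_cat bind_some !bind_cons IH.
Qed.

(** * Diagrams and local moves as joined words *)

Section Diagrams.
Variable n : nat.
Implicit Types (D : diagram n) (w : seq (option passage)).

Definition good w : bool :=
  [&& ends w == n, terminated w & gauss_axiom (contents w)].

Definition dword D : seq (option passage) := join (strands D).

(* Meaningful for [good] words only, the others being sent to the trivial diagram. *)
Definition diag w : diagram n :=
  insubd (trivial n) [tuple nth [::] (split w) i | i < n].

Lemma good_dword D : good (dword D).
Proof.
rewrite /good ends_join size_tuple eqxx terminated_join contents_join.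
exact: strandsP.
Qed.

Lemma tuple_split (X : Type) (w : seq (option X)) :
  terminated w -> ends w = n ->
  [tuple nth [::] (split w) i | i < n] = split w :> seq (seq X).
Proof.
move=> tw ew.
have sz : size (split w) = n by rewrite -ew -{2}(splitK tw) ends_join.
apply: (@eq_from_nth _ [::]) => [|i]; rewrite size_tuple ?sz // => ni.
by rewrite -[in LHS](tnth_nth _ _ (Ordinal ni)) tnth_mktuple.
Qed.

Lemma strands_diag w : good w -> strands (diag w) = split w :> seq _.
Proof.
case/and3P => /eqP ew tw gw.
rewrite /diag; have E := tuple_split tw ew.
rewrite [strands _](_ : _ = val (insubd (trivial n) [tuple nth [::] (split w) i | i < n])) //.
rewrite val_insubd E ifT //.
by move: gw; rewrite -{1}(splitK tw) contents_join.
Qed.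

Lemma dwordK w : good w -> dword (diag w) = w.
Proof.
move=> gw; rewrite /dword strands_diag // splitK //.
by case/and3P: gw.
Qed.

Lemma dword_inj : injective dword.
Proof.
move=> D D' /(congr1 (@split _)); rewrite !joinK => e.
by apply: val_inj; apply: val_inj.
Qed.

Lemma diagK D : diag (dword D) = D.
Proof. by apply: dword_inj; rewrite dwordK // good_dword. Qed.

Definition fillf F (x : passage + nat) : seq passage :=
  match x with inl p => [:: p] | inr j => F j end.

Definition site_list (c : seq (option (passage + nat))) : seq nat :=
  pmap site_name (contents c).

Lemma local_moveP J F F' (c : seq (option (passage + nat))) D D' :
  uniq J -> perm_eq (site_list c) J ->
  dword D = bind (fillf F) c -> dword D' = bind (fillf F') c ->
  terminated c -> local_move J F F' D D'.
Proof.
move=> uJ pJ eD eD' tc.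
have ec : ends c = n.
  by rewrite -(ends_bind (fillf F)) -eD; case/and3P: (good_dword D) => /eqP.
exists [tuple nth [::] (split c) i | i < n].
have E := tuple_split tc ec.
split=> //.
- rewrite /sites E; move: pJ.
  by rewrite /site_list -{1}(splitK tc) contents_join.
- apply: val_inj; rewrite /= E -[LHS]joinK -[RHS]joinK -bind_fill_join splitK //.
  by congr (split _).
- apply: val_inj; rewrite /= E -[LHS]joinK -[RHS]joinK -bind_fill_join splitK //.
  by congr (split _).
Qed.

Lemma local_move_inv J F F' D D' : local_move J F F' D D' ->
  exists c : seq (option (passage + nat)), [/\ terminated c, uniq J,
    perm_eq (site_list c) J, dword D = bind (fillf F) c &
    dword D' = bind (fillf F') c].
Proof.
case=> C [uJ pJ eD eD']; exists (join C); split=> //.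
- exact: terminated_join.
- by rewrite /site_list contents_join.
- by rewrite /dword eD bind_fill_join.
- by rewrite /dword eD' bind_fill_join.
Qed.

Lemma dword_stack D E : dword (stack D E) =
  ins (fun i => map top (nth [::] (strands E) i)) 0
    (bind (fun p => [:: bottom p]) (dword D)).
Proof.
rewrite /dword bind_sing_join ins_join size_map size_tuple; congr (join _).
apply: (@eq_from_nth _ [::]) => [|i]; rewrite size_tuple ?size_mkseq // => ni.
rewrite nth_mkseq // (nth_map [::]) ?size_tuple //.
by rewrite -[LHS](tnth_nth _ _ (Ordinal ni)) tnth_mktuple !(tnth_nth [::]).
Qed.
End Diagrams.

(** * Marked words and their realizations *)

Lemma perm_partition (A T : eqType) (key : A -> T) (s : seq A) (ms : seq T) :
  uniq ms -> all (fun x => key x \in ms) s ->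
  perm_eq (flatten [seq [seq x <- s | key x == m] | m <- ms]) s.
Proof.
elim: ms s => [|m ms IH] s /=; first by case: s.
case/andP => mN ums sP.
rewrite -(permPr (permEl (perm_filterC (fun x => key x == m) s))) perm_cat2l.
have E : [seq [seq x <- s | key x == m'] | m' <- ms] =
    [seq [seq x <- [seq x <- s | key x != m] | key x == m'] | m' <- ms].
  apply/eq_in_map => m' m'ms; rewrite -filter_predI; apply: eq_in_filter => x xs /=.
  by case: eqP => //= ->; case: eqP mN m'ms => // -> /negP.
rewrite E; apply: IH => //; apply/allP => x; rewrite mem_filter => /andP[xm xs].
by have := allP sP x xs; rewrite inE (negbTE xm).
Qed.

Lemma gauss_perm w w' : perm_eq w w' -> gauss_axiom w = gauss_axiom w'.
Proof.
move=> ww'; rewrite /gauss_axiom (perm_uniq (perm_pmap over_name ww')).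
congr (_ && _); rewrite (permPl (perm_pmap over_name ww')).
by rewrite (permPr (perm_pmap under_name ww')).
Qed.

Lemma injective_extension (cs cs' : seq nat) : uniq cs -> uniq cs' ->
  size cs = size cs' -> exists2 f : nat -> nat, injective f & map f cs = cs'.
Proof.
move=> u u' e; set N := \max_(c <- cs') c.
have ltN c : c \in cs' -> c <= N by move=> /leq_bigmax_seq; apply.
(* Names outside [cs] are sent above every element of [cs'], so the two branches never collide; the
   [Renaming] move asks for a map injective on all of [nat]. *)
exists (fun x => if x \in cs then nth 0 cs' (index x cs) else (x + N).+1).
  move=> x y; case: ifP => xc; case: ifP => yc.
  - have ix : index x cs < size cs' by rewrite -e index_mem.
    have iy : index y cs < size cs' by rewrite -e index_mem.
    by move=> /eqP; rewrite nth_uniq // => /eqP /index_inj; apply.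
  - have ix : index x cs < size cs' by rewrite -e index_mem.
    move=> h; have := ltN _ (mem_nth 0 ix); rewrite h.
    by rewrite leqNgt ltnS leq_addl.
  - have ix : index y cs < size cs' by rewrite -e index_mem.
    move=> h; have := ltN _ (mem_nth 0 ix); rewrite -h.
    by rewrite leqNgt ltnS leq_addl.
  - by move=> [/addIn].
apply: (@eq_from_nth _ 0); rewrite size_map ?e // => i ni.
by rewrite (nth_map 0) ?e // mem_nth ?e // index_uniq ?e.
Qed.

(* In a marked word, [Mark m] is a place of a strand to which any number of tails
   can be attached, and [Head m s] is an under-passage of sign [s] whose tail is
   attached to [Mark m].  Over-passages have no position of their own: by OC
   moves, the order of the tails attached to one mark is immaterial.  [Hole] is
   the place where words of heads are inserted, and is otherwise ignored. *)
Inductive item := Mark of nat | Head of nat & bool | Hole.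

Definition item_code (x : item) : option (nat + nat * bool) :=
  match x with Mark m => Some (inl m) | Head m s => Some (inr (m, s)) | Hole => None end.
Definition item_decode (x : option (nat + nat * bool)) : item :=
  match x with Some (inl m) => Mark m | Some (inr (m, s)) => Head m s | None => Hole end.
Lemma item_codeK : cancel item_code item_decode.
Proof. by case. Qed.
HB.instance Definition _ := Countable.copy item (can_type item_codeK).

Definition mark_of x := if x is Mark m then Some m else None.
Definition ref_of x := if x is Head m _ then Some m else None.
Definition marks (P : seq (option item)) := pmap mark_of (contents P).
Definition refs (P : seq (option item)) := pmap ref_of (contents P).

Definition named_head (x : item * nat) :=
  if x.1 is Head m _ then Some (x.2, m) else None.
Definition heads (P : seq (option (item * nat))) := pmap named_head (contents P).
Definition erase (P : seq (option (item * nat))) := bind (fun x => [:: x.1]) P.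

(* [L m] is the order in which the crossings with tail at [Mark m] are met. *)
Definition rz_item (L : nat -> seq nat) (x : item * nat) : seq passage :=
  match x.1 with
  | Mark m => map Over (L m)
  | Head _ s => [:: Under x.2 s]
  | Hole => [::]
  end.
Definition rz L P := bind (rz_item L) P.

Definition tails_at (P : seq (option (item * nat))) m :=
  [seq x.1 | x <- heads P & x.2 == m].

Definition named (L : nat -> seq nat) P :=
  uniq (unzip1 (heads P)) /\
  {in marks (erase P), forall m, perm_eq (L m) (tails_at P m)}.

Lemma contents_erase P : contents (erase P) = map fst (contents P).
Proof. by rewrite contents_bind; elim: (contents P) => //= x s ->. Qed.

Lemma mark_in_erase m c P : (Mark m, c) \in contents P -> m \in marks (erase P).
Proof.
rewrite /marks contents_erase => mP; rewrite mem_pmap.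
exact: (map_f mark_of (map_f fst mP)).
Qed.

Lemma under_names_rz L P :
  pmap under_name (contents (rz L P)) = unzip1 (heads P).
Proof.
rewrite /heads contents_bind; elim: (contents P) => //= -[[m|m s|] c] s' IH //=.
- by rewrite pmap_cat IH /rz_item /=; elim: (L m).
- by rewrite IH.
Qed.

Lemma heads_refs P : map snd (heads P) = refs (erase P).
Proof.
by rewrite /refs contents_erase /heads; elim: (contents P) => //= -[[m|m s|] c] P' /= ->.
Qed.

(** * The class of a marked word *)

Section Kw.
Variables n K : nat.

Definition valid (P : seq (option item)) :=
  [&& ends P == n, terminated P, uniq (marks P) & all (mem (marks P)) (refs P)].

Lemma terminated_erase P : terminated (erase P) = terminated P.
Proof.
rewrite /terminated; elim/last_ind: P => // P x _.
by rewrite last_rcons -cats1 /erase bind_cat last_cat; case: x.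
Qed.

(** Read mark by mark, the over-passages are the heads grouped by the mark they refer to. Each head
    occurs exactly once, since marks are distinct and every reference is to an existing mark. *)
Lemma rz_good L P : valid (erase P) -> named L P -> good n (rz L P).
Proof.
case/and4P => eP tP uP rP [uN LP].
rewrite /good ends_bind -(ends_bind (fun x => [:: x.1]) P) eP.
rewrite terminated_bind -?terminated_erase //= contents_bind.
set w := flatten _.
have ov : pmap over_name w = flatten [seq L m | m <- marks (erase P)].
  rewrite /w /marks contents_erase; elim: (contents P) => //= -[[m|m s|] c] s' IH /=.
  - rewrite pmap_cat IH; congr (_ ++ _).
    by rewrite /rz_item /=; elim: (L m) => //= a l ->.
  - by rewrite IH.
  - by rewrite IH.
have un : pmap under_name w = unzip1 (heads P).
  by rewrite -(under_names_rz L) contents_bind.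
have pe : perm_eq (flatten [seq L m | m <- marks (erase P)]) (unzip1 (heads P)).
  apply: (@perm_trans _ (flatten [seq tails_at P m | m <- marks (erase P)])).
    elim: (marks (erase P)) LP => //= m l IH H.
    apply: perm_cat; first by apply: H; rewrite mem_head.
    by apply: IH => x xl; apply: H; rewrite inE xl orbT.
  rewrite /tails_at (eq_map (g := fun m => map fst [seq x <- heads P | x.2 == m])) //.
  rewrite (map_comp (map fst)) -map_flatten; apply: perm_map.
  apply: perm_partition => //; apply/allP => x xP.
  by apply: (allP rP); rewrite -heads_refs; apply: map_f.
by rewrite /gauss_axiom ov un pe (perm_uniq pe) uN.
Qed.

Definition kw w : wSL n K := \pi_(wSL n K) (diag n w).

Lemma kw_move w w' : wk_move K (diag n w) (diag n w') -> kw w = kw w'.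
Proof. by move=> h; apply/wSL_piP; apply: rst_step. Qed.

Definition lift (w : seq (option passage)) : seq (option (passage + nat)) :=
  bind (fun p => [:: inl p]) w.

Lemma lift_fill F w : bind (fillf F) (lift w) = w.
Proof.
rewrite bind_bind; elim: w => //= x w IH; rewrite bind_cons IH.
by case: x.
Qed.
Lemma lift_site w : site_list (lift w) = [::].
Proof. by rewrite /site_list contents_bind; elim: (contents w) => //= x s ->. Qed.

Lemma site_list_cat c c' : site_list (c ++ c') = site_list c ++ site_list c'.
Proof. by rewrite /site_list contents_cat pmap_cat. Qed.

Lemma kw_swap wA wB a b :
  good n (wA ++ Some (Over a) :: Some (Over b) :: wB) ->
  kw (wA ++ Some (Over a) :: Some (Over b) :: wB) =
  kw (wA ++ Some (Over b) :: Some (Over a) :: wB).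
Proof.
move=> g.
have g' : good n (wA ++ Some (Over b) :: Some (Over a) :: wB).
  case/and3P: g => e t g; apply/and3P; split.
  - by move: e; rewrite !ends_cat.
  - by move: t; rewrite /terminated !last_cat; case: wB g {e}.
  - rewrite (gauss_perm (w' := contents (wA ++ Some (Over a) :: Some (Over b) :: wB))) //.
    rewrite !contents_cat perm_cat2l /=.
    exact: permEl (perm_catCA [:: Over b] [:: Over a] (contents wB)).
apply: kw_move; apply: Welded; apply: (OC (a := a) (b := b)).
apply: (@local_moveP _ _ _ _ (lift wA ++ Some (inr 0) :: lift wB)) => //.
- by rewrite site_list_cat /site_list /= -!/(site_list _) !lift_site.
- by rewrite dwordK // bind_cat bind_cons !lift_fill.
- by rewrite dwordK // bind_cat bind_cons !lift_fill.
- case/and3P: g => _ t _; move: t; rewrite /terminated !last_cat /=.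
  by elim/last_ind: wB {g'} => [|wB x _] //; rewrite /lift -cats1 bind_cat !last_cat /=; case: x.
Qed.

Lemma good_perm w w' : ends w = ends w' -> terminated w -> terminated w' ->
  perm_eq (contents w) (contents w') -> good n w -> good n w'.
Proof. by rewrite /good => -> -> -> /gauss_perm ->. Qed.

Definition overs (l : seq nat) : seq (option passage) := map (fun c => Some (Over c)) l.

Lemma good_overs wA l l' wB : perm_eq l l' ->
  good n (wA ++ overs l ++ wB) -> good n (wA ++ overs l' ++ wB).
Proof.
move=> p g; have [e t _] := and3P g; move: g; apply: good_perm => //.
- rewrite !ends_cat; congr (_ + (_ + _)).
  by rewrite /overs !(map_comp Some Over) !ends_some.
- move: t; rewrite /terminated !last_cat.
  case: wB e => [|x wB] //= _; rewrite /overs !(map_comp Some Over).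
  case/lastP: l p => [|l x] p; first by rewrite perm_sym in p; rewrite (perm_nilP p).
  by rewrite !map_rcons last_rcons.
- rewrite !contents_cat perm_cat2l perm_cat2r.
  by rewrite /overs !(map_comp Some Over) !contents_some; apply: perm_map.
Qed.

Lemma kw_overs wA l l' wB : perm_eq l l' -> good n (wA ++ overs l ++ wB) ->
  kw (wA ++ overs l ++ wB) = kw (wA ++ overs l' ++ wB).
Proof.
have mv u x v wA' : good n (wA' ++ overs (x :: u ++ v) ++ wB) ->
    kw (wA' ++ overs (x :: u ++ v) ++ wB) = kw (wA' ++ overs (u ++ x :: v) ++ wB).
  elim: u wA' => // y u IH wA' g.
  have e z : wA' ++ Some (Over y) :: z = (wA' ++ [:: Some (Over y)]) ++ z by rewrite -catA.
  have g1 : good n (wA' ++ overs (y :: x :: u ++ v) ++ wB).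
    apply: good_overs g; exact: permEl (perm_catCA [:: x] [:: y] (u ++ v)).
  have := IH (wA' ++ [:: Some (Over y)]); rewrite -!catA => /(_ g1) <-.
  exact: kw_swap g.
elim: l l' wA => [|x l IH] l' wA p g; first by rewrite perm_sym in p; rewrite (perm_nilP p).
have xl' : x \in l' by rewrite -(perm_mem p) mem_head.
case/splitPr: xl' p => u v p.
have p' : perm_eq l (u ++ v).
  move: p; rewrite -[x :: v]/([:: x] ++ v) perm_sym perm_catCA /= perm_cons.
  by rewrite perm_sym.
have e z : wA ++ Some (Over x) :: z = (wA ++ [:: Some (Over x)]) ++ z by rewrite -catA.
rewrite -mv; last by apply: good_overs g; rewrite perm_cons.
by rewrite /= (e (overs l ++ wB)) (e (overs (u ++ v) ++ wB)); apply: IH; rewrite // -e.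
Qed.

Lemma kw_rz_eq L L' P : {in marks (erase P), forall m, perm_eq (L m) (L' m)} ->
  good n (rz L P) -> kw (rz L P) = kw (rz L' P).
Proof.
rewrite -[rz L P]cat0s -[rz L' P]cat0s; elim: P (nil : seq (option passage)) => // x P IH w H g.
have /IH {}IH : {in marks (erase P), forall m, perm_eq (L m) (L' m)}.
  move=> m mP; apply: H; move: mP; rewrite /marks !contents_erase.
  by case: x {g} => //= -[[m'|m' s|] c] //=; rewrite inE orbC => ->.
move: g; rewrite /rz !bind_cons.
case: x H => [[[m|m s|] c]|] /= H g.
- rewrite -/(rz _ _) -map_comp in g *; rewrite -map_comp.
  rewrite (kw_overs (l' := L' m)) //; last by apply: H; rewrite /marks mem_head.
  rewrite !catA; apply: IH; rewrite -catA.
  by apply: good_overs g; apply: H; rewrite /marks mem_head.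
- by have := IH (rcons w (Some (Under c s))); rewrite !cat_rcons; apply.
- by apply: IH.
- by have := IH (rcons w None); rewrite !cat_rcons; apply.
Qed.

Lemma kw_rename f w : injective f -> good n w ->
  good n (bind (fun p => [:: rename f p]) w) /\
  kw (bind (fun p => [:: rename f p]) w) = kw w.
Proof.
move=> fI g; set w' := bind _ _.
have c' : contents w' = map (rename f) (contents w).
  by rewrite /w' contents_bind; elim: (contents w) => //= x s ->.
have [e t gg] := and3P g.
have g' : good n w'.
  rewrite /good ends_bind e terminated_bind //= c'.
  move: gg; rewrite /gauss_axiom pmap_over pmap_under map_inj_uniq // => /andP[-> /=].
  exact: perm_map.
split=> //; apply/esym/kw_move/Welded/(Renaming fI).
apply: val_inj; rewrite /= strands_diag // strands_diag //.
by rewrite -[RHS]joinK -bind_sing_join splitK.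
Qed.

Lemma erase_eq (P P' : seq (option (item * nat))) f : erase P = erase P' ->
  map f (unzip1 (heads P)) = unzip1 (heads P') ->
  forall L, bind (fun p => [:: rename f p]) (rz L P) = rz (fun m => map f (L m)) P'.
Proof.
move=> e h L; elim: P P' e h => [|x P IH] [|y P'] //.
- by case: y => [[]|].
- by case: x => [[]|].
case: x y => [[[m|m s|] c]|] [[[m'|m' s'|] c']|] //.
- move=> [<- e] h; rewrite /rz !bind_cons bind_cat bind_some /= -/(rz _ _) (IH _ e h).
  by congr (_ ++ _); rewrite /rz_item /=; elim: (L m) => //= z l ->.
- by move=> [<- <- e] [<- h]; rewrite /rz !bind_cons /= -/(rz _ _) (IH _ e h).
- by move=> [e] h; rewrite /rz !bind_cons /= -/(rz _ _) (IH _ e h).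
- by move=> [e] h; rewrite /rz !bind_cons /= -/(rz _ _) (IH _ e h).
Qed.

(** Two namings of one marked word differ by a bijection between finite sets of names, which extends
    to an injective renaming; the orders of the tails at each mark then differ by OC moves. *)
Lemma kw_rz_uniq L L' P P' : valid (erase P) -> erase P = erase P' ->
  named L P -> named L' P' -> kw (rz L P) = kw (rz L' P').
Proof.
move=> vP e nP nP'.
have sz : size (unzip1 (heads P)) = size (unzip1 (heads P')).
  by rewrite !size_map -[LHS](size_map snd) -[RHS](size_map snd) !heads_refs e.
have [f fI hf] := injective_extension nP.1 nP'.1 sz.
have g := rz_good vP nP.
have [g1 <-] := kw_rename fI g.
rewrite (erase_eq e hf); rewrite (erase_eq e hf) in g1.
apply: kw_rz_eq => // m mP'.
have mP : m \in marks (erase P) by rewrite e.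
apply: perm_trans (perm_map f (nP.2 m mP)) _; rewrite perm_sym.
apply: perm_trans (nP'.2 m mP') _.
rewrite /tails_at -map_comp.
move: e hf => /(congr1 refs); rewrite -!heads_refs.
elim: (heads P) (heads P') => [|[c a] s IH] [|[c' a'] s'] //= [<- e] [<- h].
by have := IH _ e h; case: ifP => // _; rewrite /= perm_cons.
Qed.

Fixpoint number k (P : seq (option item)) : seq (option (item * nat)) :=
  if P is x :: P' then omap (pair^~ k) x :: number k.+1 P' else [::].

Lemma number_cat k P Q : number k (P ++ Q) = number k P ++ number (k + size P) Q.
Proof. by elim: P k => [|x P IH] k /=; rewrite ?addn0 // IH addSnnS. Qed.

Lemma erase_number k P : erase (number k P) = P.
Proof. by elim: P k => //= x P IH k; rewrite /erase bind_cons -/(erase _) IH; case: x. Qed.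

Lemma number_names k P : subseq (unzip1 (heads (number k P))) (iota k (size P)).
Proof.
elim: P k => //= x P IH k.
have S := subseq_trans (IH k.+1) (subseq_cons _ k).
by case: x => [[m|m s|]|] //=; rewrite eqxx; apply: IH.
Qed.

Lemma number_uniq k P : uniq (unzip1 (heads (number k P))).
Proof. exact: subseq_uniq (number_names k P) (iota_uniq _ _). Qed.

Lemma named_tails_at P : uniq (unzip1 (heads P)) -> named (tails_at P) P.
Proof. by move=> u; split. Qed.

(** Positions in the word serve as distinct crossing names; [clE] permits any other naming and any
    order of tails. *)
Definition cl (P : seq (option item)) : wSL n K :=
  kw (rz (tails_at (number 0 P)) (number 0 P)).

Lemma clE L P : valid (erase P) -> named L P -> cl (erase P) = kw (rz L P).
Proof.
move=> vP nP; apply: kw_rz_uniq; rewrite ?erase_number //.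
exact/named_tails_at/number_uniq.
Qed.

End Kw.

(** * Contexts *)

Lemma perm_subst (T : eqType) (p : pred T) (hs s : seq T) : count p s = 1 ->
  perm_eq (flatten [seq if p x then hs else [:: x] | x <- s])
          (hs ++ [seq x <- s | ~~ p x]).
Proof.
elim: s => //= x s IH; case: (p x) => /=.
  move=> [/eqP]; rewrite eqn0Ngt -has_count => ns; rewrite perm_cat2l.
  have {IH} : all (predC p) s by rewrite all_predC.
  by elim: s {ns} => //= y s IH /andP[/negbTE-> /IH] /=; rewrite perm_cons.
rewrite add0n => /IH; rewrite -(perm_cons x) => /permPl->.
by rewrite -cat1s perm_catCA.
Qed.

Definition word := seq (nat * bool).
Definition hd (x : nat * bool) := Head x.1 x.2.
Definition plug (u : word) (Z : seq (option item)) :=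
  bind (fun x => if x == Hole then map hd u else [:: x]) Z.
Definition plugn (hs : seq (item * nat)) (Z : seq (option (item * nat))) :=
  bind (fun x => if x.1 == Hole then hs else [:: x]) Z.
Definition holes (Z : seq (option item)) := count (pred1 Hole) (contents Z).

Definition named_word (cs : seq nat) (u : word) := [seq (hd x.2, x.1) | x <- zip cs u].

Lemma erase_plugn cs u Z : size cs = size u ->
  erase (plugn (named_word cs u) Z) = plug u (erase Z).
Proof.
move=> su; rewrite /erase /plugn /plug !bind_bind; apply: eq_bind => -[x c] /=.
rewrite cats0; case: ifP => _ //=.
rewrite -[in RHS](unzip2_zip (s := cs) (t := u)) ?su // /named_word -!map_comp.
by elim: (zip cs u) => //= y l ->.
Qed.

Lemma heads_plugn hs Z : holes (erase Z) = 1 ->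
  perm_eq (heads (plugn hs Z)) (pmap named_head hs ++ heads Z).
Proof.
move=> h1; rewrite /heads contents_bind.
apply: perm_trans (perm_pmap named_head (perm_subst (p := fun x => x.1 == Hole) _ _)) _.
  by move: h1; rewrite /holes contents_erase count_map.
rewrite pmap_cat perm_cat2l.
by elim: (contents Z) => //= -[[m|m s|] c] l IH //=; rewrite perm_cons.
Qed.

Lemma heads_named_word cs u :
  pmap named_head (named_word cs u) = [seq (x.1, x.2.1) | x <- zip cs u].
Proof. by rewrite /named_word; elim: (zip cs u) => //= x l ->. Qed.

Lemma tails_at_plugn cs u Z m : size cs = size u -> holes (erase Z) = 1 ->
  perm_eq (tails_at (plugn (named_word cs u) Z) m)
    (tails_at Z m ++ [seq x.1 | x <- zip cs u & x.2.1 == m]).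
Proof.
move=> su h1; rewrite /tails_at.
apply: perm_trans (perm_map _ (perm_filter _ (heads_plugn _ h1))) _.
rewrite heads_named_word filter_cat map_cat perm_catC perm_cat2l.
by rewrite filter_map -map_comp.
Qed.

Lemma marks_plug u Z : marks (plug u Z) = marks Z.
Proof.
rewrite /marks contents_bind; elim: (contents Z) => //= x l IH.
rewrite pmap_cat IH; case: x => //=.
by elim: u {IH} => //= y u ->.
Qed.

Lemma refs_plug u Z : {subset refs (plug u Z) <= unzip1 u ++ refs Z}.
Proof.
rewrite /refs contents_bind => m; rewrite mem_cat.
elim: (contents Z) => //= x l IH.
rewrite pmap_cat mem_cat => /orP[|/IH/orP[->|]] //.
  case: x => //= [m' s|]; first by rewrite inE => /eqP->; rewrite mem_head orbT.
  move=> h; apply/orP; left.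
  by elim: u h {IH} => //= y u IH; rewrite !inE => /orP[->|/IH->] //; rewrite orbT.
by move=> h; case: x => //= *; rewrite ?inE h !orbT.
Qed.

Lemma erase_cat P Q : erase (P ++ Q) = erase P ++ erase Q.
Proof. exact: bind_cat. Qed.
Lemma heads_cat P Q : heads (P ++ Q) = heads P ++ heads Q.
Proof. by rewrite /heads contents_cat pmap_cat. Qed.
Lemma marks_cat P Q : marks (P ++ Q) = marks P ++ marks Q.
Proof. by rewrite /marks contents_cat pmap_cat. Qed.
Lemma refs_cat P Q : refs (P ++ Q) = refs P ++ refs Q.
Proof. by rewrite /refs contents_cat pmap_cat. Qed.
Lemma holes_cat P Q : holes (P ++ Q) = holes P + holes Q.
Proof. by rewrite /holes contents_cat count_cat. Qed.

(** * Words plugged into a context, and Reidemeister II *)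

Section Moves.
Variables n K : nat.
Local Notation cl := (cl n K).
Local Notation kw := (kw n K).
Local Notation good := (good n).
Local Notation valid := (valid n).

Definition context Z := valid Z && (holes Z == 1).
Definition over Z (u : word) := all (fun x => x.1 \in marks Z) u.

Lemma valid_plug u Z : valid Z -> over Z u -> valid (plug u Z).
Proof.
case/and4P => e t mu r o; rewrite /valid ends_bind e terminated_bind //= marks_plug mu.
apply/allP => m /refs_plug; rewrite mem_cat /= => /orP[|/(allP r)] //.
by case/mapP => x xu ->; apply: (allP o).
Qed.

(** The heads of [Z] are named by their positions, which are below [size Z]; names from [size Z] on
    are therefore fresh for the plugged word. *)
Lemma plug_named L cs u Z : context Z -> over Z u -> uniq cs -> size cs = size u ->
  all (fun c => size Z <= c) cs ->
  {in marks Z, forall q, perm_eq (L q)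
     (tails_at (number 0 Z) q ++ [seq x.1 | x <- zip cs u & x.2.1 == q])} ->
  let P := plugn (named_word cs u) (number 0 Z) in
  good (rz L P) /\ cl (plug u Z) = kw (rz L P).
Proof.
case/andP => vZ /eqP h1 o ucs su fcs HL P.
have eP : erase P = plug u Z by rewrite erase_plugn // erase_number.
have h1' : holes (erase (number 0 Z)) = 1 by rewrite erase_number.
have nP : named L P.
  split.
    rewrite (perm_uniq (perm_map _ (heads_plugn _ h1'))) heads_named_word // map_cat.
    rewrite -map_comp -/(unzip1 (zip cs u)) unzip1_zip ?su // cat_uniq ucs number_uniq.
    rewrite andbT /=; apply/hasPn => c /(mem_subseq (number_names 0 Z)).
    rewrite mem_iota add0n => /andP[_ lc]; apply/negP => /(allP fcs).
    by rewrite leqNgt lc.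
  move=> m; rewrite eP marks_plug => mZ; apply: perm_trans (HL _ mZ) _.
  by rewrite perm_sym tails_at_plugn.
have vP : valid (erase P) by rewrite eP; apply: valid_plug.
by split; [exact: rz_good|rewrite -eP; exact: clE].
Qed.

Definition template_item (L : nat -> seq nat) (S : nat -> seq nat) (h : nat)
    (x : item * nat) : seq (passage + nat) :=
  match x.1 with
  | Mark q => map (inl \o Over) (L q) ++ map inr (S q)
  | Head _ s => [:: inl (Under x.2 s)]
  | Hole => [:: inr h]
  end.

Lemma template_item_sites L S h P :
  perm_eq (site_list (bind (template_item L S h) P))
    (nseq (holes (erase P)) h ++ flatten [seq S q | q <- marks (erase P)]).
Proof.
rewrite /site_list contents_bind /holes /marks contents_erase.
elim: (contents P) => //= -[[q|q t|] c] s IH; rewrite /template_item /= ?perm_cons //.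
rewrite !pmap_cat perm_sym perm_catCA.
set a := pmap _ (map _ (L q)); have -> : a = [::] by rewrite /a; elim: (L q).
set b := pmap _ (map _ (S q)); have -> : b = S q.
  by rewrite /b; elim: (S q) => //= j l ->.
by rewrite perm_cat2l perm_sym.
Qed.

(* The sites in [J] are put at the marks given by [g], the site [h] at the hole. *)
Definition site_template Z J g h :=
  bind (template_item (tails_at (number 0 Z)) (fun q => [seq j <- J | g j == q]) h)
       (number 0 Z).

Lemma site_template_sites Z J g h : context Z -> all (fun j => g j \in marks Z) J ->
  perm_eq (site_list (site_template Z J g h)) (h :: J).
Proof.
case/andP => /and4P[_ _ uZ _] /eqP h1 gJ.
apply: perm_trans (template_item_sites _ _ _ _) _.
rewrite erase_number h1 perm_cons; exact: perm_partition.
Qed.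

(** The two sides of a local move are two fillings of one site template. Each is recognized here as
    a plugged word, so that the move becomes an equality between classes [cl (plug _ Z)]; [L1 j]
    lists the over-passages filling site [j]. *)
Lemma site_template_fill Z J g h F L1 cs u : context Z -> over Z u ->
  all (fun j => g j \in marks Z) J -> uniq cs -> size cs = size u ->
  all (fun c => size Z <= c) cs ->
  F h = [seq Under x.1 x.2.2 | x <- zip cs u] ->
  {in J, forall j, F j = map Over (L1 j)} ->
  {in marks Z, forall q, perm_eq (flatten [seq L1 j | j <- J & g j == q])
     [seq x.1 | x <- zip cs u & x.2.1 == q]} ->
  let w := bind (fillf F) (site_template Z J g h) in
  good w /\ cl (plug u Z) = kw w.
Proof.
move=> cZ o gJ ucs su fcs Fh FJ HL w.
pose L q := tails_at (number 0 Z) q ++ flatten [seq L1 j | j <- J & g j == q].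
have [] := @plug_named L cs u Z cZ o ucs su fcs.
  by move=> q qZ; rewrite perm_cat2l HL.
set P := plugn _ _; suff -> : rz L P = w by [].
rewrite /rz /P /plugn /w /site_template !bind_bind; apply: eq_bind => -[[q|q s|] c] //=.
- rewrite /rz_item /template_item /= cats0 /L !map_cat flatten_cat; congr (_ ++ _).
    by elim: (tails_at _ _) => //= a l ->.
  have : {subset [seq j <- J | g j == q] <= J} by move=> j; rewrite mem_filter => /andP[].
  elim: [seq _ <- _ | _] => //= j l IH H.
  rewrite map_cat FJ; last by apply: H; rewrite mem_head.
  by congr (_ ++ _); apply: IH => i il; apply: H; rewrite inE il orbT.
- rewrite /template_item /= cats0 Fh /named_word; elim: (zip cs u) => //= y l IH.
  by rewrite -IH.
Qed.

Lemma terminated_template Z J g h : context Z -> terminated (site_template Z J g h).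
Proof.
case/andP => /and4P[_ tZ _ _] _; apply: terminated_bind.
by rewrite -terminated_erase erase_number.
Qed.

(** Reidemeister II, with site 0 at the mark [m] and site 1 at the hole: the two tails can be taken
    adjacent because their order at a mark is free. *)
Lemma cl_cancel Z m s : context Z -> m \in marks Z ->
  cl (plug [:: (m, s); (m, ~~ s)] Z) = cl (plug [::] Z).
Proof.
move=> cZ mZ; pose a := size Z; pose b := (size Z).+1.
pose ws := [:: [:: Over a; Over b]; [:: Under a s; Under b (~~ s)]].
pose J := [:: 0]; pose g := fun _ : nat => m.
have gJ : all (fun j => g j \in marks Z) J by rewrite /= mZ.
have [||||||||gw ->] // := @site_template_fill Z J g 1 (nth [::] ws)
    (fun _ => [:: a; b]) [:: a; b] [:: (m, s); (m, ~~ s)] cZ.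
- by rewrite /= mZ.
- by rewrite /= inE andbT neq_ltn leqnn.
- by rewrite /= leqnn leqnSn.
- by move=> j; rewrite inE => /eqP->.
- by move=> q _; rewrite /= /g; case: eqP.
have [||||||||gw' ->] // := @site_template_fill Z J g 1 (nth [::] [:: [::]; [::]])
    (fun _ => [::]) [::] [::] cZ.
- by move=> j; rewrite inE => /eqP->.
- by move=> q _; rewrite /= /g; case: eqP.
apply/esym/kw_move/Welded/(R2 (a := a) (b := b) (s := s) (r := false)).
apply: local_moveP (terminated_template J g 1 cZ); rewrite ?dwordK //.
rewrite (permPl (site_template_sites 1 cZ gJ)).
exact: permEl (perm_catC [:: 1] [:: 0]).
Qed.

End Moves.

(** * Tree insertion and the slide move *)

Fixpoint relabel (g : nat -> nat) (T : tree) : tree :=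
  match T with
  | Tail t j => Tail t (g j)
  | Vertex t X Y => Vertex t (relabel g X) (relabel g Y)
  end.

Lemma tails_relabel g T : tails (relabel g T) = map g (tails T).
Proof. by elim: T => //= t X -> Y ->; rewrite map_cat. Qed.

Lemma expansion_relabel g s T :
  expansion s (relabel g T) = [seq (g x.1, x.2) | x <- expansion s T].
Proof.
elim: T s => //= t X IX Y IY s.
by case: (s (+) t); rewrite !map_cat !IX !IY.
Qed.

Lemma expansion_tails s T : {subset unzip1 (expansion s T) <= tails T}.
Proof.
move=> m; elim: T s => //= t X IX Y IY s.
rewrite mem_cat; case: (s (+) t); rewrite /unzip1 !map_cat !mem_cat.
  by case/or4P=> [/IY|/IX|/IY|/IX] ->; rewrite ?orbT.
by case/or4P=> [/IX|/IY|/IX|/IY] ->; rewrite ?orbT.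
Qed.

(** Surgery needs pairwise distinct sites, whereas several tails of a tree may share a mark: the
    leaves are numbered here, and [relabel] sends each number back to its mark. *)
Fixpoint index_tree k (T : tree) : tree :=
  match T with
  | Tail t j => Tail t k
  | Vertex t X Y => Vertex t (index_tree k X) (index_tree (k + size (tails X)) Y)
  end.

Lemma tails_index_tree k T : tails (index_tree k T) = iota k (size (tails T)).
Proof. by elim: T k => //= t X IX Y IY k; rewrite IX IY size_cat iotaD. Qed.

Lemma relabel_index_tree g k T :
  (forall i, i < size (tails T) -> g (k + i) = nth 0 (tails T) i) ->
  relabel g (index_tree k T) = T.
Proof.
elim: T k => /= [t j|t X IX Y IY] k H; first by rewrite -[k]addn0 H.
rewrite IX ?IY // => i li; last by rewrite H ?nth_cat ?li // size_cat ltn_addr.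
by rewrite -addnA H ?size_cat ?ltn_add2l // nth_cat ltnNge leq_addr /= addKn.
Qed.

Lemma zip_mapr (A B C : Type) (f : B -> C) (s : seq A) t :
  zip s (map f t) = [seq (x.1, f x.2) | x <- zip s t].
Proof. by elim: s t => [|x s IH] [|y t] //=; rewrite IH. Qed.

Lemma tails_at_cat P Q q : tails_at (P ++ Q) q = tails_at P q ++ tails_at Q q.
Proof. by rewrite /tails_at heads_cat filter_cat map_cat. Qed.

Lemma terminated_end (X : Type) (w : seq (option X)) x w' :
  terminated (w ++ Some x :: w') -> exists w1, w' = w1 ++ [:: None].
Proof.
rewrite /terminated last_cat /=; case/lastP: w' => // w' y; rewrite last_rcons.
by case: y => // _; exists w'; rewrite cats1.
Qed.

Lemma fill_overs F l : flatten [seq fillf F i | i <- map (inl \o Over) l] = map Over l.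
Proof. by elim: l => //= y l ->. Qed.

Section Moves.
Variables n K : nat.
Local Notation cl := (cl n K).
Local Notation kw := (kw n K).
Local Notation good := (good n).
Local Notation valid := (valid n).
Local Notation context := (context n).

Lemma cl_tree Z T s : context Z -> all (mem (marks Z)) (tails T) ->
  K <= size (tails T) -> cl (plug (expansion s T) Z) = cl (plug [::] Z).
Proof.
move=> cZ tT kT.
(* Site 0 is left for the head, and [g] sends the site of a tail to its mark. *)
pose k := size (tails T); pose T0 := index_tree 1 T.
pose J := iota 1 k; pose g j := nth 0 (tails T) j.-1.
have tT0 : tails T0 = J by exact: tails_index_tree.
have gT : relabel g T0 = T by apply: relabel_index_tree.
pose e := expansion s T; pose e0 := expansion s T0.
have ee : e = [seq (g x.1, x.2) | x <- e0] by rewrite /e -gT expansion_relabel.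
pose cs := iota (size Z) (size e).
pose W := WTree 0 s T0.
have gJ : all (fun j => g j \in marks Z) J.
  apply/allP => j; rewrite mem_iota => /andP[j0 jk].
  by apply: (allP tT); apply: mem_nth; rewrite prednK // -ltnS.
have ze : zip cs e = [seq (x.1, (g x.2.1, x.2.2)) | x <- zip cs e0].
  by rewrite ee zip_mapr.
have [||||||||gw ew] := @site_template_fill n K Z J g 0 (surgered W cs)
    (fun j => [seq x.1 | x <- zip cs e0 & x.2.1 == j]) cs e cZ.
- apply/allP => x xe; apply: (allP tT); apply: (@expansion_tails s).
  exact: map_f.
- exact: gJ.
- exact: iota_uniq.
- by rewrite size_iota.
- by apply/allP => c; rewrite mem_iota => /andP[].
- by rewrite /surgered /= ze -map_comp.
- move=> j; rewrite mem_iota /surgered /= => /andP[].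
  by case: eqP => [->//|_ _ _]; rewrite -map_comp.
- move=> q _; rewrite ze filter_map -map_comp.
  rewrite [X in perm_eq _ X](_ : _ = [seq x.1 | x <- zip cs e0 & g x.2.1 == q]) //.
  have := @perm_partition _ _ (fun x : nat * (nat * bool) => x.2.1)
    [seq x <- zip cs e0 | g x.2.1 == q] [seq j <- J | g j == q].
  move=> /(_ (filter_uniq _ (iota_uniq _ _))) H.
  have {}H := perm_map fst (H _); rewrite map_flatten -map_comp in H.
  apply: perm_trans (H _); last first.
    apply/allP => x; rewrite !mem_filter => /andP[-> xz] /=.
    rewrite -tT0; apply: (@expansion_tails s); rewrite -/e0.
    apply: map_f; rewrite -[X in _ \in X](@unzip2_zip _ _ cs e0).
      exact: map_f.
    by rewrite size_iota ee size_map.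
  have pf (l1 l2 : seq (seq nat)) : l1 = l2 -> perm_eq (flatten l1) (flatten l2).
    by move=> ->.
  apply/pf/eq_in_map => j; rewrite mem_filter => /andP[/eqP gj _] /=.
  congr map; rewrite -filter_predI; apply: eq_filter => x /=.
  by case: eqP => //= ->; rewrite gj eqxx.
have [||||||||gw' ew'] // := @site_template_fill n K Z J g 0 (fun=> [::])
    (fun _ => [::]) [::] [::] cZ.
  by move=> q _; elim: [seq _ <- J | _].
rewrite -/e ew ew'; apply/esym/kw_move; apply: (@Surgery _ _ _ _ W).
  by rewrite /= tT0 size_iota.
exists cs; first by rewrite size_iota ee size_map.
apply: local_moveP (terminated_template J g 0 cZ); rewrite ?dwordK //.
- by rewrite /= tT0 mem_iota iota_uniq.
- by rewrite [tails (body W)]tT0; apply: (site_template_sites 0 cZ gJ).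
Qed.

(* Reidemeister III for the crossings [a] (the head between the two marks), [b] and
   [c] (the two new heads): the tail of [c] slides along the strand past [a], while
   the tails of [a] and [b], both at [x], are made adjacent by OC moves. *)
Lemma cl_slide Z1 Z2 m x s m' t :
  let Z := Z1 ++ Some (Mark m) :: Some (Head x s) :: Some (Mark m') :: Z2 in
  context Z ->
  cl (plug [:: (x, s); (m', t)] Z) = cl (plug [:: (m, t); (x, s)] Z).
Proof.
move=> Z cZ; have [/and4P[_ tZ uZ /allP rZ] /eqP h1] := andP cZ.
pose a := (size Z1).+1; pose b := size Z; pose c := (size Z).+1.
pose n1 := number 0 Z1; pose n2 := number (size Z1).+3 Z2.
have nZ : number 0 Z = n1 ++ [:: Some (Mark m, size Z1); Some (Head x s, a);
    Some (Mark m', a.+1)] ++ n2 by rewrite number_cat add0n.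
pose L0 q := tails_at n1 q ++ tails_at n2 q.
have tE q : perm_eq (tails_at (number 0 Z) q) (L0 q ++ if x == q then [:: a] else [::]).
  rewrite nZ !tails_at_cat -catA perm_cat2l perm_catC perm_cat2l /tails_at /heads /=.
  by case: (x == q).
have mZ : m \in marks Z by rewrite marks_cat mem_cat /marks /= mem_head orbT.
have m'Z : m' \in marks Z by rewrite marks_cat mem_cat /marks /= !inE eqxx !orbT.
have xZ : x \in marks Z by apply: rZ; rewrite refs_cat mem_cat /refs /= mem_head orbT.
have uZ' := uZ; rewrite marks_cat /marks /= -!/(marks _) in uZ'.
have m1 : m' \notin marks Z1.
  by move: uZ'; rewrite uniq_catC /= !mem_cat !negb_or => /and3P[_ /andP[]].
have m2 : m' \notin marks Z2.
  by move: uZ'; rewrite uniq_catC /= !mem_cat !negb_or => /and3P[_ /andP[]].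
have k1 : m \notin marks Z1.
  by move: uZ'; rewrite uniq_catC /= inE !mem_cat !negb_or => /andP[/and3P[_]].
have k2 : m \notin marks Z2.
  by move: uZ'; rewrite uniq_catC /= inE !mem_cat !negb_or => /andP[/and3P[_]].
have mm : m != m'.
  by move: uZ'; rewrite uniq_catC /= inE !negb_or => /andP[/andP[]].
(* Site 0, the top arc, is at the mark [x]; site 1, the middle arc, takes the place of the head [a];
   site 2, the bottom arc, is the hole. *)
pose S q := [seq j <- [:: 0] | x == q].
pose tau := template_item L0 S 2.
pose C := bind tau n1 ++ map Some (tau (Mark m, 0)) ++ Some (inr 1) ::
          map Some (tau (Mark m', 0)) ++ bind tau n2.
have sC : perm_eq (site_list C) [:: 0; 1; 2].
  have E : perm_eq (site_list C) (1 :: site_list (bind tau (n1 ++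
      [:: Some (Mark m, 0); Some (Mark m', 0)] ++ n2))).
    rewrite /C !bind_cat -(cat1s (Some (inr 1))) !site_list_cat.
    apply/permP => p; rewrite /= !count_cat /= !addn0.
    rewrite (addnCA (count p (site_list (map Some (tau (Mark m, 0)))))).
    by rewrite (addnCA (count p (site_list (bind tau n1)))) -!addnA !count_cat.
  rewrite (permPl E).
  apply: (@perm_trans _ (1 :: [:: 2; 0])); last by [].
  rewrite perm_cons; apply: perm_trans (template_item_sites _ _ _ _) _.
  have -> : holes (erase (n1 ++ [:: Some (Mark m, 0); Some (Mark m', 0)] ++ n2)) = 1.
    by rewrite !erase_cat !holes_cat !erase_number -h1 holes_cat.
  rewrite perm_cons.
  have -> : marks (erase (n1 ++ [:: Some (Mark m, 0); Some (Mark m', 0)] ++ n2)) = marks Z.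
    by rewrite !erase_cat !marks_cat !erase_number.
  by apply: perm_partition; rewrite //= xZ.
have tC : terminated C.
  have [] := @terminated_end _ (Z1 ++ [:: Some (Mark m); Some (Head x s)]) (Mark m') Z2.
    by rewrite -catA.
  move=> Z3 e3; rewrite /C /n2 e3 number_cat bind_cat /terminated !last_cat /= last_cat.
  by rewrite last_cat.
(* With [e = t] and [rM = rB = false], this value gives the signs [s], [s], [t] to [a], [b], [c] in
   [triangle]; reversing the three arcs preserves them. *)
pose rT := s (+) t.
pose o r := if r then [:: b; a] else [:: a; b].
have oE r : two r (Over a) (Over b) = map Over (o r) by case: r.
have op r : perm_eq (o r) [:: a; b].
  by case: r => //; exact: permEl (perm_catC [:: b] [:: a]).
pose F := nth [::] (triangle a b c t rT false false).
pose F' := nth [::] (triangle a b c t (~~ rT) true true).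
(* The tail of [c] has to be adjacent to the head [a]: it comes first at [m'] before the move, and
   last at [m] after it. *)
pose LD q := (if m' == q then [:: c] else [::]) ++ L0 q ++ (if x == q then o rT else [::]).
pose LD' q := L0 q ++ (if x == q then o (~~ rT) else [::]) ++ (if m == q then [:: c] else [::]).
have rzC L G u cs Y F0 :
    {in marks (erase Y), forall q, L q = L0 q ++ if x == q then G else [::]} ->
    F0 0 = map Over G -> F0 2 = [seq Under x.1 x.2.2 | x <- zip cs u] ->
    rz L (plugn (named_word cs u) Y) = bind (fillf F0) (bind tau Y).
  move=> HL F00 F02; rewrite /rz /plugn !bind_bind; apply: eq_in_bind => -[[q|q s'|] k] kY //=.
    rewrite /rz_item /tau /template_item /= cats0 HL; last first.
      exact: mark_in_erase kY.
    rewrite [in RHS]map_cat flatten_cat fill_overs map_cat; congr (_ ++ _).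
    by rewrite /S /=; case: (x == q); rewrite //= F00 cats0.
  rewrite /tau /template_item /= cats0 F02 /named_word.
  by elim: (zip cs u) => //= y l <-.
have plugE hs : plugn hs (number 0 Z) = plugn hs n1 ++ [:: Some (Mark m, size Z1);
    Some (Head x s, a); Some (Mark m', a.+1)] ++ plugn hs n2.
  by rewrite nZ /plugn !bind_cat.
have CE F0 : bind (fillf F0) C = bind (fillf F0) (bind tau n1) ++
    map Some (flatten (map (fillf F0) (tau (Mark m, 0)))) ++ map Some (F0 1) ++
    map Some (flatten (map (fillf F0) (tau (Mark m', 0)))) ++ bind (fillf F0) (bind tau n2).
  rewrite /C -(cat1s (Some (inr 1))) !bind_cat !bind_some.
  by rewrite [bind _ [:: _]]cats0.
have tauE G F0 q k : F0 0 = map Over G -> flatten (map (fillf F0) (tau (Mark q, k))) =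
    map Over (L0 q ++ if x == q then G else [::]).
  move=> F00; rewrite /tau /template_item /= [in LHS]map_cat flatten_cat fill_overs.
  rewrite map_cat; congr (_ ++ _).
  by rewrite /S /=; case: (x == q); rewrite //= F00 cats0.
have notin q Y (W : seq (option item)) : q \notin marks W -> Y \in marks W -> (q == Y) = false.
  by move=> qW YW; apply/eqP => e; rewrite e YW in qW.
have ou : over Z [:: (x, s); (m', t)] by rewrite /= xZ m'Z.
have ou' : over Z [:: (m, t); (x, s)] by rewrite /= xZ mZ.
have bc : b != c by rewrite /b /c neq_ltn ltnSn.
have [||||g e] := @plug_named n K LD [:: b; c] _ Z cZ ou.
- by rewrite /= inE bc.
- by [].
- by rewrite /= /b /c leqnn leqnSn.
- move=> q qZ; apply/permP => p; rewrite [in RHS]count_cat (permP (tE q)) /LD /L0 !count_cat /=.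
  by case: (x == q); case: (m' == q); rewrite ?(permP (op rT)) /=;
    move: (nat_of_bool (p a)) (nat_of_bool (p b)) (nat_of_bool (p c)) (count p (tails_at n1 q))
      (count p (tails_at n2 q)); clear; lia.
have [||||g' e'] := @plug_named n K LD' [:: c; b] _ Z cZ ou'.
- by rewrite /= inE eq_sym bc.
- by [].
- by rewrite /= /b /c leqnn leqnSn.
- move=> q qZ; apply/permP => p; rewrite [in RHS]count_cat (permP (tE q)) /LD' /L0 !count_cat /=.
  by case: (x == q); case: (m == q); rewrite ?(permP (op (~~ rT))) /=;
    move: (nat_of_bool (p a)) (nat_of_bool (p b)) (nat_of_bool (p c)) (count p (tails_at n1 q))
      (count p (tails_at n2 q)); clear; lia.
have rz3 L : rz L [:: Some (Mark m, size Z1); Some (Head x s, a); Some (Mark m', a.+1)] =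
    map Some (map Over (L m)) ++ Some (Under a s) :: map Some (map Over (L m')).
  by rewrite /rz /bind /= cats0.
have mm' := negbTE mm; have m'm : (m' == m) = false by rewrite eq_sym.
have eD : rz LD (plugn (named_word [:: b; c] [:: (x, s); (m', t)]) (number 0 Z)) =
    bind (fillf F) C.
  rewrite CE plugE /rz !bind_cat -!/(rz _ _).
  have F2 : F 2 = [seq Under y.1 y.2.2 | y <- zip [:: b; c] [:: (x, s); (m', t)]].
    by rewrite /F /= /rT; case: (s) (t) => -[].
  have F0 : F 0 = map Over (o rT) by rewrite -oE.
  rewrite !(rzC LD (o rT) _ _ _ F) //; last 2 first.
  - by rewrite erase_number => q qY; rewrite /LD (notin _ _ _ m2 qY).
  - by rewrite erase_number => q qY; rewrite /LD (notin _ _ _ m1 qY).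
  congr (_ ++ _); rewrite !(tauE (o rT)) // (rz3 LD) /LD m'm eqxx -catA /=.
  by congr (_ ++ Some (Under a _) :: _); rewrite /rT; case: (s) (t) => -[].
have eD' : rz LD' (plugn (named_word [:: c; b] [:: (m, t); (x, s)]) (number 0 Z)) =
    bind (fillf F') C.
  rewrite CE plugE /rz !bind_cat -!/(rz _ _).
  have F2 : F' 2 = [seq Under y.1 y.2.2 | y <- zip [:: c; b] [:: (m, t); (x, s)]].
    by rewrite /F' /= /rT; case: (s) (t) => -[].
  have F0 : F' 0 = map Over (o (~~ rT)) by rewrite -oE.
  rewrite !(rzC LD' (o (~~ rT)) _ _ _ F') //; last 2 first.
  - by rewrite erase_number => q qY; rewrite /LD' (notin _ _ _ k2 qY) cats0.
  - by rewrite erase_number => q qY; rewrite /LD' (notin _ _ _ k1 qY) cats0.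
  congr (_ ++ _); rewrite !(tauE (o (~~ rT))) // (rz3 LD') /LD' mm' eqxx cats0.
  rewrite !map_cat -!catA /=.
  have <- : s = t (+) ~~ rT (+) true by rewrite /rT; case: (s) (t) => -[].
  by rewrite -!catA.
rewrite e e' eD eD'; apply/kw_move/Welded.
apply: (R3 (a := a) (b := b) (c := c) (e := t) (rT := rT) (rM := false) (rB := false)).
rewrite eD in g; rewrite eD' in g'.
by apply: (local_moveP _ sC _ _ tC); rewrite ?dwordK.
Qed.

End Moves.

(** * Creating, deleting and merging marks *)

Section Marks.
Variables n K : nat.
Local Notation cl := (cl n K).
Local Notation kw := (kw n K).
Local Notation good := (good n).
Local Notation valid := (valid n).
Local Notation context := (context n).

Lemma valid_unmark A p B : valid (A ++ Some (Mark p) :: B) ->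
  p \notin refs (A ++ B) -> valid (A ++ B).
Proof.
move=> v pN; have [e t u /allP r] := and4P v; apply/and4P; split.
- by move: e; rewrite !ends_cat.
- have [B' ->] := terminated_end t.
  by rewrite /terminated !last_cat.
- move: u; rewrite !marks_cat !cat_uniq /marks /= => /and3P[-> + /andP[_ ->]].
  by rewrite negb_or => /andP[_ ->].
- apply/allP => q qr.
  have : q \in marks (A ++ Some (Mark p) :: B).
    by apply: r; move: qr; rewrite !refs_cat.
  rewrite !inE !marks_cat !mem_cat /marks /= inE => /or3P[->//|/eqP e'|->]; last by rewrite orbT.
  by rewrite -e' qr in pN.
Qed.

Lemma valid_mark A p B : valid (A ++ B) -> ends B != 0 ->
  p \notin marks (A ++ B) -> valid (A ++ Some (Mark p) :: B).
Proof.
move=> v eB pN; have [e t u /allP r] := and4P v; apply/and4P; split.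
- by move: e; rewrite !ends_cat.
- case: B eB t {v pN e u r} => // x B _.
  by rewrite /terminated !last_cat.
- have -> : marks (A ++ Some (Mark p) :: B) = marks A ++ [:: p] ++ marks B by rewrite marks_cat.
  rewrite uniq_catCA /= -marks_cat u andbT.
  by move: pN; rewrite marks_cat.
- apply/allP => q qr; have := r q; rewrite !refs_cat in qr * => /(_ qr).
  rewrite !inE !marks_cat !mem_cat /marks /= inE => /orP[->//|->]; by rewrite !orbT.
Qed.

Lemma cl_unused A p B : valid (A ++ Some (Mark p) :: B) -> p \notin refs (A ++ B) ->
  cl (A ++ Some (Mark p) :: B) = cl (A ++ B).
Proof.
move=> v pN; have v' := valid_unmark v pN.
pose nA := number 0 A; pose nB := number (size A).+1 B.
pose P := nA ++ Some (Mark p, size A) :: nB.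
have eP : number 0 (A ++ Some (Mark p) :: B) = P by rewrite number_cat add0n.
have eP' : erase (nA ++ nB) = A ++ B by rewrite erase_cat !erase_number.
have hE : heads (nA ++ nB) = heads P by rewrite !heads_cat.
have tE q : tails_at (nA ++ nB) q = tails_at P q by rewrite /tails_at hE.
rewrite -[in RHS]eP' (@clE _ _ (tails_at (nA ++ nB))); last 2 first.
- by rewrite eP'.
- by apply: named_tails_at; rewrite hE -eP number_uniq.
rewrite /cl eP; congr (kw _); rewrite /rz.
have E Y : bind (rz_item (tails_at (nA ++ nB))) Y = bind (rz_item (tails_at P)) Y.
  by apply: eq_bind => -[[q|q s|] c]; rewrite /rz_item //= tE.
rewrite E !bind_cat; congr (_ ++ _); rewrite bind_cons.
suff -> : rz_item (tails_at P) (Mark p, size A) = [::] by [].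
rewrite /rz_item /= -tE /tails_at.
suff -> : [seq x <- heads (nA ++ nB) | x.2 == p] = [::] by [].
apply/eqP; rewrite -(negbK (_ == _)) -has_filter; apply/hasPn => x xP.
by apply/eqP => xp; move: pN; rewrite -eP' -heads_refs -xp map_f.
Qed.

(** No move beyond reordering is involved: a tail put last at [m] and a tail put first at [m'] give
    the same realization. *)
Lemma cl_adjacent Z1 m m' Z2 t :
  let Z := Z1 ++ Some (Mark m) :: Some (Mark m') :: Z2 in context Z ->
  cl (plug [:: (m', t)] Z) = cl (plug [:: (m, t)] Z).
Proof.
move=> Z cZ; have [/and4P[_ _ uZ _] _] := andP cZ.
have mZ : m \in marks Z by rewrite marks_cat mem_cat /marks /= mem_head orbT.
have m'Z : m' \in marks Z by rewrite marks_cat mem_cat /marks /= !inE eqxx !orbT.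
have uZ' := uZ; rewrite marks_cat /marks /= -!/(marks _) uniq_catC /= in uZ'.
move: uZ'; rewrite !inE !mem_cat !negb_or -!andbA => /and5P[mm k2 k1 m2 /andP[m1 _]].
pose L := tails_at (number 0 Z); pose c := size Z.
pose LD q := (if m' == q then [:: c] else [::]) ++ L q.
pose LD' q := L q ++ (if m == q then [:: c] else [::]).
have o : over Z [:: (m', t)] by rewrite /= m'Z.
have o' : over Z [:: (m, t)] by rewrite /= mZ.
have [||||_ ->] := @plug_named n K LD [:: c] _ Z cZ o; rewrite /= ?leqnn //.
  by move=> q _; rewrite /LD /= perm_catC; case: (m' == q).
have [||||_ ->] := @plug_named n K LD' [:: c] _ Z cZ o'; rewrite /= ?leqnn //.
  by move=> q _; rewrite /LD' /=; case: (m == q).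
congr (kw _).
pose n1 := number 0 Z1; pose n2 := number (size Z1).+2 Z2.
have nZ : number 0 Z = n1 ++ [:: Some (Mark m, size Z1); Some (Mark m', (size Z1).+1)] ++ n2.
  by rewrite number_cat add0n.
have E Y : {in marks (erase Y), LD =1 LD'} ->
    rz LD (plugn (named_word [:: c] [:: (m', t)]) Y) =
    rz LD' (plugn (named_word [:: c] [:: (m, t)]) Y).
  move=> H; rewrite /rz /plugn !bind_bind; apply: eq_in_bind => -[[q|q s'|] k] kY //=.
  by rewrite /rz_item /= H //; exact: mark_in_erase kY.
have notin q Y (W : seq (option item)) : q \notin marks W -> Y \in marks W -> (q == Y) = false.
  by move=> qW YW; apply/eqP => e; rewrite e YW in qW.
pose M := [:: Some (Mark m, size Z1); Some (Mark m', (size Z1).+1)].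
have S Lx hs : rz Lx (plugn hs (n1 ++ M ++ n2)) =
    rz Lx (plugn hs n1) ++ rz Lx (plugn hs M) ++ rz Lx (plugn hs n2).
  by rewrite /plugn (bind_cat _ n1) (bind_cat _ M) /rz (bind_cat _ (bind _ n1)) (bind_cat _ (bind _ M)).
have m'm : (m' == m) = false by rewrite eq_sym (negbTE mm).
rewrite nZ !S (E n1) ?(E n2); last 2 first.
- by rewrite erase_number => q qY; rewrite /LD /LD' (notin _ _ _ m2 qY) (notin _ _ _ k2 qY) cats0.
- by rewrite erase_number => q qY; rewrite /LD /LD' (notin _ _ _ m1 qY) (notin _ _ _ k1 qY) cats0.
suff -> : rz LD (plugn (named_word [:: c] [:: (m', t)]) M) =
          rz LD' (plugn (named_word [:: c] [:: (m, t)]) M) by [].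
rewrite /rz /bind /= /rz_item /= /LD /LD' !eqxx (negbTE mm) m'm.
by rewrite !cats0 !map_cat -!catA.
Qed.

End Marks.

(** * From diagrams to marked words, and stacking *)

Lemma unzip2_zip_sub (A B : eqType) (s : seq A) (t : seq B) : {subset unzip2 (zip s t) <= t}.
Proof.
elim: s t => [|x s IH] [|y t] //= z; rewrite !inE => /orP[->//|/IH->].
by rewrite orbT.
Qed.

Section FromDiagrams.
Variables n K : nat.
Local Notation cl := (cl n K).
Local Notation kw := (kw n K).
Local Notation good := (good n).
Local Notation valid := (valid n).
Local Notation context := (context n).

(* Marks up to [n] are kept free for the standard trees. *)
Definition cmark c := n.+1 + c.*2.
Definition smark j := n.+1 + j.*2.+1.

(** Every over-passage becomes a mark of its own, referred to by the matching head. Only heads use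
    their name; the 0 elsewhere is a placeholder. *)
Definition site_to_item hs (x : passage + nat) : item * nat :=
  match x with
  | inl (Over c) => (Mark (cmark c), 0)
  | inl (Under c s) => (Head (cmark c) s, c)
  | inr j => (if j == hs then Hole else Mark (smark j), 0)
  end.
Definition named_context hs c := bind (fun x => [:: site_to_item hs x]) c.

(** The order of the tails in a surgered diagram, the parity of the mark telling crossings from
    sites: the mark of a crossing carries that crossing alone, and the mark of a site the copies of
    its tail as [surgered] lists them. *)
Definition tree_mark (T : wtree) (cs : seq nat) (m : nat) :=
  let j := (m - n.+1)./2 in
  if odd (m - n.+1) then
    [seq x.1 | x <- zip cs (expansion (from_right T) (body T)) & x.2.1 == j]
  else [:: j].

Lemma tree_mark_c T cs c : tree_mark T cs (cmark c) = [:: c].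
Proof. by rewrite /tree_mark addKn odd_double doubleK. Qed.
Lemma tree_mark_s T cs j : tree_mark T cs (smark j) =
  [seq x.1 | x <- zip cs (expansion (from_right T) (body T)) & x.2.1 == j].
Proof. by rewrite /tree_mark addKn /= odd_double uphalf_double. Qed.

Lemma cmark_inj : injective cmark.
Proof. by move=> a b /addnI/double_inj. Qed.
Lemma smark_inj : injective smark.
Proof. by move=> a b /addnI[/double_inj]. Qed.
Lemma smarkNcmark a b : smark a != cmark b.
Proof. by rewrite eqn_add2l; apply/eqP => /(congr1 odd); rewrite /= !odd_double. Qed.

Lemma named_context_marks hs c :
  perm_eq (marks (erase (named_context hs c)))
    (map cmark (pmap over_name (contents (bind (fillf (fun=> [::])) c))) ++
     map smark [seq j <- site_list c | j != hs]).
Proof.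
rewrite /marks contents_erase /named_context !contents_bind /site_list.
elim: (contents c) => //= -[[a|a s]|j] l IH //=; first by rewrite perm_cons.
case: eqP => //= _; rewrite perm_sym.
by rewrite -cat1s perm_catCA /= perm_cons perm_sym.
Qed.

Lemma named_context_heads hs c : heads (named_context hs c) =
  [seq (a, cmark a) | a <- pmap under_name (contents (bind (fillf (fun=> [::])) c))].
Proof.
rewrite /heads /named_context !contents_bind.
elim: (contents c) => //= -[[a|a s]|j] l IH //=; first by rewrite IH.
by case: (j == hs).
Qed.

Lemma named_context_holes hs c :
  holes (erase (named_context hs c)) = count_mem hs (site_list c).
Proof.
rewrite /holes contents_erase /named_context !contents_bind /site_list.
elim: (contents c) => //= -[[a|a s]|j] l IH //=; rewrite IH.
by case: (j == hs).
Qed.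

Lemma named_context_refs hs c : refs (erase (named_context hs c)) =
  map cmark (pmap under_name (contents (bind (fillf (fun=> [::])) c))).
Proof. by rewrite -heads_refs named_context_heads -map_comp. Qed.

Lemma named_context_valid hs c : good (bind (fillf (fun=> [::])) c) ->
  terminated c -> uniq (site_list c) -> valid (erase (named_context hs c)).
Proof.
case/and3P; rewrite ends_bind => e _ /andP[uo po] tc us.
rewrite /valid /erase !ends_bind e !terminated_bind //=; apply/andP; split.
  rewrite (perm_uniq (named_context_marks hs c)) cat_uniq !map_inj_uniq //;
    [|exact: smark_inj|exact: cmark_inj].
  rewrite uo filter_uniq // andbT; apply/hasPn => _ /mapP[j _ ->].
  by apply/mapP => -[b _ /eqP]; rewrite (negbTE (smarkNcmark _ _)).
apply/allP => m; rewrite named_context_refs inE (perm_mem (named_context_marks hs c)) mem_cat.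
by case/mapP => a; rewrite -(perm_mem po) => ao ->; rewrite map_f.
Qed.

Lemma named_context_over hs c T cs v :
  head_site T = hs -> size cs = size v ->
  zip cs v = [seq (x.1, (smark x.2.1, x.2.2)) | x <- zip cs (expansion (from_right T) (body T))] ->
  bind (fillf (surgered T cs)) c =
  rz (tree_mark T cs) (plugn (named_word cs v) (named_context hs c)).
Proof.
move=> eh sv zv; rewrite /rz /plugn /named_context !bind_bind; apply: eq_bind.
move=> [[a|a s]|j]; rewrite /= ?cats0 /rz_item /= ?tree_mark_c //.
rewrite /surgered eh; case: (j =P hs) => jhs /=; rewrite ?cats0.
  by rewrite /named_word zv; elim: (zip _ _) => //= y l ->.
by rewrite tree_mark_s -map_comp.
Qed.

Lemma kw_named_context hs c T cs v :
  let w := bind (fillf (surgered T cs)) c in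
  good w -> good (bind (fillf (fun=> [::])) c) -> terminated c ->
  perm_eq (site_list c) (hs :: tails (body T)) -> uniq (hs :: tails (body T)) ->
  head_site T = hs -> size cs = size v ->
  zip cs v = [seq (x.1, (smark x.2.1, x.2.2)) | x <- zip cs (expansion (from_right T) (body T))] ->
  kw w = cl (plug v (erase (named_context hs c))).
Proof.
move=> w gw g0 tc ps us eh sv zv.
have us' : uniq (site_list c) by rewrite (perm_uniq ps).
have V := named_context_valid hs g0 tc us'.
have h1 : holes (erase (named_context hs c)) = 1.
  by rewrite named_context_holes count_uniq_mem // (perm_mem ps) mem_head.
set P := plugn (named_word cs v) (named_context hs c).
have ew : w = rz (tree_mark T cs) P by exact: named_context_over.
have eP : erase P = plug v (erase (named_context hs c)) by exact: erase_plugn.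
have vs : {subset unzip1 v <= map smark (tails (body T))}.
  move=> m /mapP[x xv ->].
  have : x \in unzip2 (zip cs v) by rewrite unzip2_zip ?sv.
  rewrite zv => /mapP[y /mapP[z zz ->] ->] /=; apply: map_f.
  apply: (@expansion_tails (from_right T)).
  by apply: map_f; apply: (@unzip2_zip_sub _ _ cs); apply: map_f.
have ov : over (erase (named_context hs c)) v.
  apply/allP => x xv; rewrite (perm_mem (named_context_marks hs c)) mem_cat.
  apply/orP; right; have /mapP[j jT ->] := vs _ (map_f fst xv).
  apply: map_f; rewrite mem_filter (perm_mem ps) inE jT orbT andbT.
  by apply: contraTneq jT => ->; case/andP: us.
rewrite -eP ew; apply/esym/clE; first by rewrite eP valid_plug.
have [_ _ /andP[uo po]] := and3P gw.
split.
  by rewrite -(under_names_rz (tree_mark T cs)) -ew -(perm_uniq po).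
move=> m; rewrite eP marks_plug => mZ; rewrite perm_sym.
apply: perm_trans (tails_at_plugn _ sv h1) _.
rewrite /tails_at named_context_heads filter_map -map_comp map_id_in //=.
set us0 := pmap under_name _.
have zvE q : [seq x.1 | x <- zip cs v & x.2.1 == q] =
  [seq x.1 | x <- zip cs (expansion (from_right T) (body T)) & smark x.2.1 == q].
  by rewrite zv filter_map -map_comp.
have [_ _ /andP[uo0 po0]] := and3P g0.
move: mZ; rewrite (perm_mem (named_context_marks hs c)) mem_cat => /orP[] /mapP[a].
  move=> aD ->; rewrite tree_mark_c zvE.
  rewrite [X in _ ++ map _ X](eq_filter (a2 := pred0)); last first.
    by move=> x; rewrite /= (negbTE (smarkNcmark _ _)).
  rewrite filter_pred0 cats0 (eq_filter (a2 := pred1 a)); last first.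
    by move=> x /=; rewrite (inj_eq cmark_inj).
  rewrite filter_pred1_uniq //; first by rewrite -(perm_uniq po0).
  by rewrite -(perm_mem po0).
move=> _ ->; rewrite tree_mark_s zvE (eq_filter (a2 := pred0)); last first.
  by move=> x; rewrite /= eq_sym (negbTE (smarkNcmark _ _)).
rewrite filter_pred0 /= (eq_filter (a2 := fun x => x.2.1 == a)) // => x.
by rewrite /= (inj_eq smark_inj).
Qed.

(** With the head site as hole and the tail sites as marks, the diagrams before and after surgery
    are two words plugged into one context. *)
Lemma surgery_context T (D D' : diagram n) : surgery T D D' ->
  exists Z T', [/\ context Z, all (fun m => n < m) (marks Z),
    all (mem (marks Z)) (tails T'), size (tails T') = size (tails (body T)) &
    (\pi_(wSL n K) D = cl (plug [::] Z)) /\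
    (\pi_(wSL n K) D' = cl (plug (expansion (from_right T) T') Z))].
Proof.
case=> cs szcs /local_move_inv[c [tc uJ pc eD eD']].
pose hs := head_site T; pose Z := erase (named_context hs c).
exists Z, (relabel smark (body T)).
have g0 : good (bind (fillf (fun=> [::])) c) by rewrite -eD good_dword.
have us : uniq (site_list c) by rewrite (perm_uniq pc).
have vZ : valid Z by exact: named_context_valid.
have hZ : holes Z == 1.
  by rewrite named_context_holes count_uniq_mem // (perm_mem pc) mem_head.
split.
- by rewrite /context vZ.
- apply/allP => m; rewrite (perm_mem (named_context_marks hs c)) mem_cat.
  by case/orP => /mapP[a _ ->]; rewrite ltn_addr.
- rewrite tails_relabel; apply/allP => _ /mapP[j jT ->].
  rewrite inE (perm_mem (named_context_marks hs c)) mem_cat; apply/orP; right.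
  apply: map_f; rewrite mem_filter (perm_mem pc) inE jT orbT andbT.
  by apply: contraTneq jT => ->; case/andP: uJ.
- by rewrite tails_relabel size_map.
(* With no name, [zip] truncates the expansion to no arrow at all, so that the unmodified diagram is
   covered by [kw_named_context] too. *)
have S0 : (fun=> [::]) = surgered T [::].
  by apply/funext => j; rewrite /surgered; case: (expansion _ _) => *; case: ifP.
split.
  rewrite -(diagK D) eD -/(kw _); rewrite S0.
  by apply: kw_named_context; rewrite -?S0 //; case: (expansion _ _).
rewrite -(diagK D') eD' -/(kw _).
apply: kw_named_context => //.
- by rewrite -eD' good_dword.
- by rewrite expansion_relabel size_map.
- by rewrite expansion_relabel zip_mapr.
Qed.

Lemma holes_plug u Z : holes (plug u Z) = 0.
Proof.
rewrite /holes contents_bind; elim: (contents Z) => //= x l IH.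
rewrite count_cat IH addn0; case: x => //=.
by elim: u {IH} => //= y u ->.
Qed.

(** Two sites are added at the bottom of the first strand, for the head and the tail of a dummy tree
    that receives no arrow; this makes [kw_named_context] applicable. The assumption on [n] provides
    the strand. *)
Lemma diagram_cl (D : diagram n) : 0 < n -> exists P,
  [/\ valid P, holes P = 0 & (\pi_(wSL n K) D = cl P)].
Proof.
move=> n0; pose c := Some (inr 0) :: Some (inr 1) :: lift (dword D).
have [/eqP eD tD _] := and3P (good_dword D).
have tc : terminated c.
  have : terminated (lift (dword D)) by exact: terminated_bind.
  rewrite /terminated /=; case E: (lift (dword D)) => [|x w] //.
  have : ends (lift (dword D)) = n by rewrite ends_bind.
  by rewrite E => /= n00; rewrite -n00 in n0.
have fc F : F 0 = [::] -> F 1 = [::] -> bind (fillf F) c = dword D.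
  by move=> F0 F1; rewrite 2!bind_cons /= F0 F1 lift_fill.
have sc : site_list c = [:: 0; 1].
  by rewrite /site_list /= -/(site_list _) lift_site.
pose T := WTree 0 true (Tail false 1).
exists (plug [::] (erase (named_context 0 c))).
have V : valid (erase (named_context 0 c)).
  by apply: named_context_valid; rewrite ?sc ?fc ?good_dword.
split; first exact: valid_plug.
  exact: holes_plug.
rewrite -(@kw_named_context 0 c T [::] [::]) ?fc ?sc ?good_dword //.
by rewrite -[in LHS](diagK D).
Qed.

End FromDiagrams.

(** * Stacking marked words *)

Section Stack.
Variables n K : nat.
Local Notation cl := (cl n K).
Local Notation kw := (kw n K).
Local Notation good := (good n).
Local Notation valid := (valid n).

Lemma bind_nseq (X Y : Type) (f : X -> seq Y) k : bind f (nseq k None) = nseq k None.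
Proof. by elim: k => //= k IH; rewrite bind_cons IH. Qed.

(** Insertion looks only at the terminators, so agreement on empty strands suffices. *)
Lemma ins_ext (X : Type) (q q' : nat -> seq X) j w :
  ins q j (nseq (ends w) None) = ins q' j (nseq (ends w) None) -> ins q j w = ins q' j w.
Proof.
elim: w j => //= -[x|] w IH j /= e; first by rewrite (IH _ e).
have /= := congr1 (@split X) e; rewrite !split_cat_some => -[eq _].
move: e; rewrite -eq => /(congr1 (drop (size (map Some (q j))))).
by rewrite !drop_size_cat // => -[e]; rewrite (IH _ e).
Qed.

Lemma perm_contents_ins (X : eqType) (q : nat -> seq X) j w m : ends w = m ->
  perm_eq (contents (ins q j w)) (contents w ++ contents (ins q j (nseq m None))).
Proof.
move=> <- {m}; elim: w j => //= -[x|] w IH j /=; first by rewrite perm_cons IH.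
rewrite !contents_cat !contents_some /= -!/(contents _).
by rewrite perm_sym perm_catCA perm_cat2l perm_sym IH.
Qed.

Definition rename_named f (P : seq (option (item * nat))) :=
  bind (fun x => [:: (x.1, f x.2 : nat)]) P.

Lemma erase_rename f P : erase (rename_named f P) = erase P.
Proof. by rewrite /erase /rename_named bind_bind. Qed.
Lemma heads_rename f P : heads (rename_named f P) = [seq (f x.1, x.2) | x <- heads P].
Proof.
rewrite /heads contents_bind; elim: (contents P) => //= -[[m|m s|] c] l IH //=.
by rewrite IH.
Qed.

Lemma rz_rename f L P L' : {in marks (erase P), forall m, L' m = map f (L m)} ->
  rz L' (rename_named f P) = bind (fun p => [:: rename f p]) (rz L P).
Proof.
move=> LL'; rewrite /rz /rename_named !bind_bind; apply: eq_in_bind => -[[m|m s|] c] xP //=.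
rewrite /rz_item /= cats0 LL'; last first.
  exact: mark_in_erase xP.
by elim: (L m) => //= y l ->.
Qed.

Lemma ins_nil (X : Type) (w : seq (option X)) : terminated w ->
  ins (nth [::] (split w)) 0 (nseq (ends w) None) = w.
Proof.
move=> tw; have E : nseq (ends w) None = join (nseq (ends w) [::]) :> seq (option X).
  by elim: (ends w) => //= k ->.
rewrite E ins_join size_nseq -[RHS]splitK //; congr (join _).
have sz : size (split w) = ends w by rewrite -[in RHS](splitK tw) ends_join.
apply: (@eq_from_nth _ [::]) => [|i]; rewrite size_mkseq ?sz // => li.
by rewrite nth_mkseq // nth_nseq li.
Qed.

Lemma heads_ins q P : ends P = n ->
  perm_eq (heads (ins q 0 P)) (heads P ++ heads (ins q 0 (nseq n None))).
Proof.
move=> eP; rewrite /heads -pmap_cat; apply: perm_pmap; exact: perm_contents_ins.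
Qed.
Lemma marks_ins q P : ends P = n ->
  perm_eq (marks (ins q 0 P)) (marks P ++ marks (ins q 0 (nseq n None))).
Proof.
move=> eP; rewrite /marks -pmap_cat; apply: perm_pmap; exact: perm_contents_ins.
Qed.
Lemma refs_ins q P : ends P = n ->
  perm_eq (refs (ins q 0 P)) (refs P ++ refs (ins q 0 (nseq n None))).
Proof.
move=> eP; rewrite /refs -pmap_cat; apply: perm_pmap; exact: perm_contents_ins.
Qed.

Lemma erase_ins q j P : erase (ins q j P) = ins (fun i => map fst (q i)) j (erase P).
Proof.
rewrite /erase bind_ins; congr (ins _ _ _); apply/funext => i.
by elim: (q i) => //= x l ->.
Qed.

Lemma valid_ins q P : valid P -> valid (ins q 0 (nseq n None)) ->
  {in marks P, forall m, m \notin marks (ins q 0 (nseq n None))} ->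
  valid (ins q 0 P).
Proof.
case/and4P => /eqP eP tP uP /allP rP /and4P[_ _ uQ /allP rQ] dPQ.
rewrite /valid ends_ins eP eqxx terminated_ins //= (perm_uniq (marks_ins q eP)).
rewrite cat_uniq uP uQ andbT; apply/andP; split.
  by apply/hasPn => m mQ; apply/negP => /dPQ; rewrite mQ.
apply/allP => m; rewrite inE (perm_mem (refs_ins q eP)) (perm_mem (marks_ins q eP)) !mem_cat.
by case/orP => [/rP|/rQ]; rewrite inE => ->; rewrite ?orbT.
Qed.

(** Both factors keep their own marks, so no tail changes factor. Names are made even for [P] and
    odd for the upper word, as in [stack], and [L] orders the tails at a mark according to the
    factor owning it. *)
Lemma cl_stack q P : valid P -> valid (ins q 0 (nseq n None)) ->
  {in marks P, forall m, m \notin marks (ins q 0 (nseq n None))} ->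
  wSL_mul (cl P) (cl (ins q 0 (nseq n None))) = cl (ins q 0 P).
Proof.
set Q := ins q 0 (nseq n None) => vP vQ dPQ.
have vR := valid_ins vP vQ dPQ.
have [/eqP eP tP uP /allP rP] := and4P vP.
have [/eqP eQ tQ uQ /allP rQ] := and4P vQ.
pose nP := number 0 P; pose nQ := number 0 Q.
pose LP := tails_at nP; pose LQ := tails_at nQ.
have tnQ : terminated nQ by rewrite -terminated_erase erase_number.
have enQ : ends nQ = n by rewrite -(ends_bind (fun x => [:: x.1])) -/(erase _) erase_number.
have enP : ends nP = n by rewrite -(ends_bind (fun x => [:: x.1])) -/(erase _) erase_number.
pose f2 := fun c : nat => c.*2.+1.
pose nq i := nth [::] (split nQ) i.
pose nq' i := [seq (x.1, f2 x.2) | x <- nq i].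
have nQE : ins nq 0 (nseq n None) = nQ by rewrite -enQ ins_nil.
have nQ'E : ins nq' 0 (nseq n None) = rename_named f2 nQ.
  rewrite -nQE /rename_named bind_ins; congr (ins _ _ _).
    by apply/funext => i; rewrite /nq'; elim: (nq i) => //= x l ->.
  by rewrite bind_nseq.
pose nR := ins nq' 0 (rename_named double nP).
pose L m := if m \in marks P then map double (LP m) else map f2 (LQ m).
have gP : good (rz LP nP).
  by apply: rz_good; rewrite ?erase_number //; exact/named_tails_at/number_uniq.
have gQ : good (rz LQ nQ).
  by apply: rz_good; rewrite ?erase_number //; exact/named_tails_at/number_uniq.
have eR : erase nR = ins q 0 P.
  rewrite /nR erase_ins erase_rename erase_number.
  have : ins (fun i => map fst (nq' i)) 0 (nseq n None) = ins q 0 (nseq n None).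
    rewrite -[RHS](erase_number 0) -/Q -/nQ -(erase_rename f2) -nQ'E erase_ins.
    by rewrite /erase bind_nseq.
  by rewrite -eP; apply: ins_ext.
have tR : perm_eq (heads nR) ([seq (x.1.*2, x.2) | x <- heads nP] ++
    [seq (f2 x.1, x.2) | x <- heads nQ]).
  apply: perm_trans (heads_ins _ _) _; first by rewrite ends_bind.
  by rewrite nQ'E !heads_rename.
have LRP m : m \in marks P -> L m = map double (LP m) by rewrite /L => ->.
have LRQ m : m \in marks Q -> L m = map f2 (LQ m).
  by rewrite /L; case: ifP => // /dPQ /negbTE ->.
have hP : map snd (heads nP) = refs P by rewrite heads_refs erase_number.
have hQ : map snd (heads nQ) = refs Q by rewrite heads_refs erase_number.
have nmR : named L nR.
  split.
    rewrite (perm_uniq (perm_map fst tR)) map_cat -!map_comp.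
    rewrite (map_comp double fst) (map_comp f2 fst) cat_uniq.
    rewrite (map_inj_uniq double_injective) (map_inj_uniq doubleS_injective) !number_uniq /=.
    rewrite andbT; apply/hasPn => _ /mapP[a _ ->]; apply/mapP => -[b _].
    by move=> /(congr1 odd); rewrite /= !odd_double.
  move=> m; rewrite eR (perm_mem (marks_ins q eP)) mem_cat => mR.
  rewrite perm_sym /tails_at (permPl (perm_map fst (perm_filter _ tR))).
  rewrite filter_cat map_cat !filter_map -!map_comp.
  rewrite (map_comp double fst) (map_comp f2 fst).
  case/orP: mR => [mP|mQ].
    rewrite (LRP _ mP) [X in _ ++ map f2 (map _ X)](_ : _ = [::]) ?cats0 //.
    apply/eqP; rewrite -(negbK (_ == _)) -has_filter; apply/hasPn => x xQ /=.
    apply/eqP => xm; have := dPQ m mP; rewrite -xm => /negP; apply.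
    by apply: rQ; rewrite -hQ; apply: map_f.
  rewrite (LRQ _ mQ) [X in map double (map _ X)](_ : _ = [::]) //.
  apply/eqP; rewrite -(negbK (_ == _)) -has_filter; apply/hasPn => x xP /=.
  apply/eqP => xm; have /rP /dPQ : x.2 \in refs P by rewrite -hP; apply: map_f.
  by rewrite xm mQ.
have wR : rz L nR = dword (stack (diag n (rz LP nP)) (diag n (rz LQ nQ))).
  rewrite dword_stack dwordK // /rz /nR bind_ins -/(rz _ _) (rz_rename (f := double) (L := LP)); last first.
    by rewrite erase_number.
  rewrite -{1}(ends_bind (rz_item LP) nP) in enP.
  apply: ins_ext; rewrite ends_bind enP.
  have -> : ins (fun i => flatten [seq rz_item L x | x <- nq' i]) 0 (nseq n None) =
      rz L (rename_named f2 nQ) by rewrite -nQ'E /rz bind_ins bind_nseq.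
  rewrite (rz_rename (f := f2) (L := LQ)) ?erase_number //.
  have ew : ends (rz LQ nQ) = n by rewrite ends_bind.
  rewrite -{1}(ins_nil (w := rz LQ nQ)) ?terminated_bind // ew bind_ins bind_nseq.
  congr (ins _ _ _); apply/funext => i; rewrite strands_diag //.
  by elim: (nth _ _ i) => //= x l ->.
have -> : cl (ins q 0 P) = kw (rz L nR) by rewrite -eR; apply: clE; rewrite ?eR.
by rewrite wR /kw diagK /cl wSL_mulE.
Qed.

End Stack.

(** * The syntactic group of a context *)

Section SyntacticGroup.
Variables (M : Type) (f : word -> M).
Hypothesis f_cancel : forall a m s b, f (a ++ (m, s) :: (m, ~~ s) :: b) = f (a ++ b).

(* The syntactic congruence of [f]. *)
Definition syn_eq (u v : word) : bool := `[< forall a b, f (a ++ u ++ b) = f (a ++ v ++ b) >].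

Lemma syn_eq_refl : reflexive syn_eq.
Proof. by move=> u; apply/asboolP. Qed.
Lemma syn_eq_sym : symmetric syn_eq.
Proof. by move=> u v; apply/asboolP/asboolP => H a b; rewrite H. Qed.
Lemma syn_eq_trans : transitive syn_eq.
Proof. by move=> v u w /asboolP H /asboolP H'; apply/asboolP => a b; rewrite H. Qed.
Canonical syn_equiv := EquivRel syn_eq syn_eq_refl syn_eq_sym syn_eq_trans.

Definition syn := {eq_quot syn_equiv}.
HB.instance Definition _ := Choice.on syn.
HB.instance Definition _ := Quotient.on syn.

Lemma syn_piP u v : \pi_syn u = \pi_syn v <-> forall a b, f (a ++ u ++ b) = f (a ++ v ++ b).
Proof.
by split=> [/eqmodP/asboolP //|H]; apply/eqmodP/asboolP.
Qed.

Definition inv_word (u : word) := rev [seq (x.1, ~~ x.2) | x <- u].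

Definition syn_mul (x y : syn) : syn := \pi_syn (repr x ++ repr y).
Definition syn_one : syn := \pi_syn [::].
Definition syn_inv (x : syn) : syn := \pi_syn (inv_word (repr x)).

Lemma syn_mulE u v : syn_mul (\pi_syn u) (\pi_syn v) = \pi_syn (u ++ v).
Proof.
apply/syn_piP => a b; rewrite -!catA.
have /syn_piP -> : \pi_syn (repr (\pi_syn u)) = \pi_syn u by rewrite reprK.
rewrite !catA -!(catA (a ++ u)).
by have /syn_piP -> : \pi_syn (repr (\pi_syn v)) = \pi_syn v by rewrite reprK.
Qed.

Lemma f_inv_wordr a u b : f (a ++ u ++ inv_word u ++ b) = f (a ++ b).
Proof.
elim: u a b => // -[m s] u IH a b.
rewrite /inv_word /= rev_cons -cats1 -!catA /= -/(inv_word u).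
rewrite -cat1s catA IH -catA /=; exact: f_cancel.
Qed.

Lemma f_inv_wordl a u b : f (a ++ inv_word u ++ u ++ b) = f (a ++ b).
Proof.
elim: u a b => // -[m s] u IH a b.
rewrite /inv_word /= rev_cons -cats1 -!catA /= -/(inv_word u).
rewrite catA -{2}[s]negbK f_cancel -catA; exact: IH.
Qed.

Lemma syn_mulA : associative syn_mul.
Proof.
elim/quotW => u; elim/quotW => v; elim/quotW => w.
by rewrite (syn_mulE v w) (syn_mulE u v) (syn_mulE u) (syn_mulE _ w) catA.
Qed.
Lemma syn_mul1 : left_id syn_one syn_mul.
Proof. by elim/quotW => u; rewrite (syn_mulE [::] u). Qed.
Lemma syn_mulr1 : right_id syn_one syn_mul.
Proof. by elim/quotW => u; rewrite (syn_mulE u [::]) cats0. Qed.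
Lemma syn_mulV : left_inverse syn_one syn_inv syn_mul.
Proof.
move=> x; rewrite /syn_inv -[X in syn_mul _ X]reprK syn_mulE.
by apply/syn_piP => a b; rewrite -catA f_inv_wordl.
Qed.
Lemma syn_mulVr : right_inverse syn_one syn_inv syn_mul.
Proof.
move=> x; rewrite /syn_inv -[X in syn_mul X _]reprK syn_mulE.
by apply/syn_piP => a b; rewrite -catA f_inv_wordr.
Qed.

End SyntacticGroup.

Local Open Scope group_scope.

(** Being two-sided, the congruence respects concatenation, and cancellation of opposite letters
    makes the reversed opposite word an inverse; [M] itself carries no structure. *)
Lemma syntactic_group (M : Type) (f : word -> M) :
  (forall a m s b, f (a ++ (m, s) :: (m, ~~ s) :: b) = f (a ++ b)) ->
  exists (G : groupType) (phi : word -> G),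
    [/\ phi [::] = 1, {morph phi : u v / (u ++ v)%SEQ >-> u * v} &
        forall u v, phi u = phi v <-> forall a b, f (a ++ u ++ b) = f (a ++ v ++ b)].
Proof.
move=> H.
exists (HB.pack_for groupType (syn f) (isGroup.Build (syn f) (@syn_mulA _ f) (@syn_mul1 _ f)
  (@syn_mulr1 _ f) (@syn_mulV _ f H) (@syn_mulVr _ f H))).
exists (fun u => \pi_(syn f) u); split=> //.
- by move=> u v; rewrite [RHS]syn_mulE.
- exact: syn_piP.
Qed.

(** * Commutator calculus for trees *)

Section TreeCommutators.
Variables (G : groupType) (l : nat -> G) (V : pred nat).
Implicit Types (x y g : G) (T : tree).

(** The order of factors is that of [expansion] for a head from the right: Y, X, then both
    twisted. *)
Definition comm y x : G := y * x * y^-1 * x^-1.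

Fixpoint value T : G :=
  match T with
  | Tail t j => if t then (l j)^-1 else l j
  | Vertex t X Y =>
      if t then (comm (value Y) (value X))^-1 else comm (value Y) (value X)
  end.

Lemma value_expansion (phi : word -> G) s T :
  {morph phi : u v / (u ++ v)%SEQ >-> u * v} ->
  (forall m s', phi [:: (m, s')] = if s' then l m else (l m)^-1) ->
  phi (expansion s T) = if s then value T else (value T)^-1.
Proof.
move=> phiM phil; elim: T s => [t j|t X IX Y IY] s /=.
  by rewrite phil; case: s t => -[] /=; rewrite ?invgK.
by case: s t => -[] /=; rewrite !phiM !IX !IY /= /comm ?invgM ?invgK !mulgA.
Qed.

Definition twist T :=
  match T with Tail t j => Tail (~~ t) j | Vertex t X Y => Vertex (~~ t) X Y end.
Lemma tails_twist T : tails (twist T) = tails T.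
Proof. by case: T. Qed.
Lemma value_twist T : value (twist T) = (value T)^-1.
Proof. by case: T => [[] j|[] X Y] /=; rewrite ?invgK. Qed.

(* [weight a g]: [g] is a product of tree commutators with at least [a] leaves. *)
Inductive weight (a : nat) : G -> Prop :=
| Weight1 : weight a 1
| WeightM T g of all V (tails T) & a <= size (tails T) & weight a g :
    weight a (value T * g).

Lemma weight_value a T : all V (tails T) -> a <= size (tails T) -> weight a (value T).
Proof. by move=> vT aT; rewrite -[value T]mulg1; apply: WeightM => //; apply: Weight1. Qed.

Lemma weightM a x y : weight a x -> weight a y -> weight a (x * y).
Proof.
move=> wx wy; elim: wx => [|T g vT aT _ IH]; first by rewrite mul1g.
by rewrite -mulgA; apply: WeightM.
Qed.

Lemma weightV a x : weight a x -> weight a x^-1.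
Proof.
elim=> [|T g vT aT _ IH]; first by rewrite invg1; apply: Weight1.
rewrite invgM -value_twist; apply: weightM => //.
by apply: weight_value; rewrite tails_twist.
Qed.

Lemma weight_le a b x : b <= a -> weight a x -> weight b x.
Proof.
move=> ba; elim=> [|T g vT aT _ IH]; first exact: Weight1.
by apply: WeightM => //; apply: leq_trans ba aT.
Qed.

(** Conjugating a tree commutator by another one multiplies it by their commutator, again the value
    of a tree, and with more leaves. *)
Lemma weight_conj a b x g : weight b x -> weight a g -> weight a (x * g * x^-1).
Proof.
move=> wx; elim: wx g => [|X h vX _ _ IH] g wg; first by rewrite invg1 mulg1 mul1g.
have {IH} := IH _ wg; rewrite invgM !mulgA -(mulgA _ h g) -(mulgA _ (h * g)).
elim=> [|T g' vT aT _ IH]; first by rewrite mulg1 mulgV; apply: Weight1.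
have -> : value X * (value T * g') * (value X)^-1 =
    value (Vertex false T X) * (value T * (value X * g' * (value X)^-1)).
  by rewrite /= /comm !mulgA !(mulgVK, mulgK).
apply: WeightM; rewrite /= ?all_cat ?vT ?vX ?size_cat //; first exact: leq_trans aT (leq_addr _ _).
exact: WeightM.
Qed.

Lemma commMr y t g : comm y (t * g) = comm y t * (t * comm y g * t^-1).
Proof. by rewrite /comm invgM !mulgA !(mulgVK, mulgK). Qed.
Lemma commMl s h t : comm (s * h) t = s * comm h t * s^-1 * comm s t.
Proof. by rewrite /comm invgM !mulgA !(mulgVK, mulgK). Qed.

(** The product formulas [commMr] and [commMl] reduce to two trees, which are joined at a new
    trivalent vertex. *)
Lemma weight_comm a b x y : weight a x -> weight b y -> weight (a + b) (comm y x).
Proof.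
move=> wx wy; elim: wx => [|T g vT aT wg IH].
  by rewrite /comm mulg1 mulgV invg1 mulg1; apply: Weight1.
rewrite commMr; apply: weightM; last first.
  by apply: (@weight_conj _ 0) => //; apply: weight_value.
elim: wy {wg IH} => [|S h vS bS _ IH].
  by rewrite /comm mul1g invg1 mulg1 mulgV; apply: Weight1.
rewrite commMl; apply: weightM.
  by apply: (@weight_conj _ 0) => //; apply: weight_value.
apply: (@weight_value _ (Vertex false T S)); rewrite /= ?all_cat ?vT ?vS //.
by rewrite size_cat leq_add.
Qed.

(** The commutator is well defined on the graded quotients of the weight filtration: factors one
    step deeper in the arguments give a factor one step deeper in the result. *)
Lemma comm_congr a b c d x y : weight a x -> weight b y ->
  weight a.+1 c -> weight b.+1 d ->
  exists2 e, weight (a + b).+1 e & comm (d * y) (c * x) = e * comm y x.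
Proof.
move=> wx wy wc wd.
have cc u v : u * v * u^-1 = comm u v * v by rewrite /comm mulgVK.
have wQ := weight_comm wx wy.
have wcx : weight a (c * x) by apply: weightM => //; apply: weight_le wc.
have wP := weight_comm wcx wy.
(* Obtained by expanding with [commMl] and [commMr], then using [cc] and a conjugation to bring
   every factor except [comm y x] to the left. *)
exists (comm d (comm y (c * x)) * (comm y c * (comm c (comm y x) *
        (comm y x * comm d (c * x) * (comm y x)^-1)))).
  apply: weightM.
    by apply: weight_le (weight_comm wP wd); rewrite -addn1 leq_add2l.
  apply: weightM; first by apply: weight_le (weight_comm wc wy); rewrite addSn.
  apply: weightM; first by apply: weight_le (weight_comm wQ wc); rewrite -addn1 leq_add2l.
  apply: (weight_conj wQ); apply: weight_le (weight_comm wcx wd).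
  by rewrite addnS.
rewrite commMl cc; have : comm y (c * x) = comm y c * (comm c (comm y x) * comm y x).
  by rewrite commMr cc.
move: (comm y (c * x)) (comm y c) (comm d (c * x)) => P C D ->.
move: (comm y x) => Q; move: (comm c Q) => F; move: (comm d _) => E.
by rewrite !mulgA !mulgVK.
Qed.

(** Multilinearity of iterated commutators modulo higher weight: labels need only agree modulo
    weight 2. The induction is [comm_congr] at each vertex. *)
Lemma value_relabel r T : all V (tails T) ->
  {in tails T, forall m, V (r m) /\ exists2 e, weight 2 e & l m = e * l (r m)} ->
  exists2 e, weight (size (tails T)).+1 e & value T = e * value (relabel r T).
Proof.
elim: T => [t j|t X IX Y IY] /=.
  move=> _ /(_ j (mem_head _ _))[Vg [e we ->]].
  case: t; last by exists e.
  exists ((l (r j))^-1 * e^-1 * l (r j)); last by rewrite invgM mulgK.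
  rewrite -{2}[l (r j)]invgK; apply: (@weight_conj _ 1); last exact: weightV.
  by apply: weightV; apply: (@weight_value _ (Tail false (r j))); rewrite /= ?Vg.
rewrite all_cat => /andP[vX vY] H.
have [c wc eX] := IX vX (fun m mX => H m (etrans (mem_cat _ _ _) (introT orP (or_introl mX)))).
have [d wd eY] := IY vY (fun m mY => H m (etrans (mem_cat _ _ _) (introT orP (or_intror mY)))).
have vg Z : {subset tails Z <= tails X ++ tails Y} -> all V (tails (relabel r Z)).
  move=> sZ; rewrite tails_relabel; apply/allP => _ /mapP[m mZ ->].
  by have [] := H m (sZ _ mZ).
have wX : weight (size (tails X)) (value (relabel r X)).
  apply: weight_value; last by rewrite tails_relabel size_map.
  by apply: vg => m mX; rewrite mem_cat mX.
have wY : weight (size (tails Y)) (value (relabel r Y)).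
  apply: weight_value; last by rewrite tails_relabel size_map.
  by apply: vg => m mX; rewrite mem_cat mX orbT.
have [e we E] := comm_congr wX wY wc wd.
rewrite eX eY E size_cat; case: t; last by exists e.
set Q := comm _ _; exists (Q^-1 * e^-1 * Q); last by rewrite invgM mulgK.
rewrite -{2}[Q]invgK; apply: (@weight_conj _ 0); last exact: weightV.
by apply/weightV/(weight_le _ (weight_comm wX wY)).
Qed.

End TreeCommutators.

(** * Labels along a strand *)

(** Heads already inserted around the hole become part of the context. A statement about one plugged
    word, valid in every context, thus extends to all surroundings [a], [b], as a congruence
    requires. *)
Definition absorb (a b : word) (Z : seq (option item)) :=
  bind (fun x => if x == Hole then map hd a ++ Hole :: map hd b else [:: x]) Z.

Lemma flatten_plug_hd u (v : word) :
  flatten [seq if x == Hole then map hd u else [:: x] | x <- map hd v] = map hd v.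
Proof. by elim: v => //= x v ->. Qed.

Lemma plug_absorb u a b Z : plug u (absorb a b Z) = plug (a ++ u ++ b) Z.
Proof.
rewrite /plug /absorb bind_bind; apply: eq_bind => x.
case: (x =P Hole) => [_|/eqP/negbTE xH] /=; last by rewrite xH.
by rewrite map_cat flatten_cat /= !flatten_plug_hd !map_cat.
Qed.

Lemma marks_absorb a b Z : marks (absorb a b Z) = marks Z.
Proof. by rewrite -(marks_plug [::]) plug_absorb marks_plug. Qed.

Lemma absorb_cat a b Z Z' : absorb a b (Z ++ Z') = absorb a b Z ++ absorb a b Z'.
Proof. exact: bind_cat. Qed.
Lemma plug_cat u Z Z' : plug u (Z ++ Z') = plug u Z ++ plug u Z'.
Proof. exact: bind_cat. Qed.

Lemma bind_hole_free f Z : holes Z = 0 ->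
  bind (fun x => if x == Hole then f else [:: x]) Z = Z.
Proof.
elim: Z => // -[x|] Z IH; rewrite bind_cons /holes /=; last by move=> /IH ->.
by case: (x == Hole) => //= /IH ->.
Qed.
Lemma plug_hole_free u Z : holes Z = 0 -> plug u Z = Z.
Proof. exact: bind_hole_free. Qed.
Lemma holes_some (w : seq item) : Hole \notin w -> holes (map Some w) = 0.
Proof. by move=> h; rewrite /holes contents_some; apply/count_memPn. Qed.
Lemma holes_absorb a b Z : holes (absorb a b Z) = holes Z.
Proof.
rewrite /holes contents_bind; elim: (contents Z) => //= x l IH.
rewrite count_cat IH; case: (x =P Hole) => [_|/eqP/negbTE xH] /=; last by rewrite xH.
have c0 (v : word) : count (pred1 Hole) (map hd v) = 0 by elim: v.
by rewrite count_cat /= !c0.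
Qed.

Lemma all_cat_over Z u v : over Z (u ++ v) = over Z u && over Z v.
Proof. exact: all_cat. Qed.

Lemma over1 Z m t : over Z [:: (m, t)] = (m \in marks Z).
Proof. by rewrite /= andbT. Qed.

Lemma over_mark A p B u : over (A ++ B) u -> over (A ++ Some (Mark p) :: B) u.
Proof.
apply: sub_all => x; rewrite -(cat1s (Some _)) !marks_cat !mem_cat.
by case/orP => ->; rewrite ?orbT.
Qed.

(** * The group of a context and its Wirtinger relations *)

Section Model.
Variables n K : nat.
Local Notation cl := (cl n K).
Local Notation valid := (valid n).
Local Notation context := (context n).

Lemma refs_plug_nil Z : refs (plug [::] Z) = refs Z.
Proof.
rewrite /refs contents_bind; elim: (contents Z) => //= x s IH.
by rewrite pmap_cat IH; case: x.
Qed.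

Lemma refs_absorb a b Z : {subset refs (absorb a b Z) <= unzip1 (a ++ b) ++ refs Z}.
Proof. by rewrite -refs_plug_nil plug_absorb; apply: refs_plug. Qed.

Lemma context_absorb a b Z : context Z -> over Z a -> over Z b -> context (absorb a b Z).
Proof.
case/andP => vZ hZ oa ob; rewrite /context holes_absorb hZ andbT.
have [e t u r] := and4P vZ; apply/and4P; split.
- by rewrite ends_bind.
- exact: terminated_bind.
- by rewrite marks_absorb.
- apply/allP => m; rewrite inE marks_absorb => /refs_absorb.
  rewrite mem_cat /unzip1 map_cat mem_cat => /orP[/orP[]|/(allP r)] // /mapP[x xa ->].
    exact: (allP oa).
  exact: (allP ob).
Qed.

(* [G] is the group of words of heads inserted at the hole of [Z], modulo being
   interchangeable there; it plays the role of the group of [Z] modulo the [K]-th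
   term of its lower central series. *)
Record model Z (G : groupType) (phi : word -> G) (l : nat -> G) : Prop := Model {
  modelM : {morph phi : u v / (u ++ v)%SEQ >-> u * v};
  model1 : phi [::] = 1;
  model_letter : forall m s, phi [:: (m, s)] = if s then l m else (l m)^-1;
  model_complete : forall u v, over Z u -> over Z v -> phi u = phi v ->
    forall a b, over Z a -> over Z b -> cl (plug (a ++ u ++ b) Z) = cl (plug (a ++ v ++ b) Z);
  model_sound : forall u v, over Z u -> over Z v ->
    (forall a b, over Z a -> over Z b -> cl (plug (a ++ u ++ b) Z) = cl (plug (a ++ v ++ b) Z)) ->
    phi u = phi v;
  model_tree : forall T, all (mem (marks Z)) (tails T) -> K <= size (tails T) ->
    value l T = 1 }.

Lemma over_expansion s T Z : all (mem (marks Z)) (tails T) -> over Z (expansion s T).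
Proof.
move=> vT; apply/allP => x xe; apply: (allP vT); apply: (@expansion_tails s).
exact: map_f.
Qed.

Lemma modelP Z : context Z -> exists (G : groupType) (phi : word -> G) l, model Z phi l.
Proof.
(* [syntactic_group] requires a function on all words; letters referring to no mark of [Z] are
   dropped, which leaves words over [Z] unchanged. *)
move=> cZ; pose F (u : word) : word := [seq x <- u | x.1 \in marks Z].
have FI u : over Z u -> F u = u by move=> /all_filterP.
have oF u : over Z (F u) by apply: filter_all.
have Fcat u v : F (u ++ v) = F u ++ F v by exact: filter_cat.
have [a m s b|G [phi [phi1 phiM phiP]]] := @syntactic_group _ (fun u => cl (plug (F u) Z)).
  rewrite !Fcat /= ; case mZ: (m \in marks Z) => //.
  change (cl (plug (F a ++ [:: (m, s); (m, ~~ s)] ++ F b) Z) =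
          cl (plug (F a ++ [::] ++ F b) Z)).
  by rewrite -!plug_absorb cl_cancel ?marks_absorb //; apply: context_absorb.
have phi_eq u v : over Z u -> over Z v ->
    (forall a b, over Z a -> over Z b -> cl (plug (a ++ u ++ b) Z) = cl (plug (a ++ v ++ b) Z)) ->
    phi u = phi v.
  by move=> ou ov H; apply/phiP => a b; rewrite !Fcat (FI u) // (FI v) //; apply: H.
exists G, phi, (fun m => phi [:: (m, true)]).
have phil m s : phi [:: (m, s)] = if s then phi [:: (m, true)] else (phi [:: (m, true)])^-1.
  case: s => //; apply/esym/mulg1_eq; rewrite -phiM -phi1; apply/phiP => a b.
  rewrite !Fcat /=; case mZ: (m \in marks Z) => //.
  change (cl (plug (F a ++ [:: (m, true); (m, ~~ true)] ++ F b) Z) =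
          cl (plug (F a ++ [::] ++ F b) Z)).
  by rewrite -!plug_absorb cl_cancel ?marks_absorb //; apply: context_absorb.
split=> // [u v ou ov /phiP H a b oa ob|T vT kT].
  by have := H a b; rewrite !Fcat !FI.
have : phi (expansion true T) = phi [::].
  apply: phi_eq => //; first exact: over_expansion.
  move=> a b oa ob; rewrite -!(plug_absorb _ a b); apply: cl_tree => //.
    exact: context_absorb.
  by rewrite marks_absorb.
by rewrite (value_expansion (l := fun m => phi [:: (m, true)]) true T phiM phil) phi1.
Qed.

Definition head_word (w : seq item) : word :=
  pmap (fun x => if x is Head m s then Some (m, s) else None) w.

Section Slides.
Variables (Z : seq (option item)) (G : groupType) (phi : word -> G) (l : nat -> G).
Hypothesis mZ : model Z phi l.

Lemma model_inv u : phi (inv_word u) = (phi u)^-1.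
Proof.
elim: u => [|[m s] u IH]; first by rewrite (model1 mZ) invg1.
rewrite -cat1s (modelM mZ) invgM -IH /inv_word /= rev_cons -cats1 (modelM mZ).
by congr (_ * _); rewrite !(model_letter mZ); case: s; rewrite ?invgK.
Qed.

Lemma over_inv u : over Z u -> over Z (inv_word u).
Proof.
move=> ou; apply/allP => x; rewrite mem_rev => /mapP[y yu ->]; exact: (allP ou _ yu).
Qed.

Lemma model_expansion s T : phi (expansion s T) = if s then value l T else (value l T)^-1.
Proof. exact: (value_expansion s T (modelM mZ) (model_letter mZ)). Qed.

Lemma weight_word u : over Z u -> weight l (mem (marks Z)) 1 (phi u).
Proof.
elim: u => [|[m s] u IH] /=; first by move=> _; rewrite (model1 mZ); apply: Weight1.
case/andP => mm ou; rewrite -cat1s (modelM mZ); apply: weightM; last exact: IH.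
rewrite (model_letter mZ); have := @weight_value _ l (mem (marks Z)) 1 (Tail (~~ s) m).
by rewrite /= andbT if_neg; apply.
Qed.

Lemma weight_trivial g : weight l (mem (marks Z)) K g -> g = 1.
Proof.
by elim=> [//|T h vT kT _ ->]; rewrite (model_tree mZ) // mulg1.
Qed.

Lemma model_conj u g : phi (inv_word u ++ g ++ u) = (phi u)^-1 * phi g * phi u.
Proof. by rewrite !(modelM mZ) model_inv mulgA. Qed.

Lemma model_adjacent Z1 m m' Z2 t : context Z ->
  Z = Z1 ++ Some (Mark m) :: Some (Mark m') :: Z2 -> phi [:: (m', t)] = phi [:: (m, t)].
Proof.
move=> cZ eZ.
have mm : m \in marks Z by rewrite eZ marks_cat mem_cat /marks /= mem_head orbT.
have mm' : m' \in marks Z by rewrite eZ marks_cat mem_cat /marks /= !inE eqxx !orbT.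
apply: (model_sound mZ) => [||a b oa ob]; [by rewrite /= mm'|by rewrite /= mm|].
have := context_absorb cZ oa ob; rewrite -!(plug_absorb _ a b) eZ absorb_cat => cZ'.
exact: (cl_adjacent K t cZ').
Qed.

Lemma model_slide_head Z1 m x s m' Z2 t : context Z ->
  Z = Z1 ++ Some (Mark m) :: Some (Head x s) :: Some (Mark m') :: Z2 ->
  phi [:: (x, s); (m', t)] = phi [:: (m, t); (x, s)].
Proof.
move=> cZ eZ.
have mm : m \in marks Z by rewrite eZ marks_cat mem_cat /marks /= mem_head orbT.
have mm' : m' \in marks Z by rewrite eZ marks_cat mem_cat /marks /= !inE eqxx !orbT.
have mx : x \in marks Z.
  have /andP[/and4P[_ _ _ /allP r] _] := cZ.
  by apply: r; rewrite eZ refs_cat mem_cat /refs /= mem_head orbT.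
apply: (model_sound mZ) => [||a b oa ob];
  [by rewrite /= mx mm'|by rewrite /= mm mx|].
have := context_absorb cZ oa ob; rewrite -!(plug_absorb _ a b) eZ absorb_cat => cZ'.
exact: (cl_slide K t cZ').
Qed.

End Slides.

Lemma fresh (s : seq nat) : exists p, p \notin s.
Proof.
exists (sumn s).+1; apply/negP => /(nth_index 0); set i := index _ _ => e.
suff : nth 0 s i <= sumn s by rewrite e ltnn.
by elim: s i {e} => [|x s IH] [|i] //=; rewrite ?leq_addr // (leq_trans (IH i)) // leq_addl.
Qed.

Lemma cl_mark v A p B : context (A ++ Some (Mark p) :: B) -> context (A ++ B) ->
  over (A ++ B) v -> cl (plug v (A ++ Some (Mark p) :: B)) = cl (plug v (A ++ B)).
Proof.
move=> cZ /andP[/and4P[_ _ _ /allP r] _] ov; have [vZ _] := andP cZ.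
have pN : p \notin marks (A ++ B).
  have /and4P[_ _ + _] := vZ; rewrite marks_cat -cat1s marks_cat uniq_catCA /=.
  by rewrite marks_cat => /andP[].
have ov' : over (A ++ Some (Mark p) :: B) v.
  exact: over_mark.
have eP : plug v (A ++ Some (Mark p) :: B) = plug v A ++ Some (Mark p) :: plug v B.
  by rewrite plug_cat.
have := valid_plug vZ ov'; rewrite eP plug_cat => vP; apply: cl_unused => //.
rewrite -plug_cat; apply/negP => /refs_plug; rewrite mem_cat => /orP[/mapP[x xv ex]|pr].
  by rewrite ex (allP ov) in pN.
by have := r _ pr; rewrite inE (negbTE pN).
Qed.

Lemma context_mark A p B : context (A ++ B) -> ends B != 0 ->
  p \notin marks (A ++ B) -> context (A ++ Some (Mark p) :: B).
Proof.
case/andP => vZ hZ eB pN; apply/andP; split; first exact: valid_mark.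
by move: hZ; rewrite !holes_cat -[Some _ :: B]cat1s holes_cat.
Qed.

Lemma segment_over Z1 m w m' Z2 Z : valid Z ->
  Z = Z1 ++ Some (Mark m) :: map Some w ++ Some (Mark m') :: Z2 ->
  [/\ m \in marks Z, m' \in marks Z & over Z (head_word w)].
Proof.
case/and4P => _ _ _ /allP r eZ.
rewrite {1 2}eZ -(cat1s (Some (Mark m))) !marks_cat !mem_cat.
rewrite [m' \in marks (_ :: Z2)]mem_head [m \in marks [:: _]]mem_head !orbT; split=> //.
apply/allP => x xw; apply: r; rewrite eZ -(cat1s (Some (Mark m))) !refs_cat !mem_cat.
suff -> : x.1 \in refs (map Some w) by rewrite !orbT.
rewrite /refs contents_some; elim: w xw {eZ} => //= -[q|q s|] w IH //=.
by rewrite !inE => /orP[/eqP->|/IH->]; rewrite ?eqxx ?orbT.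
Qed.

(* Passing above the heads of [w] conjugates the label of a tail. *)
Lemma cl_slide_word w Z1 m m' Z2 t a b :
  let Z := Z1 ++ Some (Mark m) :: map Some w ++ Some (Mark m') :: Z2 in
  let h := head_word w in
  Hole \notin w -> context Z -> over Z a -> over Z b ->
  cl (plug (a ++ [:: (m', t)] ++ b) Z) =
  cl (plug (a ++ (inv_word h ++ [:: (m, t)] ++ h) ++ b) Z).
Proof.
elim: w Z1 m Z2 a b => [|y w IH] Z1 m Z2 a b Z h hw cZ oa ob.
  have [G [phi [l mZ]]] := modelP cZ.
  have mm : m \in marks Z by rewrite /Z marks_cat mem_cat /marks /= mem_head orbT.
  have mm' : m' \in marks Z by rewrite /Z marks_cat mem_cat /marks /= !inE eqxx !orbT.
  apply: (model_complete mZ) => //=; rewrite ?mm ?mm' //.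
  exact: (model_adjacent mZ t cZ (erefl _)).
have /andP[vZ _] := cZ.
have [mm mm' _] := segment_over vZ (erefl Z : _ = Z1 ++ Some (Mark m) :: map Some (y :: w) ++ Some (Mark m') :: Z2).
have hwZ (v : seq item) A B : Z = A ++ map Some v ++ B -> over Z (head_word v).
  move=> eZ; apply/allP => x xv; have /andP[/and4P[_ _ _ /allP r] _] := cZ.
  apply: r; rewrite eZ !refs_cat !mem_cat; apply/orP; right; apply/orP; left.
  rewrite /refs contents_some; elim: v xv {eZ} => //= -[q|q s|] v IHv //=.
  by rewrite !inE => /orP[/eqP->|/IHv->]; rewrite ?eqxx ?orbT.
case: y @h hw @Z vZ cZ oa ob mm mm' hwZ => [p|x s|] h hw Z vZ cZ oa ob mm mm' hwZ //.
- have [G [phi [l mZ]]] := modelP cZ.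
  rewrite inE /= in hw.
  have eZ : Z = (Z1 ++ [:: Some (Mark m)]) ++ Some (Mark p) :: map Some w ++ Some (Mark m') :: Z2.
    by rewrite -catA.
  have oh : over Z h by apply: (hwZ w (Z1 ++ [:: Some (Mark m); Some (Mark p)]) (Some (Mark m') :: Z2)); rewrite -catA.
  have mp : p \in marks Z by rewrite eZ marks_cat mem_cat /marks /= mem_head orbT.
  have E1 : phi [:: (m', t)] = phi (inv_word h ++ [:: (p, t)] ++ h).
    apply: (model_sound mZ); rewrite ?over_cat /= ?mm' ?mp //.
      by rewrite all_cat_over over_inv //= mp.
    move=> a' b' oa' ob'; rewrite eZ; apply: IH => //; by rewrite -eZ.
  apply: (model_complete mZ) => //; rewrite ?all_cat_over ?over_inv ?over1 ?mm' ?mm //.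
  rewrite E1 !(model_conj mZ); congr (_ * _ * _).
  exact: (model_adjacent mZ t cZ (erefl _)).
rewrite inE /= in hw.
pose A := Z1 ++ [:: Some (Mark m); Some (Head x s)].
pose B := map Some w ++ Some (Mark m') :: Z2.
have eZ : Z = A ++ B by rewrite /A -catA.
(* [cl_slide] needs a mark just above the head [x]. A fresh one is created there; the words to be
   compared do not refer to it, so [cl_mark] removes it afterwards. *)
have [p pN] := fresh (marks Z).
have eB : ends B != 0.
  have /andP[/and4P[_ tZ _ _] _] := cZ.
  have [|Z3 e3] := @terminated_end _ (A ++ map Some w) (Mark m') Z2.
    by rewrite -catA -eZ.
  by rewrite /B e3 !ends_cat /= ends_cat /= !addnS.
pose Y := A ++ Some (Mark p) :: B.
have cY : context Y by apply: context_mark; rewrite -?eZ.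
have oY u : over Z u -> over Y u.
  by rewrite eZ; apply: over_mark.
have YZ u : over Z u -> cl (plug u Y) = cl (plug u Z).
  by move=> ou; rewrite eZ; apply: cl_mark; rewrite -?eZ.
have [G [phi [l mY]]] := modelP cY.
pose h' := head_word w.
have oh' : over Z h'.
  by apply: (hwZ w A (Some (Mark m') :: Z2)); rewrite eZ.
have ox : x \in marks Z.
  by have /= := hwZ [:: Head x s] (Z1 ++ [:: Some (Mark m)]) B; rewrite -catA => /(_ erefl) /andP[].
have mp : p \in marks Y by rewrite /Y marks_cat mem_cat /marks /= mem_head orbT.
have mY' q : q \in marks Z -> q \in marks Y.
  by move=> qZ; have := oY [:: (q, true)]; rewrite !over1; apply.
have E1 : phi [:: (m', t)] = phi (inv_word h' ++ [:: (p, t)] ++ h').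
  apply: (model_sound mY); rewrite ?all_cat_over ?over1 ?mp ?mY' ?oY ?over_inv ?oY //.
  by move=> a' b' oa' ob'; apply: IH.
have E2 : phi [:: (x, s); (p, t)] = phi [:: (m, t); (x, s)].
  apply: (model_slide_head mY (Z1 := Z1) (Z2 := B) t cY).
  by rewrite /Y /A -catA.
have oh : over Z h by rewrite /h /= ox.
rewrite -!YZ; last 2 first.
- by rewrite !all_cat_over oa over_inv ?over1 ?mm ?oh ?ob.
- by rewrite !all_cat_over oa over1 mm' ob.
apply: (model_complete mY); rewrite ?all_cat_over ?over1 ?mY' ?over_inv ?oY ?mm //.
rewrite E1 !(model_conj mY); rewrite /h /= -/h' -(cat1s (x, s) h') (modelM mY) invgM.
have : phi [:: (p, t)] = (phi [:: (x, s)])^-1 * phi [:: (m, t)] * phi [:: (x, s)].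
  have E3 : phi [:: (x, s)] * phi [:: (p, t)] = phi [:: (m, t)] * phi [:: (x, s)].
    by rewrite -!(modelM mY).
  by rewrite -mulgA -E3 mulKg.
by move=> ->; rewrite !mulgA.
Qed.

End Model.

(** * Moving heads *)

Definition hds (u : word) : seq (option item) := map Some (map hd u).

Lemma head_word_hd u : head_word (map hd u) = u.
Proof. by elim: u => //= -[m s] u ->. Qed.
Lemma Hole_hd u : Hole \notin map hd u.
Proof. by apply/mapP => -[x _]. Qed.
Lemma holes_hds u : holes (hds u) = 0.
Proof. by rewrite holes_some // Hole_hd. Qed.
Lemma marks_hds u : marks (hds u) = [::].
Proof. by rewrite /marks contents_some; elim: u. Qed.
Lemma refs_hds u : refs (hds u) = unzip1 u.
Proof. by rewrite /refs contents_some; elim: u => //= x u ->. Qed.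

Lemma plug_at u A B : holes A = 0 -> holes B = 0 ->
  plug u (A ++ Some Hole :: B) = A ++ hds u ++ B.
Proof. by move=> hA hB; rewrite plug_cat [plug u (_ :: _)]bind_cons -/(plug u B) !plug_hole_free. Qed.

Lemma ends_after (X : Type) (w : seq (option X)) x w' :
  terminated (w ++ Some x :: w') -> ends w' != 0.
Proof. by move=> t; have [w1 ->] := terminated_end t; rewrite ends_cat addn_eq0 andbF. Qed.

Lemma tails_expansion s T : {subset tails T <= unzip1 (expansion s T)}.
Proof.
move=> m; elim: T s => //= t X IX Y IY s.
rewrite mem_cat; case: (s (+) t); rewrite /unzip1 !map_cat !mem_cat.
  by case/orP => [/IX h|/IY h]; rewrite (h true) ?orbT.
by case/orP => [/IX h|/IY h]; rewrite (h false) ?orbT.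
Qed.

Section Heads.
Variables n k : nat.
Local Notation cl := (cl n k.+1).
Local Notation valid := (valid n).
Local Notation context := (context n).

Lemma valid_hole A B : valid (A ++ B) -> ends B != 0 -> holes A = 0 -> holes B = 0 ->
  context (A ++ Some Hole :: B).
Proof.
case/and4P => e t u r eB hA hB; apply/andP; split; last first.
  by rewrite -(cat1s (Some Hole)) !holes_cat hA hB.
apply/and4P; split.
- by move: e; rewrite !ends_cat.
- by case: B t eB {e u r hB} => // x B; rewrite /terminated !last_cat.
- by move: u; rewrite -(cat1s (Some Hole)) !marks_cat.
- by move: r; rewrite -(cat1s (Some Hole)) !marks_cat !refs_cat.
Qed.

Lemma model_segment Z (G : groupType) (phi : word -> G) l m w m' Z1 Z2 : model n k.+1 Z phi l ->
  context Z -> Z = Z1 ++ Some (Mark m) :: map Some w ++ Some (Mark m') :: Z2 ->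
  Hole \notin w ->
  over Z (head_word w) /\ l m' = (phi (head_word w))^-1 * l m * phi (head_word w).
Proof.
move=> mZ cZ eZ hw; have /andP[vZ _] := cZ.
have [mm mm' ow] := segment_over vZ eZ.
split=> //.
have : phi [:: (m', true)] = phi (inv_word (head_word w) ++ [:: (m, true)] ++ head_word w).
  apply: (model_sound mZ); rewrite ?all_cat_over ?over1 ?over_inv ?mm ?mm' //.
  by move=> a b oa ob; rewrite eZ; apply: cl_slide_word; rewrite -?eZ.
by rewrite (model_conj mZ) !(model_letter mZ).
Qed.

Lemma cl_relabel r s T Z : context Z -> all (mem (marks Z)) (tails T) ->
  size (tails T) = k ->
  {in tails T, forall m, r m \in marks Z /\ (r m = m \/ exists Z1 w Z2,
     Z = Z1 ++ Some (Mark m) :: map Some w ++ Some (Mark (r m)) :: Z2 /\ Hole \notin w)} ->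
  cl (plug (expansion s T) Z) = cl (plug (expansion s (relabel r T)) Z).
Proof.
move=> cZ vT sT H; have [G [phi [l mZ]]] := modelP k.+1 cZ.
have E : value l T = value l (relabel r T).
  have [m mT|e we ->] := @value_relabel G l (mem (marks Z)) r T vT.
    have [rm E] := H m mT; split=> //; case: E => [->|[Z1 [w [Z2 [eZ hw]]]]].
      by exists 1; [apply: Weight1|rewrite mul1g].
    have [ow ->] := model_segment mZ cZ eZ hw; set x := phi _.
    have wx : weight l (mem (marks Z)) 1 x by exact: (weight_word mZ).
    have wm : weight l (mem (marks Z)) 1 (l m).
      apply: (@weight_value _ l (mem (marks Z)) 1 (Tail false m)) => //=.
      by rewrite andbT; exact: (allP vT m mT).
    (* This is the quotient of [l m] by its conjugate, written as a commutator so that its weight is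
       visible. *)
    exists (comm x (x^-1 * l m * x)).
      apply: (@weight_comm _ _ _ 1 1) => //.
      by apply: weightM => //; apply: weightM => //; apply: weightV.
    by rewrite /comm !invgM !mulgA !mulgVK !mulgV mul1g mulgK.
  by rewrite (weight_trivial mZ (g := e)) ?mul1g // -sT.
have vrT : all (mem (marks Z)) (tails (relabel r T)).
  by rewrite tails_relabel; apply/allP => _ /mapP[m mT ->]; case: (H m mT).
have := @model_complete _ _ _ _ _ _ mZ (expansion s T) (expansion s (relabel r T))
  (over_expansion s vT) (over_expansion s vrT) _ [::] [::] isT isT.
by rewrite !cats0; apply; rewrite !(model_expansion mZ) E.
Qed.

(** Joining a tail at [x] to [T] gives a tree with [k.+1] tails, whose value is both trivial and the
    commutator of the two labels. *)
Lemma model_commute Z (G : groupType) (phi : word -> G) l T s x s' : model n k.+1 Z phi l ->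
  all (mem (marks Z)) (tails T) -> size (tails T) = k -> x \in marks Z ->
  commute (phi (expansion s T)) (phi [:: (x, s')]).
Proof.
move=> mZ vT sT xZ.
have C : commute (value l T) (l x).
  have := model_tree mZ (T := Vertex false T (Tail false x)).
  rewrite /= all_cat vT /= xZ size_cat sT addn1 leqnn => /(_ isT isT).
  by rewrite /comm => /divg1_eq E; rewrite /commute -{1}E mulgVK.
rewrite (model_expansion mZ) (model_letter mZ).
have C1 : commute (value l T) (if s' then l x else (l x)^-1).
  by case: (s') => //; apply: commuteV.
by case: s => //; apply/commute_sym/commuteV/commute_sym.
Qed.

Lemma valid_perm P P' : ends P' = ends P -> terminated P' ->
  perm_eq (contents P) (contents P') -> valid P -> valid P'.
Proof.
rewrite /valid => -> -> pe; rewrite /marks /refs.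
rewrite (perm_uniq (perm_pmap mark_of pe)) => /and4P[-> _ -> /allP r] /=.
apply/allP => m; rewrite inE -(perm_mem (perm_pmap ref_of pe)) => /r.
by rewrite inE (perm_mem (perm_pmap mark_of pe)).
Qed.

Lemma marks_hole A B : marks (A ++ Some Hole :: B) = marks (A ++ B).
Proof. by rewrite -(cat1s (Some Hole)) !marks_cat. Qed.

Lemma hds_cat u v : hds (u ++ v) = hds u ++ hds v.
Proof. by rewrite /hds !map_cat. Qed.

Lemma ends_hds u : ends (hds u) = 0.
Proof. exact: ends_some. Qed.

Lemma valid_drop u A B : valid (A ++ hds u ++ B) -> ends B != 0 -> valid (A ++ B).
Proof.
case/and4P => e t m r eB; apply/and4P; split.
- by move: e; rewrite !ends_cat ends_hds.
- by case: B t eB {e m r} => // x B; rewrite /terminated !last_cat.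
- by move: m; rewrite !marks_cat marks_hds.
- by move: r; rewrite !marks_cat marks_hds !refs_cat !all_cat => /and3P[-> _ ->].
Qed.

Lemma over_of_valid u A B : valid (A ++ hds u ++ B) -> all (fun x => x.1 \in marks (A ++ B)) u.
Proof.
case/and4P => _ _ _ /allP r; apply/allP => x xu.
have := r x.1; rewrite !inE !refs_cat !mem_cat refs_hds (map_f fst xu) orbT => /(_ isT).
by rewrite !marks_cat marks_hds !mem_cat.
Qed.

Lemma cl_head_swap A x s' C T s : let e := expansion s T in
  valid (A ++ Some (Head x s') :: C) -> ends C != 0 -> holes A = 0 -> holes C = 0 ->
  all (mem (marks (A ++ C))) (tails T) -> size (tails T) = k ->
  cl (A ++ hds e ++ Some (Head x s') :: C) = cl (A ++ Some (Head x s') :: hds e ++ C).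
Proof.
move=> e v eC hA hC vT sT.
have v' : valid (A ++ C) := valid_drop (u := [:: (x, s')]) v eC.
have cZ := valid_hole v' eC hA hC.
have /= := over_of_valid (u := [:: (x, s')]) v; rewrite andbT => xZ.
have [G [phi [l mZ]]] := modelP k.+1 cZ.
have vT' : all (mem (marks (A ++ Some Hole :: C))) (tails T) by rewrite marks_hole.
have xZ' : x \in marks (A ++ Some Hole :: C) by rewrite marks_hole.
have oe := over_expansion s vT'.
have := @model_complete _ _ _ _ _ _ mZ (e ++ [:: (x, s')]) ([:: (x, s')] ++ e) _ _ _ [::] [::] isT isT.
rewrite !all_cat_over oe over1 xZ' !cats0 !plug_at // !hds_cat -!catA; apply=> //.
by rewrite !(modelM mZ); apply: model_commute mZ vT' sT xZ'.
Qed.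

Definition redirect (m m' : nat) : seq (option item) -> seq (option item) :=
  map (fun x => if x is Some (Head q s) then Some (Head (if q == m then m' else q) s) else x).

Lemma holes_redirect m m' P : holes (redirect m m' P) = holes P.
Proof. by rewrite /holes; elim: P => //= -[[q|q s|]|] P /= ->. Qed.
Lemma marks_redirect m m' P : marks (redirect m m' P) = marks P.
Proof. by rewrite /marks; elim: P => //= -[[q|q s|]|] P /= ->. Qed.
Lemma ends_redirect m m' P : ends (redirect m m' P) = ends P.
Proof. by elim: P => //= -[[q|q s|]|] P /= ->. Qed.
Lemma refs_redirect m m' P : m != m' -> m \notin refs (redirect m m' P).
Proof.
move=> mm; rewrite /refs; elim: P => //= -[[q|q s|]|] P IH //=.
by rewrite inE negb_or IH andbT; case: (q =P m) => [//|/eqP]; rewrite eq_sym.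
Qed.

(* References to [m] can be redirected to [m'] one head at a time as long as the
   portion [W] forcing the labels of [m] and [m'] to agree is left untouched. *)
Lemma cl_redirect W m m' X A Y :
  (forall Z, context Z -> (exists Z1 Z2, Z = Z1 ++ W ++ Z2) ->
     forall t, cl (plug [:: (m, t)] Z) = cl (plug [:: (m', t)] Z)) ->
  m' \in marks W ->
  (exists X1 X2, X = X1 ++ W ++ X2) \/ (exists Y1 Y2, Y = Y1 ++ W ++ Y2) ->
  valid (X ++ A ++ Y) -> holes (X ++ A ++ Y) = 0 ->
  valid (X ++ redirect m m' A ++ Y) /\
  cl (X ++ A ++ Y) = cl (X ++ redirect m m' A ++ Y).
Proof.
move=> HW m'W; elim: A X => // x A IH X WXY v h0.
have WX z : (exists X1 X2, X ++ [:: z] = X1 ++ W ++ X2) \/ (exists Y1 Y2, Y = Y1 ++ W ++ Y2).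
  case: WXY => [[X1 [X2 ->]]|]; [left|by right].
  by exists X1, (X2 ++ [:: z]); rewrite -!catA.
have [[q [s [ex qm]]]|E] : (exists q s, x = Some (Head q s) /\ q = m) \/
    redirect m m' (x :: A) = x :: redirect m m' A.
  case: x {WX v h0} => [[q|q s|]|]; try by right.
  case: (q =P m) => [->|/eqP/negbTE qm]; first by left; exists m, s.
  by right; rewrite /redirect /= qm.
- subst x q; pose Z := X ++ Some Hole :: A ++ Y.
  have eAY : ends (A ++ Y) != 0 by apply: (@ends_after _ X (Head m s)); case/and4P: v.
  have v' : valid (X ++ A ++ Y) := valid_drop (u := [:: (m, s)]) v eAY.
  have hh : holes X = 0 /\ holes (A ++ Y) = 0.
    by move: h0; rewrite holes_cat /= -[Some _ :: _]cat1s holes_cat => /eqP; rewrite !addn_eq0 /= => /andP[/eqP-> /eqP->].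
  have [hX hAY] := hh.
  have cZ : context Z by exact: valid_hole.
  have WZ : exists Z1 Z2, Z = Z1 ++ W ++ Z2.
    case: WXY => [[X1 [X2 eX]]|[Y1 [Y2 eYY]]].
      by exists X1, (X2 ++ Some Hole :: A ++ Y); rewrite /Z eX -!catA.
    by exists (X ++ Some Hole :: A ++ Y1), Y2; rewrite /Z eYY -?catA /= -?catA.
  have := HW Z cZ WZ s; rewrite !plug_at // => E1.
  have v2 : valid (X ++ hds [:: (m', s)] ++ A ++ Y).
    rewrite -plug_at //; apply: valid_plug; first by case/andP: cZ.
    by rewrite over1 -/Z; case: WZ => Z1 [Z2 eZ]; rewrite eZ !marks_cat !mem_cat m'W orbT.
  have E2 : redirect m m' (Some (Head m s) :: A) = hds [:: (m', s)] ++ redirect m m' A.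
    by rewrite /redirect /= eqxx.
  rewrite E2 -catA [LHS in _ /\ LHS = _]E1.
  have := IH (X ++ hds [:: (m', s)]); rewrite -!catA; apply=> //; first exact: WX.
  by rewrite /hds /= holes_cat -cat1s holes_cat hX hAY.
- rewrite E; have := IH (X ++ [:: x]); rewrite -!catA; apply=> //; exact: WX.
Qed.

(* A fresh mark [m2] is created below the heads.  The labels of [m] and [m2] differ
   by conjugation by a commutator of weight [k], hence agree, so that all references
   to [m] can be redirected to [m2]; then [m] is recreated next to [m2]. *)
Lemma cl_mark_swap A m C T s : let e := expansion s T in
  valid (A ++ hds e ++ Some (Mark m) :: C) -> holes A = 0 -> holes C = 0 ->
  m \notin tails T -> size (tails T) = k ->
  cl (A ++ hds e ++ Some (Mark m) :: C) = cl (A ++ Some (Mark m) :: hds e ++ C).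
Proof.
move=> e v hA hC mT sT.
have [_ tv _ _] := and4P v.
have eC : ends C != 0 by apply: (@ends_after _ (A ++ hds e) (Mark m)); rewrite -catA.
have [m2 m2N] := fresh (marks (A ++ hds e ++ Some (Mark m) :: C)).
have mE : marks (A ++ hds e ++ Some (Mark m) :: C) = marks A ++ m :: marks C.
  by rewrite !marks_cat marks_hds.
have mm2 : m != m2.
  by apply: contraNneq m2N => <-; rewrite mE mem_cat mem_head orbT.
(* [W] and [W'] force the labels of [m] and [m2] to agree for different reasons: the heads between
   them commute with the label in [W], and the marks are adjacent in [W']. *)
pose W := Some (Mark m2) :: hds e ++ [:: Some (Mark m)].
pose W' := [:: Some (Mark m); Some (Mark m2)].
have HW Z : context Z -> (exists Z1 Z2, Z = Z1 ++ W ++ Z2) ->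
    forall t, cl (plug [:: (m, t)] Z) = cl (plug [:: (m2, t)] Z).
  move=> cZ [Z1 [Z2 eZ]] t; have /andP[vZ _] := cZ.
  have eZ' : Z = Z1 ++ Some (Mark m2) :: map Some (map hd e) ++ Some (Mark m) :: Z2.
    by rewrite eZ /W /= -!catA.
  have [m2Z mZ oe] := segment_over vZ eZ'; rewrite head_word_hd in oe.
  have [G [phi [l mod]]] := modelP k.+1 cZ.
  have vT : all (mem (marks Z)) (tails T).
    by apply/allP => q /(tails_expansion s) /mapP[x xe ->]; exact: (allP oe).
  have [_] := model_segment mod cZ eZ' (Hole_hd e); rewrite head_word_hd.
  have := model_commute s true mod vT sT m2Z; rewrite (model_letter mod) => C1.
  rewrite -mulgA -C1 mulKg => E.
  have := @model_complete _ _ _ _ _ _ mod [:: (m, t)] [:: (m2, t)] _ _ _ [::] [::] isT isT.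
  by apply; rewrite ?over1 // !(model_letter mod) E.
have HW' Z : context Z -> (exists Z1 Z2, Z = Z1 ++ W' ++ Z2) ->
    forall t, cl (plug [:: (m, t)] Z) = cl (plug [:: (m2, t)] Z).
  by move=> cZ [Z1 [Z2 eZ]] t; rewrite eZ; apply/esym/cl_adjacent; rewrite -eZ.
have m2W : m2 \in marks W by rewrite mem_head.
have m2W' : m2 \in marks W' by rewrite /marks /= !inE eqxx orbT.
have hW : holes W = 0 by rewrite /W -cat1s !holes_cat holes_hds.
pose rA := redirect m m2 A; pose rC := redirect m m2 C.
have hrA : holes rA = 0 by rewrite holes_redirect.
have hrC : holes rC = 0 by rewrite holes_redirect.
have v1 : valid (A ++ W ++ C).
  rewrite /W /= -catA; apply: valid_mark => //.
  by rewrite !ends_cat ends_hds.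
have c1 : cl (A ++ hds e ++ Some (Mark m) :: C) = cl (A ++ W ++ C).
  apply/esym; have := v1; rewrite /W /= -catA => v1'; apply: cl_unused => //.
  apply/negP => m2r; have /and4P[_ _ _ /allP r] := v.
  by have := r _ m2r; rewrite inE (negbTE m2N).
have [|||v2 c2] := @cl_redirect W m m2 [::] A (W ++ C) HW m2W; rewrite ?holes_cat ?hA ?hW ?hC //.
  by right; exists [::], C.
have [|||v3 c3] := @cl_redirect W m m2 (rA ++ W) C [::] HW m2W.
- by left; exists rA, [::]; rewrite cats0.
- by rewrite cats0 -catA.
- by rewrite cats0 !holes_cat hrA hW hC.
rewrite !cats0 -!catA -/rC in v3 c3.
have v3' : valid ((rA ++ Some (Mark m2) :: hds e) ++ Some (Mark m) :: rC).
  by move: v3; rewrite /W /= -?catA /= -?catA.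
(* The heads [e] inside [W] have not been redirected; they avoid [m] because [T] has no tail there.
   Hence [m] can be deleted. *)
have mr : m \notin refs ((rA ++ Some (Mark m2) :: hds e) ++ rC).
  rewrite -(cat1s (Some (Mark m2))) !refs_cat refs_hds !mem_cat !negb_or !refs_redirect //= andbT.
  by apply: contra mT; apply: expansion_tails.
have c4 : cl (rA ++ W ++ rC) = cl (rA ++ Some (Mark m2) :: hds e ++ rC).
  by have := cl_unused k.+1 v3' mr; rewrite /W /= -?catA /= -?catA.
have v4 : valid (rA ++ Some (Mark m2) :: hds e ++ rC).
  by have := valid_unmark v3' mr; rewrite -!catA.
have erC : ends rC != 0 by rewrite ends_redirect.
have v5 : valid (rA ++ W' ++ hds e ++ rC).
  apply: valid_mark => //; first by rewrite /= ends_cat ends_hds.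
  rewrite -(cat1s (Some (Mark m2))) !marks_cat marks_hds !marks_redirect !mem_cat !negb_or /=.
  have /and4P[_ _ + _] := v; rewrite mE cat_uniq /= negb_or.
  by case/and3P => _ /andP[-> _] /andP[-> _]; rewrite mm2.
have c5 : cl (rA ++ W' ++ hds e ++ rC) = cl (rA ++ Some (Mark m2) :: hds e ++ rC).
  by apply: cl_unused => //; move: mr; rewrite -catA.
have v6 : valid (A ++ Some (Mark m) :: hds e ++ C).
  apply: valid_perm v; rewrite ?ends_cat /= ?ends_cat //.
    by case: C eC tv {hC v1 c1 v2 c2 v3 c3 rC hrC v3' mr c4 v4 erC v5 c5 mE m2N} => // x C _;
      rewrite /terminated !last_cat /= !last_cat.
  rewrite -(cat1s (Some (Mark m)) C) -(cat1s (Some (Mark m)) (hds e ++ C)) !contents_cat.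
  by rewrite perm_cat2l perm_catCA.
have v7' : valid ((A ++ [:: Some (Mark m)]) ++ Some (Mark m2) :: hds e ++ C).
  apply: valid_mark; rewrite -?catA ?ends_cat ?ends_hds //.
  by move: m2N; rewrite mE marks_cat -cat1s !marks_cat marks_hds.
have v7 : valid (A ++ W' ++ hds e ++ C) by move: v7'; rewrite -catA.
have c7 : cl (A ++ W' ++ hds e ++ C) = cl (A ++ Some (Mark m) :: hds e ++ C).
  have := @cl_unused n k.+1 _ _ _ v7'; rewrite -!catA; apply.
  have /and4P[_ _ _ /allP r] := v6; apply/negP => /r; rewrite inE.
  move: m2N; rewrite mE -(cat1s (Some (Mark m))) !marks_cat marks_hds.
  by move=> /negbTE ->.
have [|||v8 c8] := @cl_redirect W' m m2 [::] A (W' ++ hds e ++ C) HW' m2W';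
  rewrite ?holes_cat ?holes_hds ?hA ?hC //.
  by right; exists [::], (hds e ++ C).
have [|||v9 c9] := @cl_redirect W' m m2 (rA ++ W' ++ hds e) C [::] HW' m2W'.
- by left; exists rA, (hds e); rewrite catA.
- by rewrite cats0 -!catA.
- by rewrite cats0 !holes_cat hrA holes_hds hC.
rewrite !cats0 -!catA -/rC in v9 c9.
(* Both sides equal the word where all references to [m] go to [m2] and [m] is absent: the left side
   is reached through [W], the right side through [W']. *)
by rewrite c1 c2 /= c3 c4 -c5 -c9 -c7 c8.
Qed.

End Heads.

Local Close Scope group_scope.

(** * Standard trees *)

Section InsLemmas.
Variable X : Type.
Implicit Types (q : nat -> seq X).

Lemma first_end (w : seq (option X)) : ends w != 0 ->
  exists (v : seq X) w', w = map Some v ++ None :: w'.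
Proof.
elim: w => // -[x|] w IH; last by exists [::], w.
by move=> /IH[v [w' ->]]; exists (x :: v), w'.
Qed.

Lemma no_end (w : seq (option X)) : ends w = 0 -> exists v : seq X, w = map Some v.
Proof.
elim: w => [|[x|] w IH] //; first by exists [::].
by move=> /IH[v ->]; exists (x :: v).
Qed.

Lemma ins_eq q q' j w :
  (forall i, j <= i < j + ends w -> q i = q' i) -> ins q j w = ins q' j w.
Proof.
elim: w j => //= -[x|] w IH j H /=; first by rewrite (IH _ H).
rewrite H ?leqnn ?addnS ?ltnS ?leq_addr // (IH j.+1) // => i /andP[ji ij].
by apply: H; rewrite (ltnW ji) /= addnS -addSn.
Qed.
End InsLemmas.

Lemma contents_ins_ends (X : eqType) (q : nat -> seq X) j k x :
  x \in contents (ins q j (nseq k None)) -> exists2 i, j <= i < j + k & x \in q i.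
Proof.
elim: k j => //= k IH j; rewrite contents_cat contents_some mem_cat => /orP[xq|/IH[i /andP[ji ik] xi]].
  by exists j; rewrite ?leqnn ?addnS ?ltnS ?leq_addr.
by exists i; rewrite // (ltnW ji) addnS -addSn.
Qed.

Lemma mark_mem P m : m \in marks P -> exists A B, P = A ++ Some (Mark m) :: B.
Proof.
elim: P => //= -[[q|q s|]|] P IH; rewrite /marks /= -?/(marks _).
- rewrite inE => /orP[/eqP->|/IH[A [B ->]]]; first by exists [::], P.
  by exists (Some (Mark q) :: A), B.
- by move=> /IH[A [B ->]]; exists (Some (Head q s) :: A), B.
- by move=> /IH[A [B ->]]; exists (Some Hole :: A), B.
- by move=> /IH[A [B ->]]; exists (None :: A), B.
Qed.

Lemma context_split n Z : context n Z -> exists A B,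
  [/\ Z = A ++ Some Hole :: B, holes A = 0 & holes B = 0].
Proof.
case/andP => _ /eqP; elim: Z => //= x Z IH.
rewrite -cat1s holes_cat; case: x => [[q|q s|]|] /=.
- by rewrite add0n => /IH[A [B [-> hA hB]]]; exists (Some (Mark q) :: A), B.
- by rewrite add0n => /IH[A [B [-> hA hB]]]; exists (Some (Head q s) :: A), B.
- by move=> [hZ]; exists [::], Z.
- by rewrite add0n => /IH[A [B [-> hA hB]]]; exists (None :: A), B.
Qed.

Lemma choice_in (s : seq nat) (P : nat -> nat -> Prop) :
  (forall m, m \in s -> exists m', P m m') ->
  exists r, forall m, m \in s -> P m (r m).
Proof.
move=> H; have [m|r Hr] := @choice _ _ (fun m m' => m \in s -> P m m'); last by exists r.
case ms: (m \in s); last by exists 0.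
by have [m' Pm] := H m ms; exists m'.
Qed.

Section Standard.
Variables n k : nat.
Local Notation cl := (cl n k.+1).
Local Notation valid := (valid n).
Local Notation context := (context n).

(** The heads cross [w] one item at a time, by [cl_head_swap] or [cl_mark_swap]; the latter asks
    that the mark crossed carry no tail of [T]. *)
Lemma cl_move_head A w C T s : let e := expansion s T in
  valid (A ++ hds e ++ map Some w ++ C) -> holes A = 0 -> holes C = 0 -> Hole \notin w ->
  {in tails T, forall m, m \notin marks (map Some w)} -> size (tails T) = k ->
  valid (A ++ map Some w ++ hds e ++ C) /\
  cl (A ++ hds e ++ map Some w ++ C) = cl (A ++ map Some w ++ hds e ++ C).
Proof.
move=> e; elim: w A => // x w IH A v hA hC hw dT sT.
move: hw; rewrite inE negb_or => /andP[xH hw].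
have pe : perm_eq (contents (A ++ hds e ++ Some x :: map Some w ++ C))
                  (contents (A ++ Some x :: hds e ++ map Some w ++ C)).
  rewrite -(cat1s (Some x)) -(cat1s (Some x) (hds e ++ _)) !contents_cat.
  by rewrite perm_cat2l perm_catCA.
have [_ tv _ _] := and4P v.
have eC' : ends (map Some w ++ C) != 0.
  by apply: (@ends_after _ (A ++ hds e) x); rewrite -catA.
have v' : valid (A ++ Some x :: hds e ++ map Some w ++ C).
  apply: valid_perm pe _ => //; first by rewrite !ends_cat /= !ends_cat.
  move: eC'; rewrite /terminated !last_cat /= !last_cat in tv *.
  by rewrite ends_cat ends_some; case: (C) tv.
have hwC : holes (map Some w ++ C) = 0 by rewrite holes_cat hC holes_some.
have dT' : {in tails T, forall m, m \notin marks (map Some w)}.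
  move=> m mT; have := dT m mT; rewrite /= -cat1s marks_cat mem_cat negb_or.
  by case/andP.
have E : cl (A ++ hds e ++ Some x :: map Some w ++ C) =
         cl (A ++ Some x :: hds e ++ map Some w ++ C).
  case: x {IH} xH v dT {pe tv} v' => // [m|m s'] _ v dT v'.
    apply: cl_mark_swap => //; apply/negP => mT.
    by have := dT m mT; rewrite /marks /= mem_head.
  have vv : valid (A ++ Some (Head m s') :: map Some w ++ C).
    have := @valid_drop n e (A ++ [:: Some (Head m s')]) (map Some w ++ C).
    by rewrite -!catA; apply.
  apply: cl_head_swap => //.
  apply/allP => q /(tails_expansion s) /mapP[y ye ->].
  have := over_of_valid (u := e) (A := A ++ [:: Some (Head m s')]) (B := map Some w ++ C).
  rewrite -catA => /(_ n v') /allP/(_ _ ye) /=.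
  by rewrite -catA -(cat1s (Some (Head m s'))) !marks_cat.
have hAx : holes (A ++ [:: Some x]) = 0.
  by rewrite holes_cat hA (holes_some (w := [:: x])) // inE.
have := IH (A ++ [:: Some x]); rewrite -!catA => /(_ v' hAx hC hw dT' sT)[v2 E2].
by split=> //; rewrite E.
Qed.

Definition top_mark j := [:: Mark j].
(* Below the top mark [i] of strand [i] come the heads of the tree, and below them the
   extra mark [n], for the tails on strand [i] that are lower than the head. *)
Definition standard i T s j :=
  if j == i then Mark n :: rcons (map hd (expansion s T)) (Mark i) else [:: Mark j].

Lemma cl_top_marks A P j : valid (A ++ ins top_mark j P) ->
  {in refs (A ++ P), forall m, n <= m} -> j + ends P <= n ->
  cl (A ++ ins top_mark j P) = cl (A ++ P).
Proof.
elim: P A j => //= -[x|] P IH A j v rN jN.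
  by have := IH (A ++ [:: Some x]) j; rewrite -!catA; apply.
rewrite /= in v *.
have rE : refs (A ++ None :: ins top_mark j.+1 P) = refs (A ++ None :: P).
  rewrite !refs_cat; congr (_ ++ _).
  rewrite -cat1s -[None :: P]cat1s !refs_cat; congr (_ ++ _).
  rewrite /refs; elim: (P) (j.+1) => //= -[y|] P' IHP j' /=; first by rewrite IHP.
  exact: IHP.
have pN : j \notin refs (A ++ None :: ins top_mark j.+1 P).
  rewrite rE; apply/negP => /rN; rewrite leqNgt.
  by rewrite (leq_trans _ jN) // -addn1 leq_add2l.
rewrite cl_unused //.
have := IH (A ++ [:: None]) j.+1; rewrite -!catA; apply => //.
  by have := valid_unmark v pN.
by rewrite addSnnS.
Qed.

Lemma refs_top_marks j P : refs (ins top_mark j P) = refs P.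
Proof.
rewrite /refs; elim: P j => //= -[y|] P IH j /=; first by rewrite IH.
exact: IH.
Qed.

Lemma holes_top j P : holes (ins top_mark j P) = holes P.
Proof.
rewrite /holes; elim: P j => //= -[y|] P IH j /=; first by rewrite IH.
exact: IH.
Qed.

Lemma top_marks_ends j m : m \in marks (ins top_mark 0 (nseq j None)) -> m < j.
Proof.
rewrite /marks mem_pmap => /mapP[y /contents_ins_ends[i /andP[_ ij]]].
by rewrite inE add0n in ij * => /eqP-> [->].
Qed.

Lemma valid_top_marks : valid (ins top_mark 0 (nseq n None)).
Proof.
apply/and4P; split.
- rewrite ends_ins; apply/eqP; elim: (n) => //= j IH; by rewrite -[in RHS]IH.
- by apply: terminated_ins; elim: (n) => //= -[].
- suff -> : marks (ins top_mark 0 (nseq n None)) = iota 0 n by exact: iota_uniq.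
  by elim: (n) 0 => //= j IH i; rewrite -IH.
- have -> // : refs (ins top_mark 0 (nseq n None)) = [::].
  by rewrite refs_top_marks; elim: (n).
Qed.

Lemma ends_nseq (X : Type) j : ends (nseq j (@None X)) = j.
Proof. by elim: j => //= j IH; rewrite -[in RHS]IH. Qed.

Lemma ins_up j P X m w Y : P = X ++ Some (Mark m) :: map Some w ++ None :: Y ->
  ins top_mark j P = ins top_mark j X ++ Some (Mark m) :: map Some w ++
    Some (Mark (j + ends X)) :: None :: ins top_mark (j + ends X).+1 Y.
Proof. by move=> ->; rewrite ins_cat /= ins_some. Qed.

Lemma relabel_comp r1 r2 T : relabel r2 (relabel r1 T) = relabel (r2 \o r1) T.
Proof. by elim: T => //= t X -> Y ->. Qed.

(* The tails that are not below the hole on its strand are brought to the top marks;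
   the heads are then moved up, just below the top mark of their strand, and the
   remaining tails are brought to the mark [n] created just below the heads.  Every
   step changes labels by commutators of weight 2 only, which is invisible in a tree
   with [k] leaves modulo trees with [k.+1] leaves. *)
Lemma cl_standard Z T s : context Z -> all (fun m => n < m) (marks Z) ->
  all (mem (marks Z)) (tails T) -> size (tails T) = k ->
  exists i r, [/\ i < n, all (fun m => m <= n) (tails (relabel r T)) &
    cl (plug (expansion s T) Z) = wSL_mul (cl (plug [::] Z))
      (cl (ins (standard i (relabel r T) s) 0 (nseq n None)))].
Proof.
move=> cZ /allP gZ vT sT; have /andP[vZ _] := cZ.
have [A [B [eZ hA hB]]] := context_split cZ.
have [/eqP endZ tZ _ _] := and4P vZ.
have endB : ends B != 0 by apply: (@ends_after _ A Hole); rewrite -eZ.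
have [w [C eB]] := first_end endB.
have hw : Hole \notin w.
  by move: hB; rewrite eB holes_cat => /eqP; rewrite addn_eq0 /holes contents_some => /andP[/eqP/count_memPn].
have hC : holes C = 0.
  by move: hB; rewrite eB holes_cat => /eqP; rewrite addn_eq0 => /andP[_ /eqP].
pose i := ends A.
have eiC : i + (ends C).+1 = n.
  by rewrite -endZ eZ eB !ends_cat /= ends_cat ends_some.
have lin : i < n by rewrite -eiC addnS ltnS leq_addr.
pose A1 := ins top_mark 0 A; pose C1 := Some (Mark i) :: None :: ins top_mark i.+1 C.
have hA1 : holes A1 = 0 by rewrite holes_top.
have hC1 : holes C1 = 0.
  have -> : C1 = [:: Some (Mark i); None] ++ ins top_mark i.+1 C by [].
  by rewrite holes_cat holes_top hC.
pose Z1 := ins top_mark 0 Z.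
have eZ1 : Z1 = A1 ++ Some Hole :: map Some w ++ C1.
  rewrite /Z1 eZ eB ins_cat /= ins_some //=.
have mZ0 : {in marks Z, forall m, m \notin marks (ins top_mark 0 (nseq n None))}.
  move=> m /gZ nm; apply/negP => /top_marks_ends mn.
  by move: (ltn_trans mn nm); rewrite ltnn.
have cZ1 : context Z1.
  apply/andP; split; last by rewrite holes_top; case/andP: cZ.
  by apply: valid_ins => //; exact: valid_top_marks.
have mZ1 : {subset marks Z <= marks Z1}.
  by move=> m mZ; rewrite (perm_mem (marks_ins top_mark endZ)) mem_cat mZ.
have plug_ins u : plug u Z1 = ins top_mark 0 (plug u Z) by rewrite /plug bind_ins.
have plugZ u : over Z u -> cl (plug u Z) = cl (plug u Z1).
  move=> ou; rewrite plug_ins; apply: esym; apply: (@cl_top_marks [::] (plug u Z) 0) => /=.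
  - rewrite -plug_ins; apply: valid_plug; first by case/andP: cZ1.
    by apply: sub_all ou => x; apply: mZ1.
  - move=> m; have /and4P[_ _ _ /allP r] := valid_plug vZ ou.
    by move=> /r; rewrite inE marks_plug => /gZ /ltnW.
  - by rewrite ends_bind endZ.
rewrite (plugZ _ (over_expansion s vT)).
have nZ1 : n \notin marks Z1.
  rewrite (perm_mem (marks_ins top_mark endZ)) mem_cat negb_or; apply/andP; split.
    by apply/negP => /gZ; rewrite ltnn.
  by apply/negP => /top_marks_ends; rewrite ltnn.
have mA : {subset marks A <= marks Z} by move=> m; rewrite eZ marks_cat mem_cat => ->.
have mw : {subset marks (map Some w) <= marks Z}.
  move=> m mw; rewrite eZ eB -(cat1s (Some Hole)) !marks_cat !mem_cat mw.
  by rewrite !orbT.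
(* The marks in [A] wait: on the strand of the hole, the way up is blocked by it. Clearing the other
   tails from [w] is what lets the heads move past [w]. *)
have [r1 Hr1] : exists r, forall m, m \in tails T ->
    [/\ r m \in marks Z1, (r m = m \/ exists X v Y,
      Z1 = X ++ Some (Mark m) :: map Some v ++ Some (Mark (r m)) :: Y /\ Hole \notin v)
      & (r m < n) \/ r m \in marks A].
  apply: (@choice_in (tails T) (fun m m' => [/\ m' \in marks Z1, (m' = m \/ exists X v Y,
      Z1 = X ++ Some (Mark m) :: map Some v ++ Some (Mark m') :: Y /\ Hole \notin v)
      & (m' < n) \/ m' \in marks A])) => m /(allP vT); rewrite inE => mZ.
  case mA' : (m \in marks A); first by exists m; split; [exact: mZ1|left|right].
  have /mark_mem[X [Y eXY]] : m \in marks B.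
    by move: mZ; rewrite eZ marks_hole marks_cat mem_cat mA'.
  have eZ' : Z = (A ++ Some Hole :: X) ++ Some (Mark m) :: Y by rewrite eZ eXY -catA.
  have endY : ends Y != 0 by apply: (@ends_after _ (A ++ Some Hole :: X) (Mark m)); rewrite -eZ'.
  have [v [Y2 eY]] := first_end endY; rewrite eY in eZ'.
  have eZ1' := ins_up 0 eZ'; rewrite -/Z1 add0n in eZ1'.
  exists (ends (A ++ Some Hole :: X)); split.
  - rewrite eZ1' -(cat1s (Some (Mark m))) !marks_cat !mem_cat.
    by rewrite [_ \in marks (_ :: _ :: _)]mem_head !orbT.
  - right; do 3 eexists; split; first exact: eZ1'.
    move: hB; rewrite eXY eY -(cat1s (Some (Mark m))) !holes_cat => /eqP.
    rewrite !addn_eq0 => /and4P[_ _ + _]; rewrite /holes contents_some.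
    by move=> /eqP/count_memPn.
  - by left; rewrite -endZ eZ' !ends_cat /= !ends_cat /= ends_some !addnS ltnS leq_addr.
pose T1 := relabel r1 T; pose e1 := expansion s T1.
have T1P m : m \in tails T1 -> m \in marks Z1 /\ (m < n \/ m \in marks A).
  by rewrite tails_relabel => /mapP[m0 /Hr1[h1 h2 h3] ->].
have sT1 : size (tails T1) = k by rewrite tails_relabel size_map.
have vT1 : all (mem (marks Z1)) (tails T1) by apply/allP => m /T1P[].
have c1 : cl (plug (expansion s T) Z1) = cl (plug e1 Z1).
  apply: cl_relabel => //; first by apply/allP => m /(allP vT); exact: mZ1.
  by move=> m /Hr1[].
have hwC1 : holes (map Some w ++ C1) = 0 by rewrite holes_cat hC1 holes_some.
have p1 : plug e1 Z1 = A1 ++ hds e1 ++ map Some w ++ C1 by rewrite eZ1 plug_at.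
have v1 : valid (A1 ++ hds e1 ++ map Some w ++ C1).
  rewrite -p1; apply: valid_plug; first by case/andP: cZ1.
  exact: over_expansion.
have uZ : uniq (marks A ++ marks (map Some w) ++ marks (None :: C)).
  by have /and4P[_ _ + _] := vZ; rewrite eZ marks_hole eB !marks_cat.
(* A top mark is below [n] while the marks of [w] are above it; a mark of [A] differs from those of
   [w] by uniqueness. *)
have d1 : {in tails T1, forall m, m \notin marks (map Some w)}.
  move=> m /T1P[_ [mn|mA']]; apply/negP => mwm.
    by have := ltn_trans (gZ _ (mw _ mwm)) mn; rewrite ltnn.
  move: uZ; rewrite cat_uniq => /and3P[_ /hasPn /(_ m) + _].
  by rewrite mem_cat mwm => /(_ isT); rewrite /= mA'.
have [v2 c2] := cl_move_head v1 hA1 hC1 hw d1 sT1.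
have eC1 : ends C1 != 0 by [].
have hA1w : holes (A1 ++ map Some w) = 0 by rewrite holes_cat hA1 holes_some.
pose Z2 := (A1 ++ map Some w) ++ Some Hole :: C1.
have cZ2 : context Z2.
  apply: valid_hole => //; rewrite -catA; apply: (valid_drop (u := e1)).
    exact: v1.
  by rewrite ends_cat ends_some.
pose Z3 := (A1 ++ map Some w) ++ Some (Mark n) :: Some Hole :: C1.
have m12 : marks Z2 = marks Z1 by rewrite eZ1 !marks_hole -catA.
have cZ3 : context Z3 by apply: context_mark => //; rewrite -/Z2 m12.
have p2 : A1 ++ map Some w ++ hds e1 ++ C1 = plug e1 Z2 by rewrite plug_at // -catA.
have c3 : cl (plug e1 Z3) = cl (plug e1 Z2).
  by apply: cl_mark => //; apply: over_expansion; rewrite -/Z2 m12.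
have m13 : {subset marks Z1 <= marks Z3}.
  move=> m; rewrite -m12 /Z2 /Z3 -(cat1s (Some (Mark n))) !marks_cat !mem_cat.
  by case/orP => ->; rewrite ?orbT.
have [r2 Hr2] : exists r, forall m, m \in tails T1 ->
    [/\ r m \in marks Z3, (r m = m \/ exists X v Y,
      Z3 = X ++ Some (Mark m) :: map Some v ++ Some (Mark (r m)) :: Y /\ Hole \notin v)
      & r m <= n].
  apply: (@choice_in (tails T1) (fun m m' => [/\ m' \in marks Z3, (m' = m \/ exists X v Y,
      Z3 = X ++ Some (Mark m) :: map Some v ++ Some (Mark m') :: Y /\ Hole \notin v)
      & m' <= n])) => m /T1P[mZ1' [mn|mA']].
    by exists m; split; [exact: m13|left|exact: ltnW].
  have [X [Y eXY]] := mark_mem mA'.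
  have [hX hY] : holes X = 0 /\ holes Y = 0.
    by move: hA; rewrite eXY -(cat1s (Some (Mark m))) !holes_cat => /eqP; rewrite !addn_eq0 => /and3P[/eqP-> _ /eqP->].
  (* No terminator after [m] in [A] means that [m] is on the strand of the hole, so its tail goes to
     the mark [n]; otherwise it goes to the top of its strand. *)
  have [eY0|endY] := eqVneq (ends Y) 0.
    have [v eY] := no_end eY0.
    exists n; split => //; first by rewrite /Z3 marks_cat mem_cat mem_head orbT.
    right; exists (ins top_mark 0 X), (v ++ w), (Some Hole :: C1); split.
      by rewrite /Z3 /A1 eXY eY ins_cat /= -[map Some v]cats0 ins_some cats0 map_cat -?catA /= -?catA.
    rewrite mem_cat negb_or hw andbT; move: hY; rewrite eY /holes contents_some.
    by move/count_memPn.
  have [v [Y2 eY]] := first_end endY; rewrite eY in eXY.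
  have eA1 := ins_up 0 eXY; rewrite -/A1 add0n in eA1.
  exists (ends X); split.
  - rewrite /Z3 eA1 -(cat1s (Some (Mark m))) !marks_cat !mem_cat.
    by rewrite [_ \in marks (_ :: _ :: _)]mem_head !orbT.
  - right; do 3 eexists; split; first by rewrite /Z3 eA1 -?catA /= -?catA.
    move: hY; rewrite eY holes_cat => /eqP; rewrite addn_eq0 /holes contents_some.
    by move=> /andP[/eqP/count_memPn].
  - apply: leq_trans (ltnW lin); rewrite /i eXY ends_cat; exact: leq_addr.
pose T' := relabel (r2 \o r1) T; pose e' := expansion s T'.
have T'P m : m \in tails T' -> m \in marks Z3 /\ m <= n.
  rewrite /T' -relabel_comp tails_relabel => /mapP[m0 /Hr2[h1 h2 h3] ->] //.
have vT' : all (mem (marks Z3)) (tails T') by apply/allP => m /T'P[].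
have c4 : cl (plug e1 Z3) = cl (plug e' Z3).
  rewrite /e' /T' -relabel_comp; apply: cl_relabel => //.
    by apply/allP => m /T1P[mZ1' _]; exact: m13.
  by move=> m /Hr2[].
exists i, (r2 \o r1); split=> //; first by apply/allP => m /T'P[].
rewrite c1 p1 c2 p2 -c3 c4.
pose q := standard i T' s.
(* The original word is untouched below the inserted material, which now sits at the tops of the
   strands: [cl_stack] applies. *)
have eP : plug e' Z3 = ins q 0 (plug [::] Z).
  rewrite eZ plug_at // cat0s /Z3 -(cat1s (Some (Mark n))) catA plug_at //; last first.
    by rewrite holes_cat hA1w.
  have qi : q i = Mark n :: rcons (map hd e') (Mark i) by rewrite /q /standard eqxx.
  rewrite ins_cat eB ins_some /= add0n -/i qi /=.
  rewrite (ins_eq (q' := top_mark) (j := 0)) => [|j]; last first.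
    by rewrite add0n => /andP[_ ji]; rewrite /q /standard ltn_eqF.
  rewrite (ins_eq (q' := top_mark) (j := i.+1)) => [|j /andP[ji _]]; last first.
    by rewrite /q /standard gtn_eqF.
  by rewrite -!catA /= /C1 map_rcons -cats1 -catA.
have v0 : valid (plug [::] Z) by exact: valid_plug.
have vP : valid (plug e' Z3).
  apply: valid_plug; first by case/andP: cZ3.
  exact: over_expansion.
pose Q := ins q 0 (nseq n None).
have mQ m : m \in marks Q -> m <= n.
  rewrite /marks mem_pmap => /mapP[y /contents_ins_ends[j /andP[_ jn]]].
  rewrite add0n in jn; rewrite /q /standard; case: eqP => [ji|_].
    rewrite inE mem_rcons inE => /or3P[/eqP-> [->]|/eqP-> [->]|/mapP[z _ ->] //] //.
    exact: ltnW.
  by rewrite inE => /eqP-> [->]; exact: ltnW.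
have rQ m : m \in refs Q -> m <= n.
  rewrite /refs mem_pmap => /mapP[y /contents_ins_ends[j /andP[_ jn]]].
  rewrite /q /standard; case: eqP => [ji|_]; last by rewrite inE => /eqP->.
  rewrite inE mem_rcons inE => /or3P[/eqP->|/eqP->|/mapP[z ze ->]] //= -[->].
  by have /T'P[] := expansion_tails (map_f fst ze).
have end0 : ends (plug [::] Z) = n by rewrite ends_bind.
have vQ : valid Q.
  apply/and4P; split.
  - by rewrite ends_ins ends_nseq.
  - by apply: terminated_ins; elim: (n) => //= -[].
  - have /and4P[_ _ + _] := vP; rewrite eP (perm_uniq (marks_ins q end0)) cat_uniq.
    by case/and3P.
  - apply/allP => m mr; have /and4P[_ _ _ /allP r] := vP.
    have := r m; rewrite inE eP (perm_mem (refs_ins q end0)) (perm_mem (marks_ins q end0)).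
    rewrite !mem_cat mr orbT marks_plug => /(_ isT) /orP[/gZ|] //.
    by rewrite ltnNge rQ.
rewrite eP cl_stack // => m; rewrite marks_plug => /gZ nm.
by apply/negP => /mQ; rewrite leqNgt nm.
Qed.

End Standard.

(** * Finite generation by induction on k *)

Section MonoidLaws.
Variables n K : nat.
Implicit Types D E F : diagram n.

Lemma pi_rename D E f : injective f ->
  (forall i, tnth (strands E) i = map (rename f) (tnth (strands D) i)) ->
  \pi_(wSL n K) D = \pi_(wSL n K) E.
Proof.
move=> fI H; apply/wSL_piP/rst_step/Welded/(Renaming fI).
by apply: eq_from_tnth => i; rewrite H tnth_map.
Qed.

Lemma tnth_stack D E i : tnth (strands (stack D E)) i =
  map bottom (tnth (strands D) i) ++ map top (tnth (strands E) i).
Proof. by rewrite tnth_mktuple. Qed.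

(* Names of [D(EF)] to names of [(DE)F]: [2c -> 4c], [4c+1 -> 4c+2], [4c+3 -> 2c+1]. *)
Definition reassociate c :=
  if ~~ odd c then c.*2
  else if odd c./2 then (c./2)./2.*2.+1 else (c./2)./2.*2.+1.*2.

Lemma reassociate_inj : injective reassociate.
Proof. by move=> a b; rewrite /reassociate; (repeat case: ifP); lia. Qed.

Lemma wSL_mulA : associative (@wSL_mul n K).
Proof.
elim/quotW => D; elim/quotW => E; elim/quotW => F.
rewrite (@wSL_mulE n K E F) (@wSL_mulE n K D E) (@wSL_mulE n K D) (@wSL_mulE n K _ F).
apply: (pi_rename reassociate_inj) => i.
rewrite !tnth_stack !map_cat -!catA -!map_comp.
congr (_ ++ (_ ++ _)); apply: eq_map => -[c|c s] /=; rewrite /reassociate;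
  (congr Over || congr Under); case: ifP; try case: ifP; lia.
Qed.

Lemma wSL_mul1 : left_id (wSL_one n K) (@wSL_mul n K).
Proof.
elim/quotW => D; rewrite (@wSL_mulE n K (trivial n) D).
apply/esym/(pi_rename doubleS_injective) => i.
by rewrite tnth_stack [X in map bottom X](tnth_nth [::]) /= nth_nseq if_same.
Qed.

Lemma wSL_mulr1 : right_id (wSL_one n K) (@wSL_mul n K).
Proof.
elim/quotW => D; rewrite (@wSL_mulE n K D (trivial n)).
apply/esym/(pi_rename double_injective) => i.
by rewrite tnth_stack [X in _ ++ map top X](tnth_nth [::]) /= nth_nseq if_same cats0.
Qed.

End MonoidLaws.

(** A right inverse of [x] has a right inverse of its own, which must be [x]. *)
Lemma is_group_of_right_inverses (G : Type) (one : G) (mul : G -> G -> G) :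
  associative mul -> left_id one mul -> right_id one mul ->
  (forall x, exists y, mul x y = one) -> is_group one mul.
Proof.
move=> mA m1 mr1 /choice[inv Hinv]; split=> //; exists inv.
have li : left_inverse one inv mul.
  move=> x; rewrite -[mul _ _]mr1 -{1}(Hinv (inv x)) mA -(mA (inv x) x) Hinv mr1.
  exact: Hinv.
by split.
Qed.

Lemma tails_pos T : 0 < size (tails T).
Proof. by elim: T => //= t X hX Y hY; rewrite size_cat ltn_addr. Qed.

(** * Enumeration of trees *)

Section Trees.
Variable N : nat.

Definition tail_list : seq tree :=
  [seq Tail t j | t <- [:: true; false], j <- iota 0 N.+1].
Definition vertex_list (Ts : seq tree) : seq tree :=
  [seq Vertex txy.1 txy.2.1 txy.2.2 | txy <-
    [seq (t, xy) | t <- [:: true; false], xy <- [seq (X, Y) | X <- Ts, Y <- Ts]]].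
(** Trees of height at most [d], among which are all those with at most [d.+1] leaves. *)
Fixpoint tree_list d : seq tree :=
  tail_list ++ if d is d'.+1 then vertex_list (tree_list d') else [::].

Lemma tree_listE d :
  tree_list d = tail_list ++ if d is d'.+1 then vertex_list (tree_list d') else [::].
Proof. by case: d. Qed.

Lemma has_allpairs (A B C : Type) (p : pred C) (f : A -> B -> C) s t :
  has p [seq f x y | x <- s, y <- t] = has (fun x => has (fun y => p (f x y)) t) s.
Proof. by elim: s => //= x s IH; rewrite has_cat IH has_map. Qed.

(** [tree] is given no decidable equality; quantifying over predicates expresses membership in the
    list. *)
Lemma has_tree_list (p : pred tree) d T : size (tails T) <= d.+1 ->
  all (fun m => m <= N) (tails T) -> p T -> has p (tree_list d).
Proof.
elim: T d p => [t j|t X IX Y IY] d p.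
  move=> _ /andP[jN _] pT.
  have H : has p tail_list.
    rewrite has_allpairs; apply/hasP; exists t; first by case: t {pT}.
    by apply/hasP; exists j; rewrite // mem_iota.
  by rewrite tree_listE has_cat H.
rewrite [tails _]/= size_cat all_cat => szT /andP[NX NY] pT.
case: d szT => [|d] szT.
  by have := leq_add (tails_pos X) (tails_pos Y); rewrite leqNgt ltnS szT.
have szX : size (tails X) <= d.+1.
  by rewrite -ltnS; apply: leq_trans szT; rewrite -addn1 leq_add2l tails_pos.
have szY : size (tails Y) <= d.+1.
  by rewrite -ltnS; apply: leq_trans szT; rewrite -add1n leq_add2r tails_pos.
rewrite tree_listE has_cat; apply/orP; right.
rewrite has_map has_allpairs; apply/hasP; exists t; first by case: t {pT}.
rewrite has_allpairs.
by apply: IX szX NX _; apply: IY szY NY _.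
Qed.

End Trees.

(** * From level k to level k+1 *)

Section Step.
Variables n k : nat.
Local Notation W := (wSL n k.+1).
Local Notation cl := (cl n k.+1).
Local Notation mul := (@wSL_mul n k.+1).

Definition standard_class i s T : W := cl (ins (standard n i T s) 0 (nseq n None)).
Definition generators : seq W :=
  [seq g | is_ <- [seq (i, s) | i <- iota 0 n, s <- [:: true; false]],
           g <- [seq standard_class is_.1 is_.2 T | T <- tree_list n k]].

Lemma generators_in i s T : i < n -> size (tails T) <= k.+1 ->
  all (fun m => m <= n) (tails T) -> standard_class i s T \in generators.
Proof.
move=> lin szT NT; apply/allpairsPdep; exists (i, s), (standard_class i s T); split=> //.
  by apply/allpairsP; exists (i, s); split; rewrite ?mem_iota //=; case: (s).
by rewrite -has_pred1 has_map; apply: has_tree_list szT NT _ => /=.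
Qed.

Lemma context_generator Z T s : context n Z -> all (fun m => n < m) (marks Z) ->
  all (mem (marks Z)) (tails T) -> size (tails T) = k ->
  exists2 g, g \in generators & cl (plug (expansion s T) Z) = mul (cl (plug [::] Z)) g.
Proof.
move=> cZ gZ vT sT; have [i [r [lin NT ->]]] := cl_standard s cZ gZ vT sT.
exists (standard_class i s (relabel r T)) => //.
by apply: generators_in => //; rewrite tails_relabel size_map sT.
Qed.

Lemma surgery_generator T D D' : size (tails (body T)) = k -> surgery T D D' ->
  (exists2 g, g \in generators & \pi_W D' = mul (\pi_W D) g) /\
  (exists2 g, g \in generators & \pi_W D = mul (\pi_W D') g).
Proof.
move=> sT /(surgery_context k.+1)[Z [T' [cZ gZ vT' sT' [-> ->]]]].
rewrite sT in sT'; split; first exact: context_generator.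
set s := from_right T; pose e := expansion s T'.
have oe : over Z e by exact: over_expansion.
(* To undo the surgery, the same tree with opposite sign is inserted next to the first one, now part
   of the context; the two expansions cancel. *)
pose Z' := absorb e [::] Z.
have [|||g gG E] := @context_generator Z' T' (~~ s) _ _ _ sT'.
- exact: context_absorb.
- by rewrite marks_absorb.
- by rewrite marks_absorb.
exists g => //; rewrite -/e.
have <- : cl (plug (expansion (~~ s) T') Z') = cl (plug [::] Z).
  rewrite plug_absorb cats0.
  have [G [phi [l mZ]]] := modelP k.+1 cZ.
  have oe' : over Z (expansion (~~ s) T') by exact: over_expansion.
  have := @model_complete _ _ _ _ _ _ mZ (e ++ expansion (~~ s) T') [::] _ isT _ [::] [::] isT isT.
  rewrite !cats0; apply; first by rewrite all_cat_over oe oe'.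
  rewrite (modelM mZ) (model1 mZ) !(model_expansion mZ).
  by case: (s); rewrite /= ?mulgV ?mulVg.
by rewrite E plug_absorb /= !cats0.
Qed.

(** Both directions are carried along, since the symmetric closure reverses surgeries and
    invertibility of the generators is not yet available. *)
Lemma wk_equiv_generators D D' : wk_equiv k D D' ->
  (exists2 gs, all (mem generators) gs & \pi_W D' = foldl mul (\pi_W D) gs) /\
  (exists2 gs, all (mem generators) gs & \pi_W D = foldl mul (\pi_W D') gs).
Proof.
elim=> {D D'} [D D'|D|D D' _ [H1 H2]|D1 D2 D3 _ [[g1 a1 e1] [h1 b1 f1]] _ [[g2 a2 e2] [h2 b2 f2]]].
- have same : wk_move k.+1 D D' -> \pi_W D = \pi_W D'.
    by move=> mv; apply/wSL_piP; apply: rst_step.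
  case=> [w|T kT sT].
    by rewrite (same (Welded _ w)); split; exists [::].
  have [szT|szT] := eqVneq (size (tails (body T))) k.
    have [[g gG E] [h hG E']] := surgery_generator szT sT.
    by split; [exists [:: g]|exists [:: h]]; rewrite //= ?gG ?hG.
  by rewrite (same (Surgery _ sT)) ?ltn_neqAle 1?eq_sym ?szT ?kT //; split; exists [::].
- by split; exists [::].
- by split.
- split; first by exists (g1 ++ g2); rewrite ?all_cat ?a1 // foldl_cat -e1.
  by exists (h2 ++ h1); rewrite ?all_cat ?b1 ?b2 // foldl_cat -f2.
Qed.

Lemma foldl_mul x gs : foldl mul x gs = mul x (foldl mul (wSL_one n k.+1) gs).
Proof.
elim/last_ind: gs => [|gs g IH]; first by rewrite wSL_mulr1.
by rewrite !foldl_rcons IH wSL_mulA.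
Qed.

Lemma wk_equiv_succ (D D' : diagram n) : wk_equiv k.+1 D D' -> wk_equiv k D D'.
Proof.
elim=> {D D'} [D D' [w|T kT sT]|D|D D' _|D1 D2 D3 _ H1 _ H2].
- exact/rst_step/Welded.
- by apply/rst_step/(Surgery _ sT)/ltnW.
- exact: rst_refl.
- exact: rst_sym.
- exact: rst_trans H1 H2.
Qed.

Lemma group_step :
  is_group (wSL_one n k) (@wSL_mul n k) /\
  finitely_generated (wSL_one n k) (@wSL_mul n k) ->
  is_group (wSL_one n k.+1) (@wSL_mul n k.+1) /\
  finitely_generated (wSL_one n k.+1) (@wSL_mul n k.+1).
Proof.
case=> -[mA m1 mr1 [inv [invl invr]]] [S HS].
have rinv (x : W) : exists y, mul x y = wSL_one n k.+1.
  elim/quotW: x => D.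
  (* [E] represents an inverse of [D] at level [k]; the generators by which [stack D E] differs from
     1 at level [k.+1] are appended to [E]. *)
  have := invr (\pi_(wSL n k) D); rewrite -[inv _]reprK wSL_mulE.
  set E := repr _ => /wSL_piP /wk_equiv_generators [[gs _ E1] _].
  exists (foldl mul (\pi_W E) gs).
  by rewrite foldl_mul wSL_mulA wSL_mulE -foldl_mul -E1.
have grp := is_group_of_right_inverses (@wSL_mulA n k.+1) (@wSL_mul1 n k.+1) (@wSL_mulr1 n k.+1) rinv.
split=> //; exists ([seq \pi_W (repr x) | x <- S] ++ generators) => H [H1 HM HV] HG.
have HGen gs x : all (mem generators) gs -> H x -> H (foldl mul x gs).
  elim: gs x => //= g gs IH x /andP[gG gsG] Hx; apply: IH => //; apply: HM => //.
  by apply: HG; rewrite mem_cat gG orbT.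
(* The image of [H] at level [k]. It contains [S], hence is everything, so any [D] agrees at level
   [k] with some [D0] in [H] and differs from it by generators. *)
pose H' (y : wSL n k) := exists2 D, \pi_(wSL n k) D = y & H (\pi_W D).
have subH' : is_subgroup (wSL_one n k) (@wSL_mul n k) H'.
  split; first by exists (trivial n).
    by move=> x y [D <- HD] [E <- HE]; exists (stack D E); rewrite ?wSL_mulE // -wSL_mulE; apply: HM.
  move=> x y xy [D eD HD].
  (* The inverse of a lift of [x] lies in [H], and its image is [y] because right inverses are
     unique in a group. *)
  have [z Ez] := rinv (\pi_W D); have Hz := HV _ _ Ez HD.
  exists (repr z); last by rewrite reprK.
  move: Ez; rewrite -[z in mul _ z]reprK wSL_mulE => /wSL_piP /wk_equiv_succ /wSL_piP.
  rewrite -wSL_mulE eD -/(wSL_one n k) => Ez.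
  rewrite -[LHS]m1 -[RHS]m1 -(invl x) -!mA xy Ez; by [].
elim/quotW => D.
have [D0 eD HD0] : H' (\pi_(wSL n k) D).
  apply: HS subH' _ _ => x xS; exists (repr x); first exact: reprK.
  by apply: HG; rewrite mem_cat map_f.
have /wSL_piP /wk_equiv_generators [[gs gsG ->] _] := eD.
exact: HGen.
Qed.

End Step.

(** * The base case *)

Lemma cl_no_heads n K P : valid n P -> refs P = [::] -> cl n K P = wSL_one n K.
Proof.
case/and4P => /eqP eP _ _ _ rP.
have h0 : heads (number 0 P) = [::].
  apply: size0nil; rewrite -(size_map snd).
  by rewrite (heads_refs (number 0 P)) erase_number rP.
have noheads (Q : seq (option (item * nat))) : heads Q = [::] ->
    rz (fun=> [::]) Q = nseq (ends Q) None.
  by elim: Q => // -[[[m|m s|] c]|] Q IH //= h; rewrite -IH.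
have eN : ends (number 0 P) = n by rewrite -eP -[in RHS](erase_number 0 P) ends_bind.
rewrite /cl (_ : tails_at (number 0 P) = fun=> [::]); last first.
  by apply/funext => m; rewrite /tails_at h0.
rewrite noheads // eN /kw /wSL_one -(diagK (trivial n)); congr (\pi_(wSL n K) (diag n _)).
by rewrite /dword /=; elim: (n) => //= j ->.
Qed.

Lemma ref_mem P : refs P != [::] -> exists A m s B, P = A ++ Some (Head m s) :: B.
Proof.
elim: P => //= -[[m|m s|]|] P IH; rewrite /refs //= -?/(refs _).
- by move=> /IH[A [q [s [B ->]]]]; exists (Some (Mark m) :: A), q, s, B.
- by exists [::], m, s, P.
- by move=> /IH[A [q [s [B ->]]]]; exists (Some Hole :: A), q, s, B.
- by move=> /IH[A [q [s [B ->]]]]; exists (None :: A), q, s, B.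
Qed.

(** A single head is surgery along a tree with one tail, which level 0 allows; heads are deleted one
    by one. *)
Lemma wSL0_trivial n (x : wSL n 0) : 0 < n -> x = wSL_one n 0.
Proof.
move=> n0; elim/quotW: x => D.
have [P [vP hP ->]] := diagram_cl 0 D n0.
have [r] := ubnP (size (refs P)); elim: r P vP hP => // r IH P vP hP szP.
have [rP|rP] := eqVneq (refs P) [::]; first exact: cl_no_heads.
have [A [m [s [B eP]]]] := ref_mem rP.
have [_ tP _ _] := and4P vP.
have eB : ends B != 0 by apply: (@ends_after _ A (Head m s)); rewrite -eP.
move: hP; rewrite eP -(cat1s (Some _)) !holes_cat => /eqP.
rewrite !addn_eq0 => /and3P[/eqP hA _ /eqP hB].
rewrite eP in vP szP.
have vAB : valid n (A ++ B) := valid_drop (u := [:: (m, s)]) vP eB.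
have cZ := valid_hole vAB eB hA hB.
have /= := over_of_valid (u := [:: (m, s)]) vP; rewrite andbT => mAB.
have := @cl_tree n 0 _ (Tail false m) s cZ; rewrite /= addbF marks_hole mAB.
move=> /(_ isT isT); rewrite !plug_at // => ->.
apply: IH; rewrite ?holes_cat ?hA ?hB //.
by move: szP; rewrite -cat1s !refs_cat !size_cat /= addnS.
Qed.

Theorem theorem3p8 (n k : nat) (hn : 1 <= n) (hk : 1 <= k) :
  is_group (wSL_one n k) (@wSL_mul n k) /\
  finitely_generated (wSL_one n k) (@wSL_mul n k).
Proof.
elim: k {hk} => [|k IH]; last exact: group_step.
have triv x : x = wSL_one n 0 := wSL0_trivial x hn.
split.
  apply: is_group_of_right_inverses; [exact: wSL_mulA|exact: wSL_mul1|exact: wSL_mulr1|].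
  by move=> x; exists x; apply: triv.
by exists [::] => H [H1 _ _] _ x; rewrite (triv x).
Qed.
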